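(* Fix an integer $k$ and let $\lambda$ and $\mu$ be partitions such that $|\lambda|,|\mu|\le k$. Then $$\chi^\lambda_{PP_k}(\mu)=\langle s_\lambda[\Omega-1],\,p_\mu\rangle,$$ and, in particular, if $|\mu|<|\lambda|$ then $\chi^\lambda_{PP_k}(\mu)=0$.
   Context: $\Lambda=\mathbb Q[p_1,p_2,\ldots]$ is the ring of symmetric functions, with Schur functions $s_\lambda$, complete functions $h_n$, power sums $p_\mu=p_{\mu_1}p_{\mu_2}\cdots$ (with $s_\emptyset=p_\emptyset=1$), and Hall scalar product $\langle s_\lambda,s_\mu\rangle=\delta_{\lambda\mu}$, extended to pairings of $\Lambda$ with its graded completion. $\Omega=1+\sum_{n\ge1}h_n$ in the completion. Plethysm: $p_m[f]$ is $f$ with each $p_r$ replaced by $p_{mr}$ (constants fixed), and $g[f]$ is obtained from the power sum expansion of $g$ by replacing each $p_m$ by $p_m[f]$. Propagating partition monoid: for $k\ge1$, $PP_k$ is the set of set partitions $\pi$ of $\{1,\ldots,k\}\cup\{\overline1,\ldots,\overline k\}$ such that every block contains at least one unbarred and at least one barred element. $\pi$ acts on $(\mathbb C^n)^{\otimes k}$ by: on $e_{i_1}\otimes\cdots\otimes e_{i_k}$, assign $e_{i_j}$ to $\overline j$; if two barred elements in the same block are assigned distinct vectors the result is $0$; otherwise the result is $e_{i'_1}\otimes\cdots\otimes e_{i'_k}$, where $e_{i'_j}$ is the common vector assigned to the barred elements in the block of $j$. The product in $PP_k$ is composition of these maps (for $n\ge k$). Rook monoid: $R_n$ is the monoid of $n\times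 n$ $0$-$1$ matrices with at most one $1$ in each row and column (partial injective maps of $[n]$). For $\lambda\vdash m\le n$, its irreducible representation indexed by $\lambda$ is $W^\lambda_{R_n}=\mathbb C\{\text{injective maps }[m]\to[n]\}\otimes_{\mathbb CS_m}W^\lambda_{S_m}$ ($W^\lambda_{S_m}$ the irreducible $S_m$-module), with $\sigma\in R_n$ sending $f$ to $\sigma\circ f$ if the image of $f$ lies in the domain of $\sigma$ and to $0$ otherwise. $R_n$ acts diagonally on $(\mathbb C^n)^{\otimes k}$, and for $n\ge k$ the actions of $R_n$ and $PP_k$ generate each other's centralizers. Characters of $PP_k$, non-empty indices: for a partition $\lambda$ with $1\le|\lambda|\le k$, $W^\lambda_{PP_k}$ is the irreducible $PP_k$-module which is the multiplicity space of $W^\lambda_{R_n}$ in $(\mathbb C^n)^{\otimes k}$ for $n\ge k$, i.e. $(\mathbb C^n)^{\otimes k}\cong\bigoplus_{\lambda}W^\lambda_{R_n}\otimes W^\lambda_{PP_k}$ as $R_n\times PP_k$-modules; $\chi^\lambda_{PP_k}$ is its character. For $\sigma\in S_i$, $1\le i\le k$, let $\sigma[k]\in PP_k$ be obtained from $\{\{\sigma(1),\overline1\},\ldots,\{\sigma(i),\overline i\}\}$ by adding $i+1,\ldots,k$ to the block containing $i$ and $\overline{i+1},\ldots,\overline k$ to the block containing $\overline i$. For $\mu\vdash i$, let $\sigma_\mu\in S_i$ be the permutation of cycle type $\mu$ which is the product of the cycles $(1,2,\ldots,\mu_1)$, $(\mu_1+1,\ldots,\mu_1+\mu_2)$, etc.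 (parts equal to $1$ giving fixed points), and $d_\mu=\sigma_\mu[k]$; the $d_\mu$ represent the generalized conjugacy classes of $PP_k$. Then $\chi^\lambda_{PP_k}(\mu)$ denotes $\chi^\lambda_{PP_k}(d_\mu)$. Empty index: the character table of $PP_k$ is taken to have rows and columns indexed by all partitions of size at most $k$, including the empty partition $\emptyset$, with the entries for $\emptyset$ being $\chi^\emptyset_{PP_k}(\emptyset)=1$, and $\chi^\emptyset_{PP_k}(\mu)=0$ and $\chi^\lambda_{PP_k}(\emptyset)=0$ for non-empty $\mu$ and $\lambda$. *)

(* Defs.v *)
From HB Require Import structures.
From mathcomp Require Import all_boot all_order all_fingroup all_algebra.
From mathcomp Require Import finmap monalg mxrepresentation mxtens.
From mathcomp Require Import complex.
From mathcomp Require Import reals.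

Set Implicit Arguments.
Unset Strict Implicit.
Unset Printing Implicit Defensive.

Import Order.TTheory GRing.Theory Num.Theory.
Local Open Scope ring_scope.

(** * Integer partitions *)

Definition is_part (la : seq nat) : bool := sorted geq la && (0%N \notin la).

(* The partitions la with 1 <= |la| <= k, each listed once: such a la has at
   most k parts, all of them at most k. *)
Definition nonempty_parts (k : nat) : seq (seq nat) :=
  [seq la <- [seq map val (t : seq 'I_k.+1) | t : k.-bseq 'I_k.+1]
     | is_part la && (0 < sumn la <= k)%N].

Lemma sumn_ge_size (la : seq nat) : 0%N \notin la -> (size la <= sumn la)%N.
Proof.
elim: la => //= x la IHla; rewrite inE negb_or eq_sym -lt0n => /andP[x0 /IHla].
by move=> h; rewrite -add1n leq_add.
Qed.

Lemma sumn_ge_mem (la : seq nat) x : x \in la -> (x <= sumn la)%N.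
Proof.
elim: la => //= y la IHla; rewrite inE => /predU1P[->|/IHla h].
  exact: leq_addr.
exact: leq_trans h (leq_addl _ _).
Qed.

Lemma mem_nonempty_parts k la :
  (la \in nonempty_parts k) = is_part la && (0 < sumn la <= k)%N.
Proof.
rewrite mem_filter; case: (boolP (is_part la && _)) => //= /andP[/andP[_ la0] /andP[_ lek]].
have sz : (size [seq (inord x : 'I_k.+1) | x <- la] <= k)%N.
  by rewrite size_map (leq_trans (sumn_ge_size la0)).
apply/imageP; exists (Bseq sz) => //=.
rewrite -map_comp -[LHS]map_id; apply/eq_in_map => x xla /=.
by rewrite inordK // ltnS (leq_trans (sumn_ge_mem xla)).
Qed.

Lemma nonempty_parts_uniq k : uniq (nonempty_parts k).
Proof.
apply: filter_uniq; rewrite map_inj_uniq ?enum_uniq // => s t.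
by move=> /(inj_map val_inj) st; apply: val_inj.
Qed.

(** * Symmetric functions *)

(* Lambda = Q[p_1, p_2, ...]: the variable of index i : nat stands for p_{i+1},
   and monomials are finitely supported exponent functions on nat. *)
Definition Lambda := {malg rat[{cmonom nat}]}.

Definition psum (r : nat) : Lambda := << ucm r.-1 >>.

Definition psum_part (mu : seq nat) : Lambda := \prod_(r <- mu) psum r.

(* h_n is the sum of p_mu / z_mu over the partitions mu of n; as n! / z_mu is
   the number of permutations of cycle type mu, this is the cycle index below. *)
Definition hsym (n : nat) : Lambda :=
  (n`!%:R : rat)^-1 *: \sum_(s : 'S_n) \prod_(c in porbits s) psum #|c|.

(* Jacobi-Trudi: s_la = det (h_{la_i - i + j}), with h_n = 0 for n < 0. *)
Definition schur (la : seq nat) : Lambda :=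
  \det (\matrix_(i < size la, j < size la)
          if (i <= nth 0%N la i + j)%N then hsym (nth 0%N la i + j - i) else 0).

Definition is_hall (B : Lambda -> Lambda -> rat) : Prop :=
  [/\ forall (a : rat) f g h, B (a *: f + g) h = a * B f h + B g h,
      forall (a : rat) f g h, B h (a *: f + g) = a * B h f + B h g &
      forall la mu, is_part la -> is_part mu ->
        B (schur la) (schur mu) = (la == mu)%:R].

(* Degree for the grading in which p_r has degree r. *)
Definition mon_deg (m : {cmonom nat}) : nat :=
  (\sum_(i <- finsupp m) i.+1 * m i)%N.

Definition sym_deg (g : Lambda) : nat := (\max_(m <- msupp g) mon_deg m)%N.

(* The graded completion is the product of the homogeneous components of Lambda;
   F stands for the formal sum of the F d, where F d is homogeneous of degree
   d. *)
Definition Lambda_hat := nat -> Lambda.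

Definition hat_one : Lambda_hat := fun d => (d == 0%N)%:R.

Definition hat_mul (F G : Lambda_hat) : Lambda_hat :=
  fun d => \sum_(i < d.+1) F i * G (d - i)%N.

Definition Omega : Lambda_hat := hsym.

Definition Omega_minus1 : Lambda_hat := fun d => Omega d - hat_one d.

(* p_m[f] for f in Lambda. *)
Definition pleth_psum (m : nat) (f : Lambda) : Lambda :=
  \sum_(t <- msupp f) f@_t *: \prod_(i <- finsupp t) psum (m * i.+1) ^+ t i.

(* p_m[F] for F in the completion: p_m[-] multiplies degrees by m. *)
Definition pleth_psum_hat (m : nat) (F : Lambda_hat) : Lambda_hat :=
  fun d => if (m %| d)%N then pleth_psum m (F (d %/ m)%N) else 0.

(* g[F]; the inner products are taken in the completion. *)
Definition pleth (g : Lambda) (F : Lambda_hat) : Lambda_hat :=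
  fun d => \sum_(t <- msupp g)
    g@_t *: (\big[hat_mul/hat_one]_(i <- finsupp t)
               \big[hat_mul/hat_one]_(j < t i) pleth_psum_hat i.+1 F) d.

(* Extension of a pairing to the completion on the left: components of different
   degrees being orthogonal for the Hall scalar product, those of F of degree
   larger than the degree of g do not contribute. *)
Definition hat_pairing (B : Lambda -> Lambda -> rat)
    (F : Lambda_hat) (g : Lambda) : rat :=
  \sum_(d < (sym_deg g).+1) B (F d) g.

(** * Modules of the symmetric group *)

(* Modules are left modules, written with matrices acting on row vectors from
   the right: the row v is sent by s to v *m rho s.  Since in 'S_m the product
   s * t is "s first, then t", a representation of 'S_m in the sense of
   mx_representation is exactly a left module for the usual composition. *)

Section Specht.

Variables (C : fieldType) (la : seq nat).
Local Notation m := (sumn la).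
Local Notation Sm := [set: 'S_m]%G.

(* The tableau of shape la filled with 0, ..., m-1 in reading order. *)
Definition row_stab : {set 'S_m} :=
  [set s : 'S_m | [forall i, reshape_index la (s i) == reshape_index la i]].

Definition col_stab : {set 'S_m} :=
  [set s : 'S_m | [forall i, reshape_offset la (s i) == reshape_offset la i]].

Definition young_symmetrizer : 'rV[C]_#|Sm| :=
  \sum_(p in row_stab) \sum_(q in col_stab)
    (-1) ^+ odd_perm q *: delta_mx 0 (gring_index Sm (p * q)%g).

Definition specht_module := cyclic_mx (regular_repr C Sm) young_symmetrizer.

Definition specht_dim : nat := \rank specht_module.

Definition specht_repr : mx_representation C Sm specht_dim :=
  submod_repr (cyclic_mx_module (regular_repr C Sm) young_symmetrizer).

End Specht.

(** * The rook monoid *)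

(* Partial injective maps; None means "undefined". *)
Definition is_rook n (s : {ffun 'I_n -> option 'I_n}) : bool :=
  [forall i, forall j, (s i != None) && (s i == s j) ==> (i == j)].

Definition rook n := {s : {ffun 'I_n -> option 'I_n} | is_rook s}.

Definition inj_map m n := {f : {ffun 'I_m -> 'I_n} | injectiveb f}.

Section RookModule.

Variables (C : fieldType) (n : nat) (la : seq nat).
Local Notation m := (sumn la).
Local Notation Inj := (inj_map m n).
Local Notation rho := (specht_repr C la).

(* Left action of R_n on C Inj: f is sent to s o f if the image of f lies in the
   domain of s, and to 0 otherwise. *)
Definition inj_left (s : rook n) : 'M[C]_#|{: Inj}| :=
  \matrix_(a < #|{: Inj}|, b < #|{: Inj}|)
    [forall i, val s (val (enum_val a) i) == Some (val (enum_val b) i)]%:R.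

(* Right action of S_m on C Inj: f is sent to f o t. *)
Definition inj_right (t : 'S_m) : 'M[C]_#|{: Inj}| :=
  \matrix_(a < #|{: Inj}|, b < #|{: Inj}|)
    [forall i, val (enum_val b) i == val (enum_val a) (t i)]%:R.

(* Row space spanned by the (f o t) (x) w - f (x) (t w). *)
Definition balanced_rel :=
  (\sum_(t : 'S_m) (inj_right t *t 1%:M - 1%:M *t rho t))%MS.

(* W^la_{R_n} = C Inj (x)_{C S_m} W^la_{S_m}, as the quotient of
   C Inj (x)_C W^la_{S_m} by balanced_rel. *)
Definition rook_dim : nat := \rank (cokermx balanced_rel).

Definition rook_mx (s : rook n) : 'M[C]_rook_dim :=
  in_factmod balanced_rel
    (val_factmod (1%:M : 'M_rook_dim) *m (inj_left s *t 1%:M)).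

End RookModule.

(** * The propagating partition monoid *)

(* inl j is the unbarred element j, inr j is the barred element j. *)
Definition is_PP k (d : {set {set ('I_k + 'I_k)%type}}) : bool :=
  partition d [set: ('I_k + 'I_k)%type] &&
  [forall B in d, [exists j, inl j \in B] && [exists j, inr j \in B]].

Definition PP k := {d : {set {set ('I_k + 'I_k)%type}} | is_PP d}.

Definition same_block k (d : PP k) (x y : 'I_k + 'I_k) : bool :=
  [exists B in val d, (x \in B) && (y \in B)].

(* (C^n)^{(x) k}, with the basis e_i = e_{i_1} (x) ... (x) e_{i_k} indexed by the
   multi-indices i. *)
Definition multi k n := {ffun 'I_k -> 'I_n}.

Section TensorSpace.

Variables (C : fieldType) (k n : nat).
Local Notation N := #|{: multi k n}|.

Definition rook_tensor (s : rook n) : 'M[C]_N :=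
  \matrix_(a < N, b < N)
    [forall j, val s (enum_val a j) == Some (enum_val b j)]%:R.

(* The basis vector e_i is sent to e_i'. *)
Definition PP_sends (d : PP k) (i i' : multi k n) : bool :=
  [forall j, forall l, same_block d (inr j) (inr l) ==> (i j == i l)] &&
  [forall j, forall l, same_block d (inl j) (inr l) ==> (i' j == i l)].

Definition PP_tensor (d : PP k) : 'M[C]_N :=
  \matrix_(a < N, b < N) (PP_sends d (enum_val a) (enum_val b))%:R.

End TensorSpace.

(* d = d1 d2 in PP_k, i.e. d acts as d2 followed by d1. *)
Definition PP_prod (C : fieldType) k (d1 d2 d : PP k) : Prop :=
  forall n, (k <= n)%N ->
    PP_tensor C n d = PP_tensor C n d2 *m PP_tensor C n d1.

Definition PP_unit (C : fieldType) k (d : PP k) : Prop :=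
  forall n, (k <= n)%N -> PP_tensor C n d = 1%:M.

Record PP_module (C : fieldType) (k : nat) := PPModule {
  PP_dim : nat;
  PP_mx :> PP k -> 'M[C]_PP_dim;
  PP_mx_unit : forall d, PP_unit C d -> PP_mx d = 1%:M;
  PP_mx_prod : forall d1 d2 d,
    PP_prod C d1 d2 d -> PP_mx d = PP_mx d2 *m PP_mx d1
}.

Definition PP_irreducible (C : fieldType) k (M : PP_module C k) : Prop :=
  (0 < PP_dim M)%N /\
  forall U : 'M[C]_(PP_dim M), (forall d, stablemx U (M d)) ->
    U = 0 \/ row_full U.

(* (C^n)^{(x) k} is isomorphic to the direct sum, over the partitions la with
   1 <= |la| <= k, of the W^la_{R_n} (x) W la, as R_n x PP_k-modules; T is the
   matrix of an isomorphism from the direct sum. *)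
Definition tensor_decomposition (C : fieldType) (k n : nat)
    (W : seq nat -> PP_module C k) : Prop :=
  let r := size (nonempty_parts k) in
  let la (i : 'I_r) := nth [::] (nonempty_parts k) i in
  let dim (i : 'I_r) := (rook_dim C n (la i) * PP_dim (W (la i)))%N in
  exists T : 'M[C]_(\sum_i dim i, #|{: multi k n}|),
    [/\ row_free T, row_full T,
        forall s : rook n,
          (\mxdiag_i (rook_mx C (la i) s *t 1%:M : 'M_(dim i))) *m T
            = T *m rook_tensor C k s &
        forall d : PP k,
          (\mxdiag_i (1%:M *t W (la i) d : 'M_(dim i))) *m T
            = T *m PP_tensor C n d].

(** * Conjugacy class representatives and characters *)

(* The product of the cycles (0, ..., mu_1 - 1), (mu_1, ..., mu_1 + mu_2 - 1),
   etc., written with the position (row, offset) of a point in the rows of mu. *)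
Definition cycle_step (mu : seq nat) (x : nat) : nat :=
  let r := reshape_index mu x in
  flatten_index mu r ((reshape_offset mu x).+1 %% nth 0%N mu r).

Lemma row_of_lt (mu : seq nat) (x : nat) : (x < sumn mu)%N ->
  [/\ (reshape_index mu x < size mu)%N,
      (reshape_offset mu x < nth 0%N mu (reshape_index mu x))%N &
      flatten_index mu (reshape_index mu x) (reshape_offset mu x) = x].
Proof.
move=> xmu; split; first exact: reshape_indexP.
  exact: reshape_offsetP.
exact: reshape_indexK.
Qed.

Lemma cycle_step_row (mu : seq nat) (x : nat) : (x < sumn mu)%N ->
  [/\ (cycle_step mu x < sumn mu)%N,
      reshape_index mu (cycle_step mu x) = reshape_index mu x &
      reshape_offset mu (cycle_step mu x) =
        (reshape_offset mu x).+1 %% nth 0%N mu (reshape_index mu x)]%N.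
Proof.
move=> /row_of_lt[r_lt o_lt _].
have lt : ((reshape_offset mu x).+1 %% nth 0 mu (reshape_index mu x)
             < nth 0 mu (reshape_index mu x))%N.
  by rewrite ltn_mod (leq_ltn_trans _ o_lt).
split; [exact: flatten_indexP | exact: flatten_indexKl | exact: flatten_indexKr].
Qed.

Definition cycle_fun (mu : seq nat) (x : 'I_(sumn mu)) : 'I_(sumn mu) :=
  let: And3 lt _ _ := cycle_step_row (ltn_ord x) in Ordinal lt.

Lemma val_cycle_fun mu x : val (@cycle_fun mu x) = cycle_step mu x.
Proof. by rewrite /cycle_fun; case: cycle_step_row. Qed.

Lemma cycle_fun_inj mu : injective (@cycle_fun mu).
Proof.
move=> x y /(congr1 val); rewrite !val_cycle_fun => xy.
have [_ xr xo] := cycle_step_row (ltn_ord x).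
have [_ yr yo] := cycle_step_row (ltn_ord y).
have rE : reshape_index mu x = reshape_index mu y by rewrite -xr -yr xy.
have [_ x_lt xK] := row_of_lt (ltn_ord x).
have [_ y_lt yK] := row_of_lt (ltn_ord y).
apply: val_inj => /=; rewrite -xK -yK rE; congr flatten_index.
have := congr1 (reshape_offset mu) xy; rewrite xo yo rE => /eqP.
rewrite -[X in X == _ %[mod _]]addn1 -[X in _ == X %[mod _]]addn1 eqn_modDr.
by rewrite rE in x_lt; rewrite !modn_small // => /eqP.
Qed.

Definition cycle_perm (mu : seq nat) : 'S_(sumn mu) := perm (@cycle_fun_inj mu).

(* The blocks of s[k]: the one containing the barred element j < i also contains
   the unbarred s j; all x >= i - 1 are put in the block of i - 1, and likewise
   for the barred ones. *)
Definition ext_block k i (s : 'S_i) (j : 'I_i) : {set ('I_k + 'I_k)%type} :=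
  [set z : ('I_k + 'I_k)%type | match z with
           | inl x => minn x i.-1 == s j :> nat
           | inr x => minn x i.-1 == j :> nat
           end].

Definition ext_blocks k i (s : 'S_i) : {set {set ('I_k + 'I_k)%type}} :=
  [set ext_block k s j | j : 'I_i].

Lemma ext_blocksP k i (s : 'S_i) : (0 < i <= k)%N -> is_PP (ext_blocks k s).
Proof.
case: i s => // i s /= ik.
have clamp (x : nat) : (minn x i < i.+1)%N by rewrite ltnS geq_minr.
have emb (j : 'I_i.+1) : exists2 x : 'I_k, minn x i = j & True.
  exists (widen_ord ik j) => //=; apply/minn_idPl; by rewrite -ltnS.
apply/andP; split; last first.
  apply/forall_inP => B /imsetP[j _ ->]; apply/andP; split; apply/existsP.
    by have [x xE _] := emb (s j); exists x; rewrite inE /= xE.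
  by have [x xE _] := emb j; exists x; rewrite inE /= xE.
have uniqj (z : 'I_k + 'I_k) (j1 j2 : 'I_i.+1) :
    z \in ext_block k s j1 -> z \in ext_block k s j2 -> j1 = j2.
  rewrite !inE; case: z => x /= /eqP e1 /eqP e2.
    by apply: (@perm_inj _ s); apply: val_inj; rewrite /= -e1 -e2.
  by apply: val_inj; rewrite /= -e1 -e2.
apply/and3P; split.
- apply/eqP/setP => z; rewrite inE; apply/bigcupP.
  case: z => x.
    exists (ext_block k s ((s^-1)%g (Ordinal (clamp x)))); first exact: imset_f.
    by rewrite inE /= permKV.
  exists (ext_block k s (Ordinal (clamp x))); first exact: imset_f.
  by rewrite inE /=.
- apply/trivIsetP => A B /imsetP[j1 _ ->] /imsetP[j2 _ ->] nAB.
  rewrite -setI_eq0; apply/eqP/setP => z; rewrite !in_setI in_set0.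
  apply/negP => /andP[z1 z2]; move/negP: nAB; apply.
  by rewrite (uniqj _ _ _ z1 z2).
- apply/negP => /imsetP[j _] /setP e; have [x xE _] := emb j.
  by have := e (inr x); rewrite !inE /= xE eqxx.
Qed.

(* d_mu = s_mu[k]; by ext_blocksP it is defined as soon as 1 <= |mu| <= k. *)
Definition d_part k (mu : seq nat) : option (PP k) :=
  insub (ext_blocks k (cycle_perm mu)).

(* The entry (la, mu) of the character table, with the convention for the empty
   partition. *)
Definition chi_PP (C : fieldType) k (W : seq nat -> PP_module C k)
    (la mu : seq nat) : C :=
  if nilp la || nilp mu then (nilp la && nilp mu)%:R
  else if d_part k mu is Some d then \tr (W la d) else 0.

(* Main.v *)
Require Import Defs.
From HB Require Import structures.
From mathcomp Require Import all_boot all_order all_fingroup all_algebra.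
From mathcomp Require Import finmap monalg mxrepresentation mxtens.
From mathcomp Require Import complex ring zify.
From mathcomp Require Import reals.

(* For a permutation s of m <= k points, seen as an element of R_n, the trace of
   s d_mu on the k-th tensor power is F(s), the product over the parts r of mu of
   the number of fixed points of s^r; by the decomposition of the tensor power it
   is also the sum over la of the product of the rook character of s with
   chi^la(mu).  The Frobenius characteristic of the rook character la is
   s_la h_{m - |la|}, so that ch F is the sum of the
   chi^la(mu) s_la h_{m - |la|}.

   On the other side, g |-> <g[Omega - 1], p_mu> takes the value F(s) on the
   product over the cycles c of s of p_|c| + 1, because a d/dp_a multiplies
   p_r[Omega] by r (in degree a) if r divides a and kills it otherwise.  The
   degree l part of this product is adjoint to the multiplication by h_{m - l};
   expanding it in Schur functions shows that ch F is also the sum of the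
   <s_la[Omega - 1], p_mu> s_la h_{m - |la|}.  Comparing the two expressions for
   m = 1, ..., k determines the coefficients successively. *)

(** Two steps behind this outline need an idea of their own. Schur functions are given as
    Jacobi-Trudi determinants and Specht modules by Young symmetrizers. The two are matched by
    triangularity: in its degree s_la is singled out by its pairings with the h_nu for nu
    lexicographically at or above la and with the e_{nu'} for nu below la. For a Young symmetrizer
    these pairings are signed counts of words on the diagram fixed by permutations, where
    transpositions cancel most words.

    The Hall product is known only through the orthonormality of Schur functions. It is rebuilt on
    power sums, where multiplication by p_r is adjoint to r d/dp_r; the skewing formulas then follow
    from Newton's identity n h_n = sum of the p_r h_{n-r} and its dual.

    The pairing with p_mu sees only degrees up to |mu|, so the completion is replaced by polynomials
    in an auxiliary degree variable. Testing on permutations of m points for every m <= k, and not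
    for m = k alone, is what makes the comparison triangular: their trace on W^la is 0 as soon as
    |la| > m. *)

Set Implicit Arguments.
Unset Strict Implicit.
Unset Printing Implicit Defensive.

Import Order.TTheory GRing.Theory Num.Theory.
Local Open Scope ring_scope.

(** * Symmetric functions as polynomials in the power sums *)

(* [Lam] is a copy of [Lambda] whose operations do not reduce: unification would
   otherwise compare products by computing them in the monoid algebra. *)
Record Lam := MkLam { lam_val : Lambda }.

HB.instance Definition _ := [isNew for lam_val].
HB.instance Definition _ := [Choice of Lam by <:].

Fact lam_key : unit. Proof. by []. Qed.
Definition lam0 := locked_with lam_key (MkLam 0).
Definition lam1 := locked_with lam_key (MkLam 1).
Definition lam_add :=
  locked_with lam_key (fun f g => MkLam (lam_val f + lam_val g)).
Definition lam_opp := locked_with lam_key (fun f => MkLam (- lam_val f)).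
Definition lam_mul :=
  locked_with lam_key (fun f g => MkLam (lam_val f * lam_val g)).
Definition lam_scale :=
  locked_with lam_key (fun (c : rat) f => MkLam (c *: lam_val f)).

Lemma lam_val0 : lam_val lam0 = 0. Proof. by rewrite /lam0 unlock. Qed.
Lemma lam_val1 : lam_val lam1 = 1. Proof. by rewrite /lam1 unlock. Qed.
Lemma lam_val_add f g : lam_val (lam_add f g) = lam_val f + lam_val g.
Proof. by rewrite /lam_add unlock. Qed.
Lemma lam_val_opp f : lam_val (lam_opp f) = - lam_val f.
Proof. by rewrite /lam_opp unlock. Qed.
Lemma lam_val_mul f g : lam_val (lam_mul f g) = lam_val f * lam_val g.
Proof. by rewrite /lam_mul unlock. Qed.
Lemma lam_val_scale c f : lam_val (lam_scale c f) = c *: lam_val f.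
Proof. by rewrite /lam_scale unlock. Qed.

Local Definition lamE := (lam_val0, lam_val1, lam_val_add, lam_val_opp, lam_val_mul, lam_val_scale).

Lemma lam_val_inj : injective lam_val.
Proof. by case=> f [g] /= ->. Qed.

Fact lam_addA : associative lam_add.
Proof. by move=> f g h; apply: lam_val_inj; rewrite !lamE addrA. Qed.
Fact lam_addC : commutative lam_add.
Proof. by move=> f g; apply: lam_val_inj; rewrite !lamE addrC. Qed.
Fact lam_add0 : left_id lam0 lam_add.
Proof. by move=> f; apply: lam_val_inj; rewrite !lamE add0r. Qed.
Fact lam_addN : left_inverse lam0 lam_opp lam_add.
Proof. by move=> f; apply: lam_val_inj; rewrite !lamE addNr. Qed.
HB.instance Definition _ :=
  GRing.isZmodule.Build Lam lam_addA lam_addC lam_add0 lam_addN.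

Fact lam_mulA : associative lam_mul.
Proof. by move=> f g h; apply: lam_val_inj; rewrite !lamE mulrA. Qed.
Fact lam_mulC : commutative lam_mul.
Proof. by move=> f g; apply: lam_val_inj; rewrite !lamE mulrC. Qed.
Fact lam_mul1 : left_id lam1 lam_mul.
Proof. by move=> f; apply: lam_val_inj; rewrite !lamE mul1r. Qed.
Fact lam_mulD : left_distributive lam_mul lam_add.
Proof. by move=> f g h; apply: lam_val_inj; rewrite !lamE mulrDl. Qed.
Fact lam_1_neq0 : lam1 != lam0.
Proof. by apply/eqP => /(congr1 lam_val); rewrite !lamE; apply/eqP/oner_neq0. Qed.
HB.instance Definition _ := GRing.Zmodule_isComNzRing.Build Lam
  lam_mulA lam_mulC lam_mul1 lam_mulD lam_1_neq0.

Fact lam_scaleA a b f : lam_scale a (lam_scale b f) = lam_scale (a * b) f.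
Proof. by apply: lam_val_inj; rewrite !lamE scalerA. Qed.
Fact lam_scale1 : left_id 1 lam_scale.
Proof. by move=> f; apply: lam_val_inj; rewrite !lamE scale1r. Qed.
Fact lam_scaleDr : right_distributive lam_scale +%R.
Proof. by move=> a f g; apply: lam_val_inj; rewrite !lamE scalerDr. Qed.
Fact lam_scaleDl f : {morph lam_scale^~ f : a b / a + b}.
Proof. by move=> a b; apply: lam_val_inj; rewrite !lamE scalerDl. Qed.
HB.instance Definition _ := GRing.Zmodule_isLmodule.Build rat Lam
  lam_scaleA lam_scale1 lam_scaleDr lam_scaleDl.
Fact lam_scaleAl a (f g : Lam) : a *: (f * g) = a *: f * g.
Proof. by apply: lam_val_inj; rewrite !lamE scalerAl. Qed.
HB.instance Definition _ := GRing.Lmodule_isLalgebra.Build rat Lam lam_scaleAl.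
HB.instance Definition _ := GRing.Lalgebra_isComAlgebra.Build rat Lam.

Fact lam_val_is_zmod_morphism : zmod_morphism lam_val.
Proof. by move=> f g; rewrite !lamE. Qed.
HB.instance Definition _ := GRing.isZmodMorphism.Build Lam Lambda lam_val
  lam_val_is_zmod_morphism.
Fact lam_val_is_monoid_morphism : monoid_morphism lam_val.
Proof. by split=> [|f g]; rewrite !lamE. Qed.
HB.instance Definition _ := GRing.isMonoidMorphism.Build Lam Lambda lam_val
  lam_val_is_monoid_morphism.
Fact lam_val_is_scalable : scalable lam_val.
Proof. by move=> c f; rewrite !lamE. Qed.
HB.instance Definition _ := GRing.isScalable.Build rat Lam Lambda *:%R lam_val
  lam_val_is_scalable.

Lemma lam_valZ c f : lam_val (c *: f) = c *: lam_val f.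
Proof. exact: lam_val_scale. Qed.

Definition mcf (t : {cmonom nat}) (f : Lam) : rat := (lam_val f)@_t.

Lemma mcfD t f g : mcf t (f + g) = mcf t f + mcf t g.
Proof. by rewrite /mcf !lamE mcoeffD. Qed.
Lemma mcfZ t c f : mcf t (c *: f) = c * mcf t f.
Proof. by rewrite /mcf !lamE mcoeffZ. Qed.
Lemma mcf0 t : mcf t 0 = 0.
Proof. by rewrite /mcf !lamE mcoeff0. Qed.

Definition lsupp (f : Lam) := msupp (lam_val f).

Lemma mcf_neq0 t f : (mcf t f != 0) = (t \in lsupp f).
Proof. exact: mcoeff_neq0. Qed.

Lemma mcf_outdom t f : t \notin lsupp f -> mcf t f = 0.
Proof. exact: mcoeff_outdom. Qed.

Definition mon : {cmonom nat} -> Lam := locked_with lam_key (fun t => MkLam << t >>).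

Lemma mcf_mon t s : mcf s (mon t) = (t == s)%:R.
Proof. by rewrite /mcf /mon unlock mcoeffU1. Qed.

Lemma mon1 : mon mone = 1.
Proof. by rewrite /mon unlock; apply: lam_val_inj; rewrite lamE. Qed.

Lemma monM s t : mon s * mon t = mon (mmul s t).
Proof. by apply: lam_val_inj; rewrite /mon unlock lamE malgM_def fgmulUU mulr1. Qed.

Lemma lsupp_mon t : lsupp (mon t) = [fset t]%fset.
Proof. by rewrite /lsupp /mon unlock msuppU1. Qed.

Lemma lam_monE f : f = \sum_(t <- lsupp f) mcf t f *: mon t.
Proof.
apply: lam_val_inj; rewrite raddf_sum [LHS]monalgE; apply: eq_bigr => t _.
rewrite /= lam_valZ; apply/malgP => s; rewrite mcoeffZ [LHS]mcoeffU.
by rewrite -[mcoeff s _]/(mcf s _) mcf_mon mulr_natr.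
Qed.

Definition pw : nat -> Lam := locked_with lam_key (fun r => mon (ucm r.-1)).

Lemma pwE r : pw r = mon (ucm r.-1).
Proof. by rewrite /pw unlock. Qed.

Lemma lam_val_pw r : lam_val (pw r) = psum r.
Proof. by rewrite pwE /mon unlock. Qed.

Section LinearExtension.

Variables (V : lmodType rat) (h : {cmonom nat} -> V).

Definition lin_ext (f : Lam) : V := \sum_(t <- lsupp f) mcf t f *: h t.

Lemma lin_extE f (d : {fset {cmonom nat}}) :
  (lsupp f `<=` d)%fset -> lin_ext f = \sum_(t <- d) mcf t f *: h t.
Proof.
move=> le; rewrite /lin_ext (big_fset_incl _ le) // => t _ /mcf_outdom ->.
by rewrite scale0r.
Qed.

Lemma lin_ext_is_linear : linear lin_ext.
Proof.
(* The three supports differ, so all sums are first written over one common finite set. *)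
move=> a f g; set d := (lsupp f `|` lsupp g `|` lsupp (a *: f + g)%R)%fset.
have lf : (lsupp f `<=` d)%fset by rewrite /d -fsetUA fsubsetUl.
have lg : (lsupp g `<=` d)%fset.
  by rewrite /d -fsetUA (fsubset_trans (fsubsetUl _ _) (fsubsetUr _ _)).
rewrite (lin_extE lf) (lin_extE lg) (lin_extE (fsubsetUr _ _ : (_ `<=` d)%fset)).
rewrite scaler_sumr -big_split; apply: eq_bigr => t _ /=.
by rewrite mcfD mcfZ scalerDl scalerA.
Qed.

HB.instance Definition _ :=
  GRing.isLinear.Build rat Lam V *:%R lin_ext lin_ext_is_linear.

Lemma lin_ext_mon t : lin_ext (mon t) = h t.
Proof. by rewrite /lin_ext lsupp_mon big_seq_fset1 mcf_mon eqxx scale1r. Qed.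

End LinearExtension.

Lemma cmonom_ind (P : {cmonom nat} -> Prop) :
  P mone -> (forall i t, P t -> P (mmul (ucm i) t)) -> forall t, P t.
Proof.
move=> P1 PM t; have [n] := ubnP (mdeg t).
elim: n t => // n IHn t; rewrite ltnS => tn.
have [->|t1] := eqVneq t mone; first by [].
have [i it] : exists i, i \in finsupp t.
  apply/fset0Pn; apply: contraNneq t1 => t0.
  by apply/eqP/eqP/cmP => i; rewrite cm1; apply/eqP; rewrite cmE_eq0 t0.
have tE : t = mmul (ucm i) (divcm t (ucm i)).
  apply/eqP/cmP => j; rewrite cmM divcmE cmU; have [<-|] //= := eqVneq i j.
    by rewrite subnKC // lt0n cmE_neq0.
  by rewrite subn0.
rewrite tE; apply/PM/IHn; move: tn.
by rewrite [in mdeg t]tE mdegM mdegU.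
Qed.

(** Each monomial is reached from 1 by multiplying by generators, so an identity between morphisms
    or derivations only has to be propagated along [pw i.+1 * f]. *)
Lemma lam_ind (P : Lam -> Prop) :
    (forall c f g, P f -> P g -> P (c *: f + g)) -> P 1 ->
    (forall i f, P f -> P (pw i.+1 * f)) -> forall f, P f.
Proof.
move=> Plin P1 PM f.
have P0 : P 0 by rewrite -[0](addNr 1) -scaleN1r; apply: Plin.
have PU t : P (mon t).
  elim/cmonom_ind: t => [|i t IHt]; first by rewrite mon1.
  by rewrite -monM -[mon (ucm i)]/(mon (ucm i.+1.-1)) -pwE; apply: PM.
rewrite [f]lam_monE; elim/big_rec: _ => // t g _ Pg.
exact: (Plin _ _ _ (PU t) Pg).
Qed.

Lemma linear_eq_mon (V : lmodType rat) (F G : Lam -> V) :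
  linear F -> linear G -> (forall t, F (mon t) = G (mon t)) -> F =1 G.
Proof.
move=> linF linG FG f.
pose F' := GRing.isLinear.Build rat Lam V *:%R F linF.
pose G' := GRing.isLinear.Build rat Lam V *:%R G linG.
pose FL : {linear Lam -> V} := HB.pack F F'.
pose GL : {linear Lam -> V} := HB.pack G G'.
rewrite -[F]/(FL : _ -> _) -[G]/(GL : _ -> _).
rewrite [f]lam_monE !linear_sum; apply: eq_bigr => t _.
by rewrite !linearZ /= FG.
Qed.

Lemma bilinear_eq_mon (V : lmodType rat) (F G : Lam -> Lam -> V) :
  (forall g, linear (F^~ g)) -> (forall g, linear (G^~ g)) ->
  (forall f, linear (F f)) -> (forall f, linear (G f)) ->
  (forall s t, F (mon s) (mon t) = G (mon s) (mon t)) -> forall f g, F f g = G f g.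
Proof.
move=> F1 G1 F2 G2 FG f g.
by apply: (linear_eq_mon (F1 g) (G1 g)) => s; apply: linear_eq_mon.
Qed.

Section Evaluation.

Variables (A : comAlgType rat).
Implicit Types (x : nat -> A) (f g : Lam) (t : {cmonom nat}).

Definition mon_eval x t : A := \prod_(i <- finsupp t) x i ^+ t i.

Lemma mon_evalE x t (d : {fset nat}) :
  (finsupp t `<=` d)%fset -> mon_eval x t = \prod_(i <- d) x i ^+ t i.
Proof.
move=> le; rewrite /mon_eval (big_fset_incl _ le) // => i _.
by rewrite -cmE_neq0 negbK => /eqP ->.
Qed.

Lemma mon_eval1 x : mon_eval x mone = 1.
Proof. by rewrite /mon_eval mdom1 big_seq_fset0. Qed.

Lemma mon_evalM x s t : mon_eval x (mmul s t) = mon_eval x s * mon_eval x t.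
Proof.
rewrite (mon_evalE x (fsubsetUl (finsupp s) (finsupp t))).
rewrite (mon_evalE x (fsubsetUr (finsupp s) (finsupp t))).
rewrite /mon_eval mdomD -big_split; apply: eq_bigr => i _ /=.
by rewrite cmM exprD.
Qed.

Lemma mon_evalU x i : mon_eval x (ucm i) = x i.
Proof. by rewrite /mon_eval mdomU big_seq_fset1 cmUU. Qed.

Definition ev x : Lam -> A := locked_with lam_key (lin_ext (mon_eval x)).

Lemma ev_mon x t : ev x (mon t) = mon_eval x t.
Proof. by rewrite /ev unlock lin_ext_mon. Qed.

Lemma ev_is_linear x : linear (ev x).
Proof. by rewrite /ev unlock; exact: linearP. Qed.
HB.instance Definition _ x :=
  GRing.isLinear.Build rat Lam A *:%R (ev x) (ev_is_linear x).

Lemma ev_is_multiplicative x : monoid_morphism (ev x).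
Proof.
split=> [|f g]; first by rewrite -mon1 ev_mon mon_eval1.
apply: (bilinear_eq_mon (F := fun f g => ev x (f * g))
  (G := fun f g => ev x f * ev x g)) => [h|h|h|h|s t].
- by move=> a f1 f2; rewrite mulrDl -scalerAl linearP.
- by move=> a f1 f2; rewrite linearP mulrDl -scalerAl.
- by move=> a f1 f2; rewrite mulrDr -scalerAr linearP.
- by move=> a f1 f2; rewrite linearP mulrDr -scalerAr.
by rewrite monM !ev_mon mon_evalM.
Qed.
HB.instance Definition _ x :=
  GRing.isMonoidMorphism.Build Lam A (ev x) (ev_is_multiplicative x).

Lemma ev_pw x r : ev x (pw r) = x r.-1.
Proof. by rewrite pwE ev_mon mon_evalU. Qed.

End Evaluation.

(** * The derivations adjoint to multiplication by power sums *)

(* [dp i] is (i+1) d/dp_{i+1}. *)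
Definition dp_mon (i : nat) (t : {cmonom nat}) : Lam :=
  (i.+1 * t i)%:R *: mon (divcm t (ucm i)).

Definition dp i : Lam -> Lam := locked_with lam_key (lin_ext (dp_mon i)).

Lemma dp_lin i : linear (dp i).
Proof. by rewrite /dp unlock; exact: linearP. Qed.

HB.instance Definition _ i :=
  GRing.isLinear.Build rat Lam Lam *:%R (dp i) (dp_lin i).

Lemma dp_monE i t : dp i (mon t) = (i.+1 * t i)%:R *: mon (divcm t (ucm i)).
Proof. by rewrite /dp unlock lin_ext_mon. Qed.

(** If the variable is absent from [s], the truncated quotients are meaningless but the coefficient
    vanishes; otherwise the division takes place inside [s]. *)
Lemma dp_mulUl i (s t : {cmonom nat}) :
  (s i)%:R *: mon (divcm (mmul s t) (ucm i))
    = (s i)%:R *: (mon (divcm s (ucm i)) * mon t).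
Proof.
have [->|s0] := posnP (s i); first by rewrite !scale0r.
congr (_ *: _); rewrite monM; congr (mon _); apply/eqP/cmP => j.
rewrite divcmE !cmM divcmE cmU; have [<-|] := eqVneq i j; last by rewrite !subn0.
by rewrite addnBAC.
Qed.

Lemma dpM i f g : dp i (f * g) = dp i f * g + f * dp i g.
Proof.
apply: (bilinear_eq_mon (F := fun f g => dp i (f * g))
  (G := fun f g => dp i f * g + f * dp i g)) => [h|h|h|h|s t].
- by move=> a f1 f2; rewrite mulrDl -scalerAl linearP.
- by move=> a f1 f2; rewrite linearP !mulrDl -!scalerAl addrACA scalerDr.
- by move=> a f1 f2; rewrite mulrDr -scalerAr linearP.
- by move=> a f1 f2; rewrite linearP !mulrDr -!scalerAr addrACA scalerDr.
rewrite monM !dp_monE cmM mulnDr natrD scalerDl; congr (_ + _).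
  by rewrite natrM -[LHS]scalerA dp_mulUl -[in RHS]scalerA !scalerAl.
rewrite mulrC [mmul s t]mulmC natrM -[LHS]scalerA dp_mulUl -[in RHS]scalerA.
by rewrite !scalerAl.
Qed.

Lemma dp1 i : dp i 1 = 0.
Proof. by rewrite -mon1 dp_monE cm1 muln0 scale0r. Qed.

Lemma dp_pw i j : dp i (pw j.+1) = (i.+1 * (j == i))%:R.
Proof.
rewrite pwE dp_monE cmU; have [->|] := eqVneq j i; last by rewrite muln0 scale0r.
rewrite muln1 (_ : divcm _ _ = mone) ?mon1 ?scaler_nat //.
by apply/eqP/cmP => k; rewrite divcmE subnn cm1.
Qed.

(** * The Hall scalar product *)

(* z_mu, for the partition mu with [t i] parts equal to [i.+1]. *)
Definition zee (t : {cmonom nat}) : nat :=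
  (\prod_(i <- finsupp t) (i.+1 ^ t i * (t i)`!))%N.

Lemma zeeE (t : {cmonom nat}) (d : {fset nat}) :
  (finsupp t `<=` d)%fset -> zee t = (\prod_(i <- d) (i.+1 ^ t i * (t i)`!))%N.
Proof.
move=> le; rewrite /zee (big_fset_incl _ le) // => i _.
by rewrite -cmE_neq0 negbK => /eqP ->.
Qed.

Lemma zeeMU i (t : {cmonom nat}) :
  zee (mmul (ucm i) t) = (i.+1 * (t i).+1 * zee t)%N.
Proof.
pose d := finsupp (mmul (ucm i) t).
have id : i \in d by rewrite -cmE_neq0 cmM cmUU.
have td : (finsupp t `<=` d)%fset by rewrite /d mdomD fsubsetUr.
rewrite (zeeE (fsubset_refl d)) (zeeE td) !(big_fsetD1 i id) /= cmM cmUU mulnA.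
congr (_ * _)%N.
  by rewrite add1n expnS factS [LHS]mulnACA.
apply: eq_fbigr => j; rewrite in_fsetD1 => /andP[ji _].
by rewrite cmM cmU eq_sym (negPf ji).
Qed.

(** The Hall product in the form <p_mu, p_nu> = z_mu if mu = nu and 0 otherwise. This choice makes
    [dp] an adjoint; orthonormality of the Schur functions becomes the theorem [sch_orth]. *)
Definition hform (f g : Lam) : rat :=
  locked_with lam_key (fun f g => lin_ext (fun t => mcf t g * (zee t)%:R : rat^o) f) f g.

Lemma hform_linearl g : linear (hform^~ g : Lam -> rat^o).
Proof. by move=> a f1 f2; rewrite /hform unlock linearP. Qed.

Lemma hform_monl t g : hform (mon t) g = mcf t g * (zee t)%:R.
Proof. by rewrite /hform unlock lin_ext_mon. Qed.

Lemma hform_linearr f : linear (hform f : Lam -> rat^o).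
Proof.
move=> a g1 g2; move: f; apply: linear_eq_mon => [b f1 f2|b f1 f2|t].
- by rewrite hform_linearl.
- rewrite !hform_linearl !scalerDr !scalerA addrACA.
  by congr (_ *: _ + _ + _); rewrite mulrC.
by rewrite !hform_monl mcfD mcfZ mulrDl -mulrA.
Qed.

Lemma hformC f g : hform f g = hform g f.
Proof.
move: f g; apply: (@bilinear_eq_mon rat^o);
  try exact: hform_linearl; try exact: hform_linearr.
move=> s t; rewrite !hform_monl !mcf_mon.
by have [->|] := eqVneq t s; rewrite ?eqxx // !mul0r.
Qed.

Lemma hformDl f1 f2 g : hform (f1 + f2) g = hform f1 g + hform f2 g.
Proof. by have := hform_linearl g 1 f1 f2; rewrite !scale1r. Qed.

Lemma hform0l g : hform 0 g = 0.
Proof. by have := hformDl 0 0 g; rewrite addr0 -[LHS]addr0 => /addrI. Qed.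

Lemma hformZl c f g : hform (c *: f) g = c * hform f g.
Proof. by have := hform_linearl g c f 0; rewrite addr0 hform0l addr0. Qed.

Lemma hformZr c f g : hform f (c *: g) = c * hform f g.
Proof. by rewrite hformC hformZl hformC. Qed.

Lemma hform_suml I r (P : pred I) (F : I -> Lam) g :
  hform (\sum_(i <- r | P i) F i) g = \sum_(i <- r | P i) hform (F i) g.
Proof.
by apply: (big_morph (hform^~ g)) => [f1 f2|]; rewrite (hformDl, hform0l).
Qed.

Lemma hform_sumr I r (P : pred I) (F : I -> Lam) g :
  hform g (\sum_(i <- r | P i) F i) = \sum_(i <- r | P i) hform g (F i).
Proof. by rewrite hformC hform_suml; apply: eq_bigr => i _; rewrite hformC. Qed.

(** On monomials both sides vanish unless s = p_{i+1} t, and then z_s is z_t times i + 1 times the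
    exponent of p_{i+1} in s, the factor produced by [dp i]. *)
Lemma hform_dp i f g : hform (dp i f) g = hform f (pw i.+1 * g).
Proof.
move: f g; apply: (@bilinear_eq_mon rat^o) => [g a f1 f2|g a f1 f2|f a g1 g2|f a g1 g2|s t].
- by rewrite linearP hform_linearl.
- by rewrite hform_linearl.
- by rewrite hform_linearr.
- by rewrite mulrDr -scalerAr hform_linearr.
rewrite dp_monE pwE monM hformZl !hform_monl !mcf_mon /=.
have [s0|s0] := posnP (s i).
  rewrite s0 muln0 mul0r; case: eqP => [E|]; last by rewrite mul0r.
  by move: s0; rewrite -E cmM cmUU.
have sE : s = mmul (ucm i) (divcm s (ucm i)).
  apply/eqP/cmP => j; rewrite cmM divcmE cmU; have [<-|] //= := eqVneq i j.
    by rewrite subnKC.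
  by rewrite subn0.
rewrite [in zee s]sE zeeMU divcmE cmUU subn1 prednK // natrM mulrCA.
rewrite -!natrM; congr (GRing.natmul _ (nat_of_bool _ * _)).
apply/eqP/eqP => [->|tE]; first by rewrite -sE.
by apply/eqP/cmP => j; rewrite divcmE -tE cmM addKn.
Qed.

Definition eps (f : Lam) : rat := mcf mone f.

Lemma hform1 f : hform f 1 = eps f.
Proof. by rewrite hformC -mon1 hform_monl /zee mdom1 big_seq_fset0 mulr1. Qed.

Lemma eps1 : eps 1 = 1.
Proof. by rewrite /eps -mon1 mcf_mon eqxx. Qed.

Lemma epsM f g : eps (f * g) = eps f * eps g.
Proof. by rewrite /eps /mcf lam_val_mul; exact: rmorphM. Qed.

Lemma eps_pw r : eps (pw r) = 0.
Proof.
rewrite /eps pwE mcf_mon; case: eqP => // /eqP/cmP/(_ r.-1).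
by rewrite cmUU cm1.
Qed.

(** * Homogeneous components *)

Lemma mon_degE (t : {cmonom nat}) (d : {fset nat}) :
  (finsupp t `<=` d)%fset -> mon_deg t = (\sum_(i <- d) i.+1 * t i)%N.
Proof.
move=> le; rewrite /mon_deg (big_fset_incl _ le) // => i _.
by rewrite -cmE_neq0 negbK => /eqP ->; rewrite muln0.
Qed.

Lemma mon_degM (s t : {cmonom nat}) : mon_deg (mmul s t) = (mon_deg s + mon_deg t)%N.
Proof.
rewrite (mon_degE (fsubsetUl (finsupp s) (finsupp t))).
rewrite (mon_degE (fsubsetUr (finsupp s) (finsupp t))).
rewrite /mon_deg mdomD -big_split; apply: eq_bigr => i _ /=.
by rewrite cmM mulnDr.
Qed.

Lemma mon_deg1 : mon_deg mone = 0%N.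
Proof. by rewrite /mon_deg mdom1 big_seq_fset0. Qed.

Lemma mon_degU i : mon_deg (ucm i) = i.+1.
Proof. by rewrite /mon_deg mdomU big_seq_fset1 cmUU muln1. Qed.

Definition homog (d : nat) (f : Lam) : Prop :=
  forall t, mcf t f != 0 -> mon_deg t = d.

Lemma homog0 d : homog d 0.
Proof. by move=> t; rewrite mcf0 eqxx. Qed.

Lemma homogD d f g : homog d f -> homog d g -> homog d (f + g).
Proof.
move=> hf hg t; rewrite mcfD.
have [->|/hf //] := eqVneq (mcf t f) 0; rewrite add0r; exact: hg.
Qed.

Lemma homogZ d c f : homog d f -> homog d (c *: f).
Proof. by move=> hf t; rewrite mcfZ mulf_eq0 negb_or => /andP[_ /hf]. Qed.

Lemma homog_mon t : homog (mon_deg t) (mon t).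
Proof. by move=> s; rewrite mcf_mon; case: (t =P s) => [->|]; rewrite ?eqxx. Qed.

Lemma homog1 : homog 0 1.
Proof. by rewrite -mon1 -mon_deg1; exact: homog_mon. Qed.

Lemma homog_pw r : (0 < r)%N -> homog r (pw r).
Proof.
by case: r => // i _; rewrite pwE -[X in homog X](mon_degU i); exact: homog_mon.
Qed.

Lemma homogM d e f g : homog d f -> homog e g -> homog (d + e) (f * g).
Proof.
move=> hf hg t; rewrite mcf_neq0 /lsupp lam_val_mul => /msuppM_le[s [s']].
by rewrite -!mcf_neq0 => -[/hf <- /hg <- ->]; exact: mon_degM.
Qed.

Lemma homog_sum d I r (P : pred I) (F : I -> Lam) :
  (forall i, P i -> homog d (F i)) -> homog d (\sum_(i <- r | P i) F i).
Proof. by move=> h; apply: big_ind => //; [exact: homog0|exact: homogD]. Qed.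

Lemma homog_prod I r (P : pred I) (e : I -> nat) (F : I -> Lam) :
  (forall i, P i -> homog (e i) (F i)) ->
  homog (\sum_(i <- r | P i) e i) (\prod_(i <- r | P i) F i).
Proof. by move=> h; apply: big_ind2 => //; [exact: homog1|move=> *; exact: homogM]. Qed.

Lemma homog_eps d f : homog d f -> (0 < d)%N -> eps f = 0.
Proof.
move=> hf d0; apply/eqP; rewrite /eps; apply: contraLR d0 => /hf <-.
by rewrite mon_deg1.
Qed.

Lemma hform_homog d e f g : homog d f -> homog e g -> d != e -> hform f g = 0.
Proof.
move=> hf hg de; rewrite [f]lam_monE hform_suml big1_seq // => t /andP[_].
rewrite -mcf_neq0 => /hf tE; rewrite hformZl hform_monl.
have [->|/hg tE'] := eqVneq (mcf t g) 0; first by rewrite mul0r mulr0.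
by rewrite -tE -tE' eqxx in de.
Qed.

(** * Cycle types *)

Section Orbits.

Implicit Types (T : finType).

Lemma porbit_stable T (s : {perm T}) (A : {set T}) z :
  (forall y, y \in A -> s y \in A) -> z \in A -> porbit s z \subset A.
Proof.
move=> sA zA; apply/subsetP => y /porbitP[k ->].
by elim: k => [|k IHk]; rewrite ?expg0 ?perm1 // expgSr permM sA.
Qed.

(** The intertwining is asked only along the orbit of [z], because in [rooted_prod_lift] it fails on
    the orbit into which a point is inserted. *)
Lemma porbit_morph T T' (f : T -> T') (s : {perm T}) (s' : {perm T'}) z :
  (forall y, y \in porbit s z -> s' (f y) = f (s y)) ->
  porbit s' (f z) = f @: porbit s z.
Proof.
move=> fs; have fk k : (s' ^+ k)%g (f z) = f ((s ^+ k)%g z).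
  elim: k => [|k IHk]; first by rewrite !expg0 !perm1.
  by rewrite !expgSr !permM IHk fs // mem_porbit.
apply/setP => y; apply/porbitP/imsetP => [[k ->]|[w /porbitP[k ->] ->]].
  by exists ((s ^+ k)%g z); rewrite ?mem_porbit.
by exists k.
Qed.

Lemma porbit_in T (s : {perm T}) c z : c \in porbits s -> z \in c -> c = porbit s z.
Proof. by case/imsetP => y _ -> zy; apply/esym/eqP; rewrite eq_porbit_mem. Qed.

(** [f1] and [f2] present [T] as a disjoint union of two stable parts, and every orbit lies in one
    of them. [F] sees the orbit and not just its size, since rooted products single out a point. *)
Lemma porbits_prod_morph (R : comPzSemiRingType) T T1 T2
    (f1 : T1 -> T) (f2 : T2 -> T) (s : {perm T}) (s1 : {perm T1}) (s2 : {perm T2})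
    (F : {set T} -> R) :
  injective f1 -> injective f2 -> (forall y z, f1 y != f2 z) ->
  (forall x, (exists y, x = f1 y) \/ (exists z, x = f2 z)) ->
  (forall y, s (f1 y) = f1 (s1 y)) -> (forall z, s (f2 z) = f2 (s2 z)) ->
  \prod_(c in porbits s) F c
    = (\prod_(c in porbits s1) F (f1 @: c)) * (\prod_(c in porbits s2) F (f2 @: c)).
Proof.
move=> if1 if2 f12 fT fs1 fs2.
have o1 y : porbit s (f1 y) = f1 @: porbit s1 y by apply: porbit_morph.
have o2 z : porbit s (f2 z) = f2 @: porbit s2 z by apply: porbit_morph.
pose P1 := [set f1 @: c | c : {set T1} in porbits s1].
pose P2 := [set f2 @: c | c : {set T2} in porbits s2].
have sE : porbits s = P1 :|: P2.
  apply/setP => c; rewrite inE; apply/imsetP/orP => [[x _ ->]|].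
    case: (fT x) => -[y ->]; rewrite (o1, o2); [left|right];
      by apply: imset_f; apply: imset_f.
  case=> /imsetP[d /imsetP[y _ ->] ->].
    by exists (f1 y); rewrite ?o1.
  by exists (f2 y); rewrite ?o2.
rewrite sE (eq_bigl [predU P1 & P2]) => [|c]; last by rewrite in_setU.
rewrite bigU /=; last first.
  rewrite -setI_eq0; apply/eqP/setP => c; rewrite !inE; apply/negP.
  case/andP => /imsetP[d1 /imsetP[y _ ->] ->] /imsetP[d2 /imsetP[z _ ->]] /setP.
  move=> /(_ (f1 y)); rewrite imset_f ?porbit_id // => /esym/imsetP[w _] /eqP.
  by rewrite (negPf (f12 _ _)).
congr (_ * _); rewrite big_imset //= => c d _ _.
  exact: (imset_inj if1).
exact: (imset_inj if2).
Qed.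

End Orbits.

Section CycleProduct.

Variables (R : comNzRingType) (p : nat -> R).
Implicit Types T : finType.

Definition cycle_prod T (s : {perm T}) : R := \prod_(c in porbits s) p #|c|.

Lemma cycle_prod_sum T T1 T2 (f1 : T1 -> T) (f2 : T2 -> T)
    (s : {perm T}) (s1 : {perm T1}) (s2 : {perm T2}) :
  injective f1 -> injective f2 -> (forall y z, f1 y != f2 z) ->
  (forall x, (exists y, x = f1 y) \/ (exists z, x = f2 z)) ->
  (forall y, s (f1 y) = f1 (s1 y)) -> (forall z, s (f2 z) = f2 (s2 z)) ->
  cycle_prod s = cycle_prod s1 * cycle_prod s2.
Proof.
move=> if1 if2 f12 fT fs1 fs2.
rewrite /cycle_prod (porbits_prod_morph _ if1 if2 f12 fT fs1 fs2).
by congr (_ * _); apply: eq_bigr => c _; rewrite card_imset.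
Qed.

Lemma porbits_prod_bij T T1 (f : T1 -> T)
    (s : {perm T}) (s1 : {perm T1}) (F : {set T} -> R) :
  bijective f -> (forall y, s (f y) = f (s1 y)) ->
  \prod_(c in porbits s) F c = \prod_(c in porbits s1) F (f @: c).
Proof.
move=> [g fK gK] fs.
(* A bijection is a decomposition whose second part is empty. *)
rewrite (@porbits_prod_morph R T T1 void f (of_void T) s s1 1%g) //.
- rewrite [X in _ * X]big1 ?mulr1 // => c /imsetP[] [].
- exact: can_inj fK.
- by move=> x; left; exists (g x).
Qed.

Lemma cycle_prod_conj T (s t : {perm T}) : cycle_prod (s ^ t) = cycle_prod s.
Proof.
rewrite /cycle_prod (@porbits_prod_bij T T t (s ^ t)%g s); first last.
- by move=> y; rewrite permJ.
- by exists (t^-1)%g; [exact: permK|exact: permKV].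
by apply: eq_bigr => c _; rewrite card_imset //; exact: perm_inj.
Qed.

Lemma cycle_prodV T (s : {perm T}) : cycle_prod s^-1 = cycle_prod s.
Proof. by rewrite /cycle_prod porbitsV. Qed.

(** The product sends [ord0] to [j], so it determines [j] and then [t]; surjectivity is the count
    (n+1)! = (n+1) n!. *)
Lemma sum_insert (V : nmodType) n (F : 'S_n.+1 -> V) :
  \sum_s F s = \sum_(j < n.+1) \sum_(t : 'S_n) F (lift_perm ord0 ord0 t * tperm ord0 j)%g.
Proof.
pose h (u : 'I_n.+1 * 'S_n) := (lift_perm ord0 ord0 u.2 * tperm ord0 u.1)%g.
rewrite pair_big /= (reindex h) //.
apply/onW_bij/inj_card_bij; last by rewrite card_prod card_ord !card_Sn.
move=> [j t] [j' t']; rewrite /h /= => E.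
have jj : j = j'.
  by have /permP/(_ ord0) := E; rewrite !permM !lift_perm_id !tpermL.
rewrite jj in E *; congr (_, _); apply/permP => i.
have /permP/(_ (lift ord0 i)) := mulIg _ _ _ E.
by rewrite !lift_perm_lift => /lift_inj.
Qed.

(* The weight of [s] with the factor of the cycle through [x] taken from [q];
   this makes the induction for Newton's identity go through. *)
Definition rooted_prod (q : nat -> R) T (s : {perm T}) (x : T) : R :=
  q #|porbit s x| * \prod_(c in porbits s | x \notin c) p #|c|.

Lemma rooted_prod_self T (s : {perm T}) x : rooted_prod p s x = cycle_prod s.
Proof.
rewrite /cycle_prod (bigD1 (porbit s x)) ?imset_f //=; congr (_ * _).
apply: eq_bigl => c; have [cs|] //= := boolP (c \in porbits s).
congr (~~ _); apply/idP/eqP => [xc|->]; [exact: porbit_in|exact: porbit_id].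
Qed.

Lemma rooted_prod_conj q T (s t : {perm T}) x :
  rooted_prod q (s ^ t) (t x) = rooted_prod q s x.
Proof.
have ts y : (s ^ t)%g (t y) = t (s y) by rewrite permJ.
have ti := @perm_inj _ t.
rewrite /rooted_prod (porbit_morph (f := t) (s := s)) // card_imset //.
congr (_ * _); rewrite !big_mkcondr /= (@porbits_prod_bij T T t (s ^ t)%g s) //.
  by apply: eq_bigr => c _; rewrite card_imset // mem_imset.
by exists (t^-1)%g; [exact: permK|exact: permKV].
Qed.

(** The transposition inserts [ord0] just before [i] in the cycle of [i] and leaves the other cycles
    alone. The root cycle gains one point, whence [q \o S]. *)
Lemma rooted_prod_lift q n (t : 'S_n) (i : 'I_n) :
  rooted_prod q (lift_perm ord0 ord0 t * tperm ord0 (lift ord0 i))%g ord0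
    = rooted_prod (q \o S) t i.
Proof.
set s := (_ * _)%g; pose f := lift (@ord0 n).
have fi : injective f := @lift_inj _ _.
have s0 : s ord0 = f i by rewrite permM lift_perm_id tpermL.
have sf y : t y != i -> s (f y) = f (t y).
  move=> ty; rewrite permM lift_perm_lift tpermD ?neq_lift //.
  by rewrite (inj_eq fi) eq_sym.
have sfi y : t y = i -> s (f y) = ord0.
  by move=> ty; rewrite permM lift_perm_lift ty tpermR.
have oN y : i \notin porbit t y -> porbit s (f y) = f @: porbit t y.
  move=> iy; apply: porbit_morph => z zy; apply: sf; apply: contraNneq iy => <-.
  have /eqP <- : porbit t z == porbit t y by rewrite eq_porbit_mem.
  by rewrite -{1}[t]expg1 mem_porbit.
have o0 : porbit s ord0 = ord0 |: f @: porbit t i.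
  apply/eqP; rewrite eqEsubset; apply/andP; split.
    apply: porbit_stable; last by rewrite !inE eqxx.
    move=> y; rewrite !inE => /orP[/eqP ->|/imsetP[z zi ->]].
      by rewrite s0 imset_f ?orbT // porbit_id.
    have [/sfi ->|/sf ->] := eqVneq (t z) i; first by rewrite eqxx.
    rewrite imset_f ?orbT //.
    have /eqP <- : porbit t z == porbit t i by rewrite eq_porbit_mem.
    by rewrite -{1}[t]expg1 mem_porbit.
  apply/subsetP => y; rewrite !inE => /orP[/eqP ->|/imsetP[z /porbitP[k ->] ->]].
    exact: porbit_id.
  have fin : f i \in porbit s ord0 by rewrite -s0 -{1}[s]expg1 mem_porbit.
  have st w : w \in porbit s ord0 -> s w \in porbit s ord0.
    by move=> /porbitP[l ->]; rewrite -permM -expgSr mem_porbit.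
  elim: k => [|k IHk]; first by rewrite expg0 perm1.
  rewrite expgSr permM.
  have [->//|/sf <-] := eqVneq (t ((t ^+ k)%g i)) i; exact: st.
have -> : rooted_prod q s ord0
    = q #|porbit t i|.+1 * \prod_(c in porbits s | ord0 \notin c) p #|c|.
  rewrite /rooted_prod o0 cardsU1 card_imset //.
  suff -> : ord0 \notin f @: porbit t i by [].
  by apply/imsetP => -[z _ /eqP]; rewrite (negPf (neq_lift _ _)).
congr (_ * _).
pose P := [set c in porbits t | i \notin c].
have PE : [set c in porbits s | ord0 \notin c] = [set f @: c | c : {set 'I_n} in P].
  apply/setP => c; rewrite inE; apply/andP/imsetP => [[/imsetP[x _ ->]]|[d]].
    have [j xE|xE] := unliftP ord0 x; last by rewrite xE porbit_id.
    rewrite xE => cj; have ij : i \notin porbit t j.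
      apply: contra cj; rewrite porbit_sym => ji; rewrite porbit_sym o0 inE.
      by rewrite (_ : lift _ j = f j) // imset_f ?orbT.
    by exists (porbit t j); rewrite ?oN // inE ij imset_f.
  rewrite inE => /andP[/imsetP[j _ ->]] ij ->; rewrite -oN //; split; first exact: imset_f.
  by rewrite oN //; apply/imsetP => -[z _ /eqP]; rewrite (negPf (neq_lift _ _)).
rewrite -[LHS]big_set PE big_imset; last by move=> c d _ _; exact: imset_inj.
by rewrite [LHS]big_set; apply: eq_bigr => c _; rewrite card_imset.
Qed.

Lemma rooted_prod_fix q n (t : 'S_n) :
  rooted_prod q (lift_perm ord0 ord0 t) ord0 = q 1%N * cycle_prod t.
Proof.
set s := lift_perm _ _ _; pose f := lift (@ord0 n).
have fi : injective f := @lift_inj _ _.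
have o0 : porbit s ord0 = [set ord0].
  apply/eqP; rewrite eqEsubset sub1set porbit_id andbT.
  by apply: porbit_stable; rewrite ?inE // => y /[!inE] /eqP ->; rewrite lift_perm_id.
have oN y : porbit s (f y) = f @: porbit t y.
  by apply: porbit_morph => z _; rewrite /s lift_perm_lift.
rewrite /rooted_prod o0 cards1; congr (_ * _).
have PE : [set c in porbits s | ord0 \notin c] = [set f @: c | c : {set 'I_n} in porbits t].
  apply/setP => c; rewrite inE; apply/andP/imsetP => [[/imsetP[x _ ->]]|[d]].
    have [j ->|->] := unliftP ord0 x; last by rewrite porbit_id.
    by exists (porbit t j); rewrite ?oN ?imset_f.
  move=> /imsetP[j _ ->] ->; rewrite -oN imset_f //; split=> //.
  by rewrite oN; apply/imsetP => -[z _ /eqP]; rewrite (negPf (neq_lift _ _)).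
rewrite -[LHS]big_set PE big_imset; last by move=> c d _ _; exact: imset_inj.
by apply: eq_bigr => c _; rewrite card_imset.
Qed.

Definition cycle_sum n : R := \sum_(s : 'S_n) cycle_prod s.

(** Permutations are sorted by the length r + 1 of the cycle through [ord0], which can be completed
    in n^_r ways. The induction lengthens that cycle by passing from [q] to [q \o S], so [q] has to
    vary. *)
Lemma rooted_sum n q :
  \sum_(s : 'S_n.+1) rooted_prod q s ord0
    = \sum_(r < n.+1) (n ^_ r)%:R * (q r.+1 * cycle_sum (n - r)).
Proof.
elim: n q => [|n IHn] q; rewrite sum_insert big_ord_recl /=.
  rewrite big_ord0 addr0 big_ord_recl big_ord0 addr0 mul1r mulr_sumr.
  by apply: eq_bigr => t _; rewrite tperm1 mulg1 rooted_prod_fix.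
rewrite [in RHS]big_ord_recl ffactn0 mul1r subn0 mulr_sumr; congr (_ + _).
  by apply: eq_bigr => t _; rewrite tperm1 mulg1 rooted_prod_fix.
transitivity (\sum_(i < n.+1) \sum_(r < n.+1) (n ^_ r)%:R * (q r.+2 * cycle_sum (n - r))).
  apply: eq_bigr => i _; rewrite -(IHn (q \o S)).
  (* Conjugation moves the root from [i] to [ord0], so all insertion places contribute the same
     sum. *)
  rewrite [RHS](reindex_inj (conjg_inj (tperm ord0 i))) /=.
  apply: eq_bigr => t _.
  by rewrite rooted_prod_lift -(rooted_prod_conj _ t (tperm ord0 i)) tpermR.
rewrite sumr_const card_ord -mulr_natl mulr_sumr; apply: eq_bigr => r _.
by rewrite mulrA -natrM ffactnS subSS.
Qed.

Lemma cycle_sumS n :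
  cycle_sum n.+1 = \sum_(r < n.+1) (n ^_ r)%:R * (p r.+1 * cycle_sum (n - r)).
Proof.
by rewrite -rooted_sum; apply: eq_bigr => s _; rewrite rooted_prod_self.
Qed.

Lemma cycle_sum0 : cycle_sum 0 = 1.
Proof.
rewrite /cycle_sum (big_pred1 1%g) => [|s]; last by apply/esym/eqP; rewrite !permS0.
by rewrite /cycle_prod big_pred0 // => c; apply/imsetP => -[[]].
Qed.

End CycleProduct.

(** * Complete symmetric functions *)

Lemma fact_neq0 n : n`!%:R != 0 :> rat.
Proof. by rewrite pnatr_eq0 -lt0n fact_gt0. Qed.

Lemma cycle_index_newton (A : comAlgType rat) (p : nat -> A) n
    (h := fun m => (m`!%:R : rat)^-1 *: cycle_sum p m) :
  n.+1%:R *: h n.+1 = \sum_(r < n.+1) p r.+1 * h (n - r)%N.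
Proof.
apply: (scalerI (fact_neq0 n)).
rewrite /h !scalerA -?mulrA mulrA -natrM mulnC -factS mulfV ?fact_neq0 // scale1r cycle_sumS.
rewrite scaler_sumr; apply: eq_bigr => r _.
rewrite mulr_natl -scaler_nat -scalerAr scalerA; congr (_ *: _).
rewrite -(@ffact_fact n r); last by have := ltn_ord r; lia.
by rewrite natrM mulfK ?fact_neq0.
Qed.

Section NewtonZ.

Variables (A : comAlgType rat) (p h : nat -> A).
Hypothesis newton : forall n,
  n.+1%:R *: h n.+1 = \sum_(r < n.+1) p r.+1 * h (n - r)%N.
Hypothesis h0 : h 0%N = 1.

Definition extZ (z : int) : A := if z is Posz n then h n else 0.

(** Terms with r > z vanish, so any bound [N] beyond z gives the same sum; at z = -1 the factor z +
    1 kills h_0. *)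
Lemma newtonZ (z : int) N : (z < N%:Z)%R ->
  (z + 1)%:~R *: extZ (z + 1) = \sum_(r < N) p r.+1 * extZ (z - r%:Z).
Proof.
case: z => [n|n] nN; last first.
  rewrite big1 => [|r _]; last first.
    by rewrite (_ : Negz n - r%:Z = Negz (n + r)) ?mulr0 //; lia.
  case: n nN => [|n] _; first by rewrite (_ : Negz 0 + 1 = 0) // scale0r.
  by rewrite (_ : Negz n.+1 + 1 = Negz n) ?scaler0 //; lia.
rewrite (_ : n%:Z + 1 = n.+1%:Z); last by lia.
rewrite newton (big_ord_widen_cond N xpredT (fun r => p r.+1 * h (n - r)%N)) //.
rewrite [RHS](bigID (fun r : 'I_N => (r < n.+1)%N)) /= [X in _ + X]big1 ?addr0.
  apply: eq_bigr => r rn; rewrite (_ : n%:Z - r%:Z = (n - r)%N%:Z) //; lia.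
move=> r; rewrite -leqNgt => rn.
by rewrite (_ : n%:Z - r%:Z = Negz (r - n.+1)) ?mulr0 //; lia.
Qed.

Variables (d : A -> A) (i : nat).
Hypothesis d_lin : linear d.
Hypothesis dM : forall f g, d (f * g) = d f * g + f * d g.
Hypothesis dp_ : forall r, d (p r.+1) = (i.+1 * (r == i))%:R.

Lemma deriv_sum I r (P : pred I) (F : I -> A) :
  d (\sum_(j <- r | P j) F j) = \sum_(j <- r | P j) d (F j).
Proof.
have dD x y : d (x + y) = d x + d y by have := d_lin 1 x y; rewrite !scale1r.
apply: (big_morph d dD).
by have := dD 0 0; rewrite addr0 -[LHS]addr0 => /addrI.
Qed.

(** Apply [d] to Newton's identity for n h_n: one term gives (i+1) h_{n-i-1}, the others by
    induction (n-i-1) h_{n-i-1} through [newtonZ], and n can be cancelled. *)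
Lemma deriv_extZ (z : int) : d (extZ z) = extZ (z - i.+1%:Z).
Proof.
have d0 : d 0 = 0 by have := deriv_sum [::] xpredT (fun _ : nat => 0); rewrite !big_nil.
have dZ a x : d (a *: x) = a *: d x.
  by rewrite -[a *: x]addr0 d_lin d0 addr0.
have d1 : d 1 = 0.
  by have := dM 1 1; rewrite !mul1r mulr1 -[LHS]addr0 => /addrI/esym.
case: z => [n|n]; last by rewrite (_ : Negz n - i.+1%:Z = Negz (n + i.+1)); [exact: d0|lia].
have [m] := ubnP n; elim: m n => // m IH [|n] nm; first by rewrite /= h0 d1.
have nz : n.+1%:R != 0 :> rat by rewrite pnatr_eq0.
apply: (scalerI nz); rewrite -dZ newton deriv_sum.
transitivity (\sum_(r < n.+1)
    ((i.+1 * (r == i :> nat))%:R * h (n - r)%N + p r.+1 * extZ (n%:Z - i.+1%:Z - r%:Z))).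
  apply: eq_bigr => r _; rewrite dM dp_ IH; last by lia.
  by congr (_ + _ * extZ _); have := ltn_ord r; lia.
rewrite big_split /= -newtonZ; last by lia.
have -> : n%:Z - i.+1%:Z + 1 = n.+1%:Z - i.+1%:Z by lia.
have -> : \sum_(r < n.+1) (i.+1 * (r == i :> nat))%:R * h (n - r)%N
   = i.+1%:R *: extZ (n.+1%:Z - i.+1%:Z).
  have [ni|ni] := ltnP i n.+1.
    rewrite (bigD1 (Ordinal ni)) //= eqxx muln1 big1 ?addr0.
      rewrite scaler_nat mulr_natl; congr (_ *+ _).
      by rewrite (_ : n.+1%:Z - i.+1%:Z = (n - i)%N%:Z) //; lia.
    move=> r; rewrite -val_eqE /= => /negPf ->; by rewrite muln0 mul0r.
  rewrite (_ : n.+1%:Z - _ = Negz (i - n.+1)) /= ?scaler0; last by lia.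
  rewrite big1 // => r _; rewrite (_ : (r == i :> nat) = false) ?muln0 ?mul0r //.
  by have := ltn_ord r; lia.
rewrite -scalerDl; congr (_ *: _).
by rewrite intrD intrN addrC -!pmulrn subrK.
Qed.

End NewtonZ.

Notation wt := (cycle_prod pw).

Lemma homog_wt (T : finType) (s : {perm T}) : homog #|T| (wt s).
Proof.
have -> : #|T| = (\sum_(c in porbits s) #|c|)%N.
  rewrite -sum1_card (partition_big (porbit s) (mem (porbits s))) /=; last first.
    by move=> x _; apply: imset_f.
  apply: eq_bigr => c cs; rewrite -sum1_card; apply: eq_bigl => x.
  apply/eqP/idP => [<-|]; first exact: porbit_id.
  by move=> xc; rewrite (porbit_in cs xc).
apply: homog_prod => c /imsetP[x _ ->]; apply: homog_pw.
by rewrite lt0n card_porbit_neq0.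
Qed.

Definition hs n : Lam := locked_with lam_key ((n`!%:R : rat)^-1 *: cycle_sum pw n).

Lemma hsE n : hs n = (n`!%:R : rat)^-1 *: cycle_sum pw n.
Proof. by rewrite /hs unlock. Qed.

Lemma lam_val_hs n : lam_val (hs n) = hsym n.
Proof.
rewrite hsE lam_valZ; congr (_ *: _); rewrite raddf_sum; apply: eq_bigr => s _.
by rewrite /= rmorph_prod; apply: eq_bigr => c _; exact: lam_val_pw.
Qed.

Lemma homog_hs n : homog n (hs n).
Proof.
rewrite hsE; apply/homogZ/homog_sum => s _.
by rewrite -[X in homog X _](card_ord n); exact: homog_wt.
Qed.

Lemma sum_wt n : \sum_(s : 'S_n) wt s = n`!%:R *: hs n.
Proof. by rewrite hsE scalerA mulfV ?scale1r ?fact_neq0. Qed.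

Lemma hs0 : hs 0 = 1.
Proof. by rewrite hsE invr1 scale1r cycle_sum0. Qed.

Lemma hs_newton n :
  n.+1%:R *: hs n.+1 = \sum_(r < n.+1) pw r.+1 * hs (n - r).
Proof.
rewrite hsE (@cycle_index_newton Lam pw n).
by apply: eq_bigr => r _; rewrite hsE.
Qed.

(* h_z, with h_z = 0 for z < 0. *)
Definition hZ := extZ hs.

Lemma dp_hZ i (z : int) : dp i (hZ z) = hZ (z - i.+1%:Z).
Proof.
by apply: (@deriv_extZ Lam pw hs hs_newton hs0) (dp_lin i) (dpM i) _ z => r; exact: dp_pw.
Qed.

(** * Skewing by complete and elementary symmetric functions *)

(* {poly Lam} is an algebra over Lam; here it is taken as an algebra over rat. *)
Definition lam_poly := {poly Lam}.
HB.instance Definition _ := GRing.ComNzRing.on lam_poly.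
Definition lam_poly_scale (c : rat) (q : lam_poly) : lam_poly := (c%:A : Lam) *: q.
Fact lam_poly_scaleA a b q :
  lam_poly_scale a (lam_poly_scale b q) = lam_poly_scale (a * b) q.
Proof. by rewrite /lam_poly_scale scalerA -scalerAl mul1r scalerA. Qed.
Fact lam_poly_scale1 : left_id 1 lam_poly_scale.
Proof. by move=> q; rewrite /lam_poly_scale scale1r scale1r. Qed.
Fact lam_poly_scaleDr : right_distributive lam_poly_scale +%R.
Proof. by move=> a p q; rewrite /lam_poly_scale scalerDr. Qed.
Fact lam_poly_scaleDl q : {morph lam_poly_scale^~ q : a b / a + b}.
Proof. by move=> a b; rewrite /lam_poly_scale scalerDl scalerDl. Qed.
HB.instance Definition _ := GRing.Zmodule_isLmodule.Build rat lam_poly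
  lam_poly_scaleA lam_poly_scale1 lam_poly_scaleDr lam_poly_scaleDl.
Fact lam_poly_scaleAl a (p q : lam_poly) : a *: (p * q) = a *: p * q.
Proof. by rewrite /GRing.scale /= /lam_poly_scale scalerAl. Qed.
HB.instance Definition _ := GRing.Lmodule_isLalgebra.Build rat lam_poly lam_poly_scaleAl.
HB.instance Definition _ := GRing.Lalgebra_isComAlgebra.Build rat lam_poly.

Section Skewing.

Variable u : rat.

(** Adding a variable t to the alphabet changes p_r into p_r + t^r; for [u = -1] the extra sign is
    the one by which the involution omega acts on p_r. *)
Definition skew_var (i : nat) : {poly Lam} :=
  (pw i.+1)%:P + ((u ^+ i)%:A)%:P * 'X^(i.+1).

(* For [u = 1] the coefficient of ['X^n] is the adjoint of multiplication by
   h_n, for [u = -1] that of multiplication by e_n. *)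
Definition skewp : Lam -> {poly Lam} := ev (skew_var : nat -> lam_poly).
HB.instance Definition _ := GRing.RMorphism.copy skewp (skewp : Lam -> lam_poly).

Lemma skewZ c f : skewp (c *: f) = (c%:A)%:P * skewp f.
Proof. by rewrite /skewp linearZ /= [RHS]mul_polyC. Qed.

Lemma skew_pw i : skewp (pw i.+1) = skew_var i.
Proof. by rewrite /skewp ev_pw. Qed.

Lemma skewM f g : skewp (f * g) = skewp f * skewp g. Proof. exact: rmorphM. Qed.
Lemma skewD f g : skewp (f + g) = skewp f + skewp g. Proof. exact: rmorphD. Qed.
Lemma skew1 : skewp 1 = 1. Proof. exact: rmorph1. Qed.

Lemma coef_skewZ c f n : (skewp (c *: f))`_n = c *: (skewp f)`_n.
Proof. by rewrite skewZ coefCM mulr_algl. Qed.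

Lemma coef_skewD f g n : (skewp (f + g))`_n = (skewp f)`_n + (skewp g)`_n.
Proof. by rewrite skewD coefD. Qed.

(* Divisible by ['X^(K.+1)], by Euler's identity for the translated variables. *)
Definition skew_defect K f : {poly Lam} :=
  'X * (skewp f)^`() - \sum_(i < K) ((u ^+ i)%:A)%:P * 'X^(i.+1) * skewp (dp i f).

Lemma leibniz_defect (B : comNzRingType) (K : nat) (X a b a' b' : B) (c x y : 'I_K -> B) :
  X * (a' * b + a * b') - \sum_i c i * (x i * b + a * y i)
    = (X * a' - \sum_i c i * x i) * b + a * (X * b' - \sum_i c i * y i).
Proof.
have -> : \sum_i c i * (x i * b + a * y i)
  = (\sum_i c i * x i) * b + a * (\sum_i c i * y i).
  rewrite mulr_suml mulr_sumr -big_split; apply: eq_bigr => i _ /=; ring.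
ring.
Qed.

(** X d/dX and the [dp i] all obey the Leibniz rule, hence the defect is a derivation along [skewp]
    and its divisibility can be tested on generators. *)
Lemma skew_defectM K f g :
  skew_defect K (f * g) = skew_defect K f * skewp g + skewp f * skew_defect K g.
Proof.
rewrite /skew_defect.
rewrite -[RHS](@leibniz_defect {poly Lam} K 'X (skewp f) (skewp g) (skewp f)^`()
  (skewp g)^`() (fun i => ((u ^+ i)%:A)%:P * 'X^(i.+1)) (fun i => skewp (dp i f))
  (fun i => skewp (dp i g))).
rewrite skewM derivM; congr (_ - _).
by apply: eq_bigr => i _; rewrite dpM skewD !skewM.
Qed.

Lemma skew_defectP K c f g :
  skew_defect K (c *: f + g) = (c%:A)%:P * skew_defect K f + skew_defect K g.
Proof.
rewrite /skew_defect skewD skewZ derivD derivM derivC mul0r add0r.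
set F := \sum_(i < K) _ * skewp (dp i f); set G := \sum_(i < K) _ * skewp (dp i g).
have -> : \sum_(i < K) ((u ^+ i)%:A)%:P * 'X^(i.+1) * skewp (dp i (c *: f + g))
    = (c%:A)%:P * F + G.
  rewrite mulr_sumr -big_split; apply: eq_bigr => i _ /=.
  by rewrite dp_lin skewD skewZ mulrDr mulrCA.
ring.
Qed.

(** Euler's operator yields (j+1) u^j X^(j+1). For j < K the term i = j cancels it; for j >= K this
    power is itself a multiple of X^(K+1). *)
Lemma skew_defect_pw K j :
  exists q, skew_defect K (pw j.+1) = 'X^(K.+1) * q.
Proof.
have dE : skew_defect K (pw j.+1)
    = (j.+1%:R * ((u ^+ j)%:A)%:P * 'X^(j.+1))
      - \sum_(i < K) (i == j :> nat)%:R * (j.+1%:R * ((u ^+ j)%:A)%:P * 'X^(j.+1)).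
  rewrite /skew_defect skew_pw /skew_var derivD derivC add0r derivM derivC mul0r.
  rewrite add0r derivXn; congr (_ - _).
    by rewrite -mulr_natl mulrCA mulrC mulrCA exprS; ring.
  apply: eq_bigr => i _; rewrite dp_pw natrM rmorphM !rmorph_nat eq_sym.
  have [->|_] := eqVneq (i : nat) j; rewrite ?mulr0 ?mul0r // mul1r mulr1.
  by rewrite mulrC mulrA.
rewrite dE -mulr_suml; have [jK|Kj] := ltnP j K.
  rewrite (bigD1 (Ordinal jK)) //= eqxx big1 ?addr0 => [|i]; last first.
    by rewrite -val_eqE /= => /negPf ->.
  by exists 0; rewrite mul1r subrr mulr0.
rewrite big1 ?mul0r ?subr0 => [|i _]; last first.
  by rewrite (_ : _ == _ = false) //; have := ltn_ord i; lia.
exists ('X^(j - K) * (j.+1%:R * ((u ^+ j)%:A)%:P)).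
by rewrite [RHS]mulrA -exprD addSn subnKC // mulrC.
Qed.

Lemma skew_defect_div K f : exists q, skew_defect K f = 'X^(K.+1) * q.
Proof.
move: f; apply: lam_ind => [c f g [q qE] [r rE]||i f [q qE]].
- by exists ((c%:A)%:P * q + r); rewrite skew_defectP qE rE mulrDr mulrCA.
- exists 0; rewrite mulr0 /skew_defect skew1 derivC mulr0 big1 ?subr0 // => i _.
  by rewrite dp1 rmorph0 mulr0.
have [r rE] := skew_defect_pw K i.
by exists (r * skewp f + skewp (pw i.+1) * q); rewrite skew_defectM rE qE; ring.
Qed.

(** The dual of Newton's identity, read off in degree n from the defect at [K = n]. As n is
    invertible it determines the coefficients of [skewp] recursively. *)
Lemma skew_dp f n :
  (skewp f)`_n *+ n = \sum_(i < n) u ^+ i *: (skewp (dp i f))`_(n - i.+1).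
Proof.
have [q /(congr1 (fun p : {poly Lam} => p`_n))] := skew_defect_div n f.
rewrite coefXnM ltnSn coefB coefXM coef_sum => /eqP; rewrite subr_eq0 => /eqP.
have -> : (if n == 0%N then 0 else (skewp f)^`()`_n.-1) = (skewp f)`_n *+ n.
  by case: n => [|n]; rewrite ?mulr0n // coef_deriv.
move=> ->; apply: eq_bigr => i _.
rewrite -mulrA coefCM mulr_algl coefXnM; congr (_ *: _).
by rewrite ltnNge ltn_ord.
Qed.

End Skewing.

Lemma lam_mulrnI n : injective (fun f : Lam => f *+ n.+1).
Proof.
move=> f g /= E; have nz : n.+1%:R != 0 :> rat by rewrite pnatr_eq0.
by apply: (scalerI nz); rewrite !scaler_nat.
Qed.

Lemma skew_coef0 u f : (skewp u f)`_0 = f.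
Proof.
move: f; apply: lam_ind => [c f g IHf IHg||i f IH].
- by rewrite coef_skewD coef_skewZ IHf IHg.
- by rewrite skew1 coefC.
by rewrite skewM skew_pw coef0M IH coefD coefC coefCM coefXn mulr0 addr0.
Qed.

Lemma skew_h (z : int) n : (skewp 1 (hZ z))`_n = hZ (z - n%:Z).
Proof.
have [m] := ubnP n; elim: m n z => // m IH [|n] z nm.
  by rewrite skew_coef0 subr0.
apply: (@lam_mulrnI n); rewrite /= skew_dp.
rewrite (eq_bigr (fun=> hZ (z - n.+1%:Z))) ?sumr_const ?card_ord // => i _.
rewrite expr1n scale1r dp_hZ IH; last by lia.
by congr hZ; have := ltn_ord i; lia.
Qed.

(** From degree 2 on, induction leaves only the last two terms of [skew_dp]; they are equal up to
    opposite signs and cancel. *)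
Lemma skew_e (z : int) : skewp (-1) (hZ z) = (hZ z)%:P + (hZ (z - 1))%:P * 'X.
Proof.
apply/polyP => n; rewrite coefD coefC coefCM coefX.
have [m] := ubnP n; elim: m n z => // m IH [|n] z nm.
  by rewrite skew_coef0 mulr0 addr0.
apply: (@lam_mulrnI n); rewrite /= skew_dp.
case: n nm => [|n] nm.
  by rewrite big_ord1 expr0 scale1r dp_hZ subnn skew_coef0 mulr1 add0r.
rewrite big_ord_recr big_ord_recr big1 /= => [|i _]; last first.
  rewrite dp_hZ IH; last by have := ltn_ord i; lia.
  have e0 : (n.+2 - i.+1 == 0)%N = false by have := ltn_ord i; lia.
  have e1 : (n.+2 - i.+1 == 1)%N = false by have := ltn_ord i; lia.
  by rewrite e0 e1 mulr0 addr0 scaler0.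
rewrite !dp_hZ subnn subSS subSnn !IH ?add0r //=; try lia.
rewrite exprS mulN1r scaleNr mulr1 !mulr0 addr0 mul0rn.
rewrite (_ : z - n.+1%:Z - 1 = z - n.+2%:Z) ?subrr //; lia.
Qed.

(** Newton's identity for [hs] and [skew_dp] are adjoint to each other term by term, through
    [hform_dp]. *)
Lemma hform_hs n f g : hform f (hs n * g) = hform (skewp 1 f)`_n g.
Proof.
have [m] := ubnP n; elim: m n f => // m IH [|n] f nm.
  by rewrite hs0 mul1r skew_coef0.
have nz : n.+1%:R != 0 :> rat by rewrite pnatr_eq0.
apply: (mulfI nz); rewrite -hformZr scalerAl hs_newton mulr_suml hform_sumr.
rewrite -hformZl scaler_nat skew_dp hform_suml; apply: eq_bigr => i _.
by rewrite -mulrA -hform_dp IH ?expr1n ?scale1r; [rewrite subSS|lia].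
Qed.

(* The Hall pairing with h_nu for [u = 1], with e_nu for [u = -1]. *)
Fixpoint skews (u : rat) (nu : seq nat) (f : Lam) : rat :=
  if nu is n :: nu' then skews u nu' (skewp u f)`_n else eps f.

Lemma skews_is_linear u nu : linear (skews u nu : Lam -> rat^o).
Proof.
elim: nu => [|n nu IH] c f g /=; last by rewrite coef_skewD coef_skewZ IH.
by rewrite /eps mcfD mcfZ.
Qed.
HB.instance Definition _ u nu :=
  GRing.isLinear.Build rat Lam rat^o *:%R (skews u nu : Lam -> rat^o) (skews_is_linear u nu).

Lemma skewsZ u nu c f : skews u nu (c *: f) = c * skews u nu f.
Proof. by rewrite -[c *: f]addr0 skews_is_linear raddf0 addr0. Qed.

Lemma skews0 u nu : skews u nu 0 = 0.
Proof. exact: raddf0. Qed.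

Lemma skews_sum u nu I r (P : pred I) (F : I -> Lam) :
  skews u nu (\sum_(i <- r | P i) F i) = \sum_(i <- r | P i) skews u nu (F i).
Proof. exact: raddf_sum. Qed.

Lemma hform_prod_hs f nu : hform f (\prod_(n <- nu) hs n) = skews 1 nu f.
Proof.
elim: nu f => [|n nu IH] f; first by rewrite big_nil hform1.
by rewrite big_cons hform_hs IH.
Qed.

(** * Schur functions *)

Definition jt (m : nat) (al : nat -> int) : 'M[Lam]_m :=
  \matrix_(i < m, j < m) hZ (al i - i%:Z + j%:Z).

Definition sch (la : seq nat) : Lam :=
  \det (jt (size la) (fun i => (nth 0%N la i)%:Z)).

Lemma lam_val_sch la : lam_val (sch la) = schur la.
Proof.
rewrite /sch /schur -det_map_mx; congr (\det _).
apply/matrixP => i j; rewrite !mxE; case: leqP => ij.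
  rewrite (_ : _ - _ + _ = Posz (nth 0%N la i + j - i)%N); last by lia.
  exact: lam_val_hs.
rewrite (_ : _ - _ + _ = Negz (i - (nth 0%N la i + j).+1)); last by lia.
exact: raddf0.
Qed.

Lemma skew_det u m (M : 'M[Lam]_m) : skewp u (\det M) = \det (map_mx (skewp u) M).
Proof. by rewrite det_map_mx. Qed.

(** The series G(z) of the skewed h_z satisfies G(z) - X G(z-1) = h_z. Subtracting X times the
    preceding column, which is multiplication by the unitriangular [U], makes every column but the
    first constant; then expand along the first. *)
Lemma skew_jt m (al : nat -> int) n :
  (skewp 1 (\det (jt m.+1 al)))`_n
    = \sum_(i < m.+1) hZ (al i - i%:Z - n%:Z) * cofactor (jt m.+1 al) i 0.
Proof.
pose G (z : int) := skewp 1 (hZ z).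
have Grec z : G z - 'X * G (z - 1) = (hZ z)%:P.
  apply/polyP => k; rewrite coefB coefXM coefC !skew_h.
  case: k => [|k] /=; first by rewrite subr0 subr0.
  by rewrite (_ : z - 1 - k%:Z = z - k.+1%:Z) ?subrr //; lia.
pose N : 'M[{poly Lam}]_m.+1 := \matrix_(i, j)
  (if j == 0 then G (al i - i%:Z) else (hZ (al i - i%:Z + j%:Z))%:P).
pose U : 'M[{poly Lam}]_m.+1 :=
  \matrix_(k, j) ((k == j)%:R - 'X * (k.+1 == j :> nat)%:R).
have detU : \det U = 1.
  rewrite -det_tr det_trig.
    by rewrite big1 // => i _; rewrite !mxE eqxx (_ : _ == _ = false) ?mulr0 ?subr0 //; lia.
  apply/is_trig_mxP => i j ij; rewrite !mxE -val_eqE /=.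
  have e0 : (j == i :> nat) = false by lia.
  have e1 : (j.+1 == i :> nat) = false by lia.
  by rewrite e0 e1 mulr0 subr0.
have NE : N = map_mx (skewp 1) (jt m.+1 al) *m U.
  apply/matrixP => i j; rewrite !mxE (bigD1 j) //= !mxE eqxx.
  rewrite (_ : j.+1 == j = false) ?mulr0 ?subr0 ?mulr1; last by lia.
  case: (unliftP 0 j) => [j' ->|->] /=.
    rewrite (bigD1 (widen_ord (leqnSn m) j')) /=; last first.
      by rewrite -val_eqE /= /bump; lia.
    rewrite big1 ?addr0 => [|k /andP[kj kj']]; last first.
      rewrite !mxE (negPf kj) (_ : _ == _ :> nat = false) ?mulr0 ?subr0 ?mulr0 //.
      by move: kj'; rewrite -val_eqE /= /bump; lia.
    rewrite !mxE (_ : _ == lift _ _ = false); last by rewrite -val_eqE /= /bump; lia.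
    rewrite /bump /= eqxx mulr1 sub0r mulrN mulrC -Grec /G.
    by congr (skewp 1 (hZ _) - 'X * skewp 1 (hZ _)); lia.
  rewrite big1 ?addr0 /= => [|k kj]; first by congr (skewp 1 (hZ _)); lia.
  by rewrite !mxE (negPf kj) mulr0 subr0 mulr0.
rewrite skew_det -[\det _]mulr1 -detU -det_mulmx -NE (expand_det_col _ 0) coef_sum.
apply: eq_bigr => i _; rewrite !mxE /=.
have -> : cofactor N i 0 = (cofactor (jt m.+1 al) i 0)%:P.
  rewrite /cofactor rmorphM rmorphXn rmorphN rmorph1 -det_map_mx.
  by congr (_ * \det _); apply/matrixP => a b; rewrite !mxE.
by rewrite coefMC skew_h.
Qed.

(** * Orthonormality of the Schur functions *)

(** Integer sequences are compared, since the terms of a Jacobi-Trudi determinant have indices that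
    may be negative or increasing. *)
Definition lexgt (a b : nat -> int) : Prop :=
  exists i, b i < a i /\ forall j, (j < i)%N -> a j = b j.

Lemma lexgt_trans a b c : lexgt a b -> lexgt b c -> lexgt a c.
Proof.
move=> [i [abi abj]] [k [bck bcj]]; have [ik|ki|ik] := ltngtP i k.
- exists i; split=> [|j ji]; first by rewrite -bcj.
  by rewrite abj // bcj // (ltn_trans ji).
- exists k; split=> [|j jk]; first by rewrite abj.
  by rewrite abj ?bcj // (ltn_trans jk).
move: ik bck bcj => <- bck bcj; exists i; split=> [|j ji]; first exact: lt_trans abi.
by rewrite abj // bcj.
Qed.

Definition szval (la : seq nat) (i : nat) : int := (nth 0%N la i)%:Z.

(** Zero is not a part, so a partition is determined by its values padded with zeros, and distinct
    partitions have a first difference. *)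
Lemma part_total la ka : is_part la -> is_part ka -> la != ka ->
  lexgt (szval la) (szval ka) \/ lexgt (szval ka) (szval la).
Proof.
move=> /andP[_ la0] /andP[_ ka0] lk.
have ex : exists i, nth 0%N la i != nth 0%N ka i.
  have [i ni|same] := @pickP 'I_(maxn (size la) (size ka)).+1
    (fun i => nth 0%N la i != nth 0%N ka i); first by exists i.
  have E i : nth 0%N la i = nth 0%N ka i.
    have [im|im] := ltnP i (maxn (size la) (size ka)).+1.
      by have /negbFE/eqP := same (Ordinal im).
    by rewrite !nth_default //; lia.
  case/eqP: lk; apply: (@eq_from_nth _ 0%N) => [|i _]; last exact: E.
  have zero (a b : seq nat) : (forall i, nth 0%N a i = nth 0%N b i) ->
      0%N \notin a -> (size a <= size b)%N.
    move=> ab a0; rewrite leqNgt; apply/negP => sab; move/negP: a0; apply.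
    by rewrite -[0%N](nth_default 0%N (leqnn (size b))) -ab mem_nth.
  by apply/eqP; rewrite eqn_leq !zero // => i.
case: (ex_minnP ex) => i neq min.
have eqj j : (j < i)%N -> szval la j = szval ka j.
  move=> ji; congr Posz; apply/eqP; apply: contraTT ji => /min.
  by rewrite -leqNgt.
have [lt|gt|E] := ltngtP (nth 0%N la i) (nth 0%N ka i).
- by right; exists i; split=> [|j /eqj]; rewrite /szval //; lia.
- by left; exists i; split=> [|j /eqj]; rewrite /szval //; lia.
by rewrite E eqxx in neq.
Qed.

Lemma hZ_neg z : z < 0 -> hZ z = 0.
Proof. by case: z. Qed.

Lemma hZ0 : hZ 0 = 1. Proof. exact: hs0. Qed.

Lemma sch_nil : sch [::] = 1.
Proof. by rewrite /sch det_mx00. Qed.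

Lemma sorted_geq_nth l la i : sorted geq (l :: la) -> (nth 0%N la i <= l)%N.
Proof.
move=> /(order_path_min (fun _ _ _ h1 h2 => leq_trans h2 h1))/allP h.
have [il|il] := ltnP i (size la); first exact/h/mem_nth.
by rewrite nth_default.
Qed.

(** In [skew_jt] all rows but the first carry an h of negative index; the first carries h_{l-n}, and
    its cofactor is the determinant of [la]. *)
Lemma coef_skew_sch l la n : sorted geq (l :: la) -> (l <= n)%N ->
  (skewp 1 (sch (l :: la)))`_n = if n == l then sch la else 0.
Proof.
move=> so ln; rewrite /sch /= skew_jt big_ord_recl big1 ?addr0 => [|i _]; last first.
  rewrite hZ_neg ?mul0r //; have := sorted_geq_nth i so.
  by rewrite lift0 /=; lia.
have [->|nl] := eqVneq n l; last first.
  by rewrite hZ_neg ?mul0r //=; lia.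
rewrite [X in hZ X](_ : _ = 0); last by rewrite /=; lia.
rewrite hZ0 mul1r /cofactor expr0 mul1r; congr (\det _).
by apply/matrixP => i j; rewrite !mxE !lift0 /=; congr hZ; lia.
Qed.

(** Equal leading parts remove the first rows of [la] one by one, until a larger part of [nu] gives
    0 by [coef_skew_sch]. *)
Lemma skews1_lexgt nu la : sorted geq la ->
  lexgt (szval nu) (szval la) -> skews 1 nu (sch la) = 0.
Proof.
elim: nu la => [|n nu IH] [|l la] so [i [lt eqs]].
- by move: lt; rewrite /szval nth_nil ltxx.
- by move: lt; rewrite /szval nth_nil; lia.
- rewrite /= sch_nil rmorph1 coef1.
  case: i lt eqs => [|i] lt eqs; first by rewrite (_ : _ == _ = false) ?skews0 //;
    move: lt; rewrite /szval /=; lia.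
  have := eqs 0%N isT; rewrite /szval /= => -[->] /=; rewrite -sch_nil.
  apply: IH => //; exists i; split=> [|j ji]; first by move: lt; rewrite /szval /= !nth_nil.
  by have := eqs j.+1 ji; rewrite /szval /= !nth_nil.
case: i lt eqs => [|i] lt eqs /=.
  have nl : (l < n)%N by move: lt; rewrite /szval /=; lia.
  rewrite coef_skew_sch //; last exact: ltnW.
  by rewrite (_ : _ == _ = false) ?skews0 //; lia.
have := eqs 0%N isT; rewrite /szval /= => -[->]; rewrite coef_skew_sch // eqxx.
apply: IH; first exact: path_sorted so.
by exists i; split=> [//|j ji]; have := eqs j.+1 ji.
Qed.

Lemma skews1_self la : sorted geq la -> skews 1 la (sch la) = 1.
Proof.
elim: la => [|l la IH] so /=; first by rewrite sch_nil eps1.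
by rewrite coef_skew_sch // eqxx IH //; exact: path_sorted so.
Qed.

Definition perm_shift m (w : 'S_m) (i : nat) : int :=
  if insub i is Some j then (w j)%:Z - i%:Z else 0.

Lemma perm_shiftE m (w : 'S_m) (j : 'I_m) : perm_shift w j = (w j)%:Z - j%:Z.
Proof. by rewrite /perm_shift valK. Qed.

(** The smallest point moved by [w] moves up, the smaller ones being already taken as their own
    images. *)
Lemma perm_shift_lexgt m (w : 'S_m) (a : nat -> int) : w != 1%g ->
  lexgt (fun i => a i + perm_shift w i) a.
Proof.
move=> w1; have ex : exists i, [exists j : 'I_m, (j == i :> nat) && (w j != j)].
  have [j wj|same] := @pickP 'I_m (fun j => w j != j).
    by exists j; apply/existsP; exists j; rewrite eqxx.
  by case/eqP: w1; apply/permP => j; rewrite perm1; apply/eqP/negbFE/same.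
case: (ex_minnP ex) => i /existsP[j /andP[/eqP ji wj]] min.
have fixed (l : 'I_m) : (l < i)%N -> w l = l.
  move=> li; apply/eqP; apply: contraTT li => wl; rewrite -leqNgt.
  by apply: min; apply/existsP; exists l; rewrite eqxx.
exists i; split=> [|l li].
  rewrite -ji perm_shiftE; suff : (j < w j)%N by lia.
  rewrite ltn_neqAle eq_sym wj leqNgt; apply/negP => wlt.
  have /perm_inj E : w (w j) = w j by apply: fixed; rewrite -ji.
  by rewrite E eqxx in wj.
rewrite /perm_shift; case: insubP => [l' _ l'E|_]; last by rewrite addr0.
by rewrite fixed ?l'E // subrr addr0.
Qed.

Lemma sch_sum la : sch la = \sum_(w : 'S_(size la))
  (-1) ^+ w * \prod_(i < size la) hZ (szval la i + perm_shift w i).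
Proof.
apply: eq_bigr => w _; congr (_ * _); apply: eq_bigr => i _; rewrite !mxE.
by rewrite perm_shiftE /szval; congr hZ; lia.
Qed.

Lemma sign_mul (A : comAlgType rat) (b : bool) (x : A) :
  (-1) ^+ b * x = ((-1) ^+ b : rat) *: x.
Proof. by case: b; rewrite ?expr1 ?expr0 ?mul1r ?scale1r // mulN1r scaleN1r. Qed.

Lemma homog_sch la : homog (sumn la) (sch la).
Proof.
rewrite sch_sum; apply: homog_sum => w _; rewrite sign_mul; apply: homogZ.
have [/existsP[i neg]|/existsPn pos] :=
  boolP [exists i : 'I_(size la), szval la i + perm_shift w i < 0].
  by rewrite (bigD1 i) //= hZ_neg // mul0r; exact: homog0.
have -> : sumn la = (\sum_(i < size la) absz (szval la i + perm_shift w i)%R)%N.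
  suff : (sumn la)%:Z = \sum_(i < size la) (absz (szval la i + perm_shift w i))%:Z.
    by rewrite -(big_morph Posz PoszD (erefl _)) => -[].
  transitivity (\sum_(i < size la) (szval la i + perm_shift w i)); last first.
    by apply: eq_bigr => i _; have := pos i; lia.
  rewrite big_split /= (eq_bigr _ (fun i _ => perm_shiftE w i)) big_split /=.
  (* The displacements w(i) - i add up to 0. *)
  rewrite sumrN [X in _ + (X - _)](reindex_inj (@perm_inj _ w^-1)) /=.
  rewrite [X in X - _](eq_bigr (fun i : 'I_(size la) => i%:Z)) ?subrr ?addr0.
    by rewrite -(big_morph Posz PoszD (erefl _)) sumnE (big_nth 0%N) big_mkord.
  by move=> i _; rewrite permKV.
apply: homog_prod => i _; have := pos i; case: (szval la i + _) => // n _.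
exact: homog_hs.
Qed.

Lemma hform_prod_hZ f m (al : nat -> int) :
  (forall i : 'I_m, 0 <= al i) ->
  hform f (\prod_(i < m) hZ (al i)) = skews 1 (mkseq (fun i => absz (al i)) m) f.
Proof.
move=> al0; rewrite -hform_prod_hs /mkseq big_map -[m in iota 0 m]subn0 big_mkord.
by congr (hform _ _); apply: eq_bigr => i _; have := al0 i; case: (al i).
Qed.

Lemma is_part_sorted la : is_part la -> sorted geq la.
Proof. by case/andP. Qed.

(** The larger partition [ka] is expanded into products of h. Terms with [w] other than 1 lie above
    [ka], hence above [la], and pair to 0 with s_la by triangularity. *)
Lemma sch_orth_le la ka : is_part la -> is_part ka ->
  la = ka \/ lexgt (szval ka) (szval la) ->
  hform (sch la) (sch ka) = (la == ka)%:R.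
Proof.
move=> /is_part_sorted sla /is_part_sorted ska le.
rewrite [sch ka]sch_sum hform_sumr (bigD1 1%g) //= [X in _ + X]big1 ?addr0 => [|w w1].
  rewrite odd_perm1 mul1r.
  rewrite (_ : \prod_(i < size ka) _ = \prod_(n <- ka) hs n); last first.
    rewrite (big_nth 0%N) big_mkord; apply: eq_bigr => i _.
    by rewrite perm_shiftE perm1 subrr addr0.
  rewrite hform_prod_hs; have [<-|lk] := eqVneq la ka; first exact: skews1_self.
  by case: le => [E|le]; [rewrite E eqxx in lk|exact: skews1_lexgt].
rewrite sign_mul hformZr; apply/eqP; rewrite mulf_eq0; apply/orP; right.
pose al i := szval ka i + perm_shift w i.
have [/existsP[i neg]|/existsPn pos] := boolP [exists i : 'I_(size ka), al i < 0].
  by rewrite (bigD1 i) //= hZ_neg // mul0r hformC hform0l.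
rewrite (@hform_prod_hZ _ _ al) => [|i]; last by have := pos i; rewrite -leNgt.
rewrite skews1_lexgt //.
have gt : lexgt al (szval la).
  case: le => [->|le]; first exact: perm_shift_lexgt.
  exact: lexgt_trans (perm_shift_lexgt _ w1) le.
suff E i : szval (mkseq (fun i => absz (al i)) (size ka)) i = al i.
  by case: gt => i [lt eqs]; exists i; rewrite E; split=> // j ji; rewrite E eqs.
rewrite /szval; have [ik|ik] := ltnP i (size ka).
  by rewrite nth_mkseq //; have := pos (Ordinal ik); rewrite /=; lia.
rewrite nth_default ?size_mkseq // /al /szval nth_default //.
by rewrite /perm_shift insubF ?addr0 //; lia.
Qed.

Lemma sch_orth la ka : is_part la -> is_part ka ->
  hform (sch la) (sch ka) = (la == ka)%:R.
Proof.
move=> pla pka; have [->|lk] := eqVneq la ka.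
  by rewrite sch_orth_le ?eqxx //; left.
have [gt|gt] := part_total pla pka lk; last first.
  by rewrite sch_orth_le // ?(negPf lk) //; right.
by rewrite hformC sch_orth_le // ?[ka == la]eq_sym ?(negPf lk) //; right.
Qed.

(** * Schur functions form a basis *)

Definition parts (m : nat) : seq (seq nat) :=
  [seq la <- [::] :: nonempty_parts m | sumn la == m].

Lemma sumn_gt0 la : is_part la -> la != [::] -> (0 < sumn la)%N.
Proof.
by case: la => // x la /andP[_]; rewrite inE negb_or eq_sym -lt0n => /andP[x0 _] _;
  rewrite ltn_addr.
Qed.

Lemma mem_parts m la : (la \in parts m) = is_part la && (sumn la == m).
Proof.
rewrite mem_filter inE mem_nonempty_parts andbC.
have [->|la0] := eqVneq la [::]; first by rewrite /=; case: eqP.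
have [pla|] //= := boolP (is_part la); rewrite (sumn_gt0 pla la0) /=.
by case: eqP => [<-|]; rewrite ?leqnn ?andbF.
Qed.

Lemma parts_uniq m : uniq (parts m).
Proof.
apply: filter_uniq; rewrite cons_uniq nonempty_parts_uniq andbT.
by rewrite mem_nonempty_parts.
Qed.

Definition pwp (mu : seq nat) : Lam := \prod_(r <- mu) pw r.

Lemma lam_val_pwp mu : lam_val (pwp mu) = psum_part mu.
Proof. by rewrite /pwp rmorph_prod; apply: eq_bigr => r _; exact: lam_val_pw. Qed.

Lemma homog_pwp mu : 0%N \notin mu -> homog (sumn mu) (pwp mu).
Proof.
move=> mu0; rewrite sumnE /pwp !big_seq; apply: homog_prod => r rmu.
by apply: homog_pw; rewrite lt0n; apply: contraNneq mu0 => <-.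
Qed.

Lemma mon_pwp t : exists2 mu, is_part mu & mon t = pwp mu.
Proof.
elim/cmonom_ind: t => [|i t [mu /andP[_ mu0] tE]].
  by exists [::]; rewrite // /pwp big_nil mon1.
exists (sort geq (i.+1 :: mu)).
  by rewrite /is_part mem_sort inE mu0 andbT sort_sorted //= => x y; exact: leq_total.
rewrite -monM tE -[mon (ucm i)]/(mon (ucm i.+1.-1)) -pwE /pwp.
by rewrite (perm_big _ (permEl (perm_sort _ _))) big_cons.
Qed.

Lemma homog_inj d e f : homog d f -> homog e f -> f != 0 -> d = e.
Proof.
move=> hd he f0; have [t] : exists t, t \in lsupp f.
  by apply/fset0Pn; apply: contraNneq f0 => E; rewrite [f]lam_monE E big_seq_fset0.
by rewrite -mcf_neq0 => tf; rewrite -(hd _ tf) -(he _ tf).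
Qed.

Lemma mon_parts t : exists2 mu, mu \in parts (mon_deg t) & mon t = pwp mu.
Proof.
have [mu pmu E] := mon_pwp t; exists mu => //; rewrite mem_parts pmu /=.
have [_ mu0] := andP pmu; apply/eqP.
apply: (@homog_inj _ _ (mon t)); first by rewrite E; exact: homog_pwp.
  exact: homog_mon.
by apply/eqP => /(congr1 (mcf t)); rewrite mcf_mon mcf0 eqxx => /eqP; rewrite oner_eq0.
Qed.

Lemma pwp_span m f : homog m f ->
  exists c : seq nat -> rat, f = \sum_(mu <- parts m) c mu *: pwp mu.
Proof.
move=> hf; rewrite [f]lam_monE; elim: (lsupp f : seq _) => [|t r [c cE]].
  exists (fun _ => 0); rewrite big_nil big1 // => mu _; exact: scale0r.
rewrite big_cons {}cE; have [->|tf] := eqVneq (mcf t f) 0.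
  by rewrite scale0r add0r; exists c.
have [mu] := mon_parts t; rewrite (hf _ tf) => muP ->.
exists (fun nu => c nu + (nu == mu)%:R * mcf t f).
rewrite [RHS](eq_bigr (fun nu => c nu *: pwp nu + ((nu == mu)%:R * mcf t f) *: pwp nu)).
  rewrite big_split /= addrC; congr (_ + _).
  rewrite (bigD1_seq mu) ?parts_uniq //= eqxx mul1r big1 ?addr0 // => nu /negPf ->.
  by rewrite mul0r scale0r.
by move=> nu _; rewrite scalerDl.
Qed.

(* The transition matrices M from s to p and K from p to s satisfy M K = 1 by
   orthonormality, hence K M = 1 as both families are indexed by [parts m]. *)
Lemma sch_expansion m f : homog m f ->
  f = \sum_(la <- parts m) hform f (sch la) *: sch la.
Proof.
move=> hf; pose N := size (parts m); pose la (i : 'I_N) := nth [::] (parts m) i.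
have laP i : la i \in parts m by rewrite mem_nth.
have laI i j : (la i == la j) = (i == j) by rewrite nth_uniq ?parts_uniq.
have ssum (g : Lam -> Lam) (F : seq nat -> Lam) :
    \sum_(mu <- parts m) F mu = \sum_(i < N) F (la i).
  by rewrite (big_nth [::]) big_mkord.
have laS i : homog m (sch (la i)).
  by have := laP i; rewrite mem_parts => /andP[_ /eqP <-]; exact: homog_sch.
have [c cE] := fin_all_exists (fun i => pwp_span (laS i)).
pose M := \matrix_(i, j) c i (la j);
  pose K := \matrix_(j, i) hform (pwp (la j)) (sch (la i)).
have MK : M *m K = 1%:M.
  apply/matrixP => i k; rewrite !mxE -laI.
  have [pi pk] : is_part (la i) /\ is_part (la k).
    by have := laP i; have := laP k; rewrite !mem_parts => /andP[-> _] /andP[-> _].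
  rewrite -sch_orth // [sch (la i)]cE ssum // hform_suml.
  by apply: eq_bigr => j _; rewrite !mxE hformZl.
have KM := mulmx1C MK.
have pE j : pwp (la j) = \sum_(i < N) hform (pwp (la j)) (sch (la i)) *: sch (la i).
  transitivity (\sum_(l < N) (K *m M) j l *: pwp (la l)).
    rewrite KM (bigD1 j) //= !mxE eqxx scale1r big1 ?addr0 // => l lj.
    by rewrite !mxE eq_sym (negPf lj) scale0r.
  under eq_bigr do rewrite mxE scaler_suml.
  rewrite exchange_big; apply: eq_bigr => i _ /=.
  rewrite {2}cE ssum // scaler_sumr; apply: eq_bigr => l _.
  by rewrite !mxE scalerA.
have [d dE] := pwp_span hf.
rewrite {1}dE !ssum // {1}(eq_bigr _ (fun j _ => congr1 ( *:%R _) (pE j))).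
under eq_bigr do rewrite scaler_sumr.
rewrite exchange_big; apply: eq_bigr => i _ /=.
rewrite dE ssum // hform_suml scaler_suml; apply: eq_bigr => j _.
by rewrite hformZl scalerA.
Qed.

(** * A characterization of Schur functions *)

Lemma prod_add_sum (R : comNzRingType) (I : finType) (F G : I -> R) :
  \prod_i (F i + G i) = \sum_(J : {set I}) \prod_i (if i \in J then F i else G i).
Proof. by rewrite bigA_distr; apply: eq_bigl => J; rewrite inE. Qed.

Lemma coef_skew_e_prod m (al : 'I_m -> int) n :
  (skewp (-1) (\prod_(i < m) hZ (al i)))`_n
    = \sum_(J : {set 'I_m} | #|J| == n) \prod_(i < m) hZ (al i - (i \in J)%:Z).
Proof.
rewrite rmorph_prod /=.
transitivity ((\sum_(J : {set 'I_m})
    (\prod_(i < m) hZ (al i - (i \in J)%:Z))%:P * 'X^#|J|)`_n).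
  apply: (congr1 (fun p : {poly Lam} => p`_n)).
  under eq_bigr do rewrite skew_e addrC.
  rewrite prod_add_sum; apply: eq_bigr => J _.
  rewrite rmorph_prod -sum1_card -prodrXr [X in _ = _ * X]big_mkcond -big_split /=.
  by apply: eq_bigr => i _; case: (i \in J); rewrite ?subr0 ?mulr1.
rewrite coef_sum [RHS]big_mkcond; apply: eq_bigr => J _.
by rewrite coefCM coefXn eq_sym; case: eqP; rewrite ?mulr1 ?mulr0.
Qed.

Lemma eps_prod_hZ m (al : 'I_m -> int) :
  eps (\prod_(i < m) hZ (al i)) = [forall i, al i == 0]%:R.
Proof.
have [/forallP al0|/forallPn[i ali]] := boolP [forall i, al i == 0].
  by rewrite big1 ?eps1 // => i _; rewrite (eqP (al0 i)) hZ0.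
rewrite (bigD1 i) //= epsM; case: (al i) ali => [[|n]|n] //= _; last first.
  by rewrite /eps mcf0 mul0r.
by rewrite (homog_eps (@homog_hs n.+1)) ?mul0r.
Qed.

Lemma sum_ord_lt m s : (\sum_(i < m | (i < s)%N) 1 = minn m s)%N.
Proof.
elim: m => [|m IH]; first by rewrite big_ord0 min0n.
rewrite big_mkcond big_ord_recr /= -big_mkcond IH; case: ltnP; lia.
Qed.

(** Skewing by e_j lowers j distinct indices by 1, so the first s indices lose at most min(j, s) in
    total. Under the hypothesis they cannot all reach 0. *)
Lemma skews_e_eq0 ka m (al : 'I_m -> int) s :
  (\sum_(j <- ka) minn j s)%N%:Z < \sum_(i < m | (i < s)%N) al i ->
  skews (-1) ka (\prod_(i < m) hZ (al i)) = 0.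
Proof.
elim: ka al => [|n ka IH] al /=.
  rewrite big_nil => gt; rewrite eps_prod_hZ.
  have [/forallP al0|//] := boolP [forall i, al i == 0].
  by move: gt; rewrite big1 ?ltxx // => i _; exact/eqP.
rewrite big_cons => gt; rewrite coef_skew_e_prod skews_sum big1 // => J /eqP Jn.
apply: (IH (fun i => al i - (i \in J)%:Z)); rewrite big_split /= sumrN.
rewrite ltrBrDr (le_lt_trans _ gt) // PoszD addrC lerD2r.
rewrite -(big_morph Posz PoszD (erefl _)) lez_nat leq_min; apply/andP; split.
  rewrite -Jn -sum1_card big_mkcond [X in (_ <= X)%N]big_mkcond.
  by apply: leq_sum => i _; case: (i \in J); case: ifP.
apply: (@leq_trans (\sum_(i < m | (i < s)%N) 1)%N).
  by apply: leq_sum => i _; case: (i \in J).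
by rewrite sum_ord_lt geq_minr.
Qed.

Lemma skews_e_ge0 ka m (al : 'I_m -> int) :
  0 <= skews (-1) ka (\prod_(i < m) hZ (al i)).
Proof.
elim: ka al => [|n ka IH] al /=; first by rewrite eps_prod_hZ ler0n.
rewrite coef_skew_e_prod skews_sum; apply: sumr_ge0 => J _.
exact: (IH (fun i => al i - (i \in J)%:Z)).
Qed.

(** The sequence is the conjugate of [a]. Lowering all positive entries at each step ([J0]) strips
    the columns of the diagram in turn and is one admissible choice; the other choices contribute
    nonnegatively. *)
Lemma skews_e_gt0 M m (a : 'I_m -> nat) : (forall i, a i <= M)%N ->
  0 < skews (-1) (mkseq (fun j => #|[pred i | (j < a i)%N]|) M)
        (\prod_(i < m) hZ (a i)%:Z).
Proof.
elim: M a => [|M IH] a aM.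
  rewrite /= (eps_prod_hZ (fun i => (a i)%:Z)) ltr0n lt0b.
  by apply/forallP => i; have := aM i; rewrite leqn0.
rewrite /mkseq /= -[1%N]addn0 iotaDl -map_comp.
rewrite (coef_skew_e_prod (fun i => (a i)%:Z)) skews_sum.
pose J0 := [set i | (0 < a i)%N].
rewrite (bigD1 J0) /=; last by rewrite -sum1_card -[X in _ == X]sum1_card;
  apply/eqP/eq_bigl => i; rewrite !inE.
rewrite ltr_wpDr //.
  by apply: sumr_ge0 => J _; exact: (skews_e_ge0 _ (fun i => _ - _)).
have := IH (fun i => (a i).-1); rewrite /mkseq.
have -> : \prod_(i < m) hZ ((a i)%:Z - (i \in J0)%:Z) = \prod_(i < m) hZ (a i).-1%:Z.
  by apply: eq_bigr => i _; congr hZ; rewrite inE; lia.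
have -> : [seq #|[pred i | (j < (a i).-1)%N]| | j <- iota 0 M]
    = [seq ((fun j => #|[pred i | (j < a i)%N]|) \o addn 1) i | i <- iota 0 M].
  by apply: eq_map => j /=; apply: eq_card => i; rewrite !inE; lia.
by apply=> i; have := aM i; lia.
Qed.

(* The conjugate partition, padded with zeros. *)
Definition conjp (nu : seq nat) : seq nat :=
  mkseq (fun j => #|[pred i : 'I_(size nu) | (j < nth 0 nu i)%N]|) (sumn nu).

(** min(nu'_j, s) counts the cells of column j within the first s rows; the double sum is then read
    by rows. *)
Lemma conjp_min nu s : sorted geq nu ->
  (\sum_(j <- conjp nu) minn j s <= \sum_(i < size nu | (i < s)%N) nth 0 nu i)%N.
Proof.
move=> so; rewrite /conjp /mkseq big_map; move: (sumn nu) => M.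
rewrite -[M in iota 0 M]subn0 big_mkord.
have step (j : nat) : (minn #|[pred i : 'I_(size nu) | (j < nth 0 nu i)%N]| s
    <= \sum_(i < size nu | (i < s)%N) (j < nth 0 nu i)%N)%N.
  have [/forallP all|/forallPn[i0]] :=
    boolP [forall i : 'I_(size nu), (i < s)%N ==> (j < nth 0 nu i)%N].
    rewrite (eq_bigr (fun=> 1%N)) => [|i is_]; last by rewrite (implyP (all i) is_).
    by rewrite sum_ord_lt leq_min geq_minr geq_min (leq_trans (max_card _)) ?card_ord.
  rewrite negb_imply -leqNgt => /andP[i0s ji0].
  rewrite (leq_trans (geq_minl _ _)) // -sum1_card big_mkcond [X in (_ <= X)%N]big_mkcond.
  apply: leq_sum => i _; rewrite inE; case: (ltnP j (nth 0%N nu i)) => // ji;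
    case: (ltnP i s) => // si.
  have : (nth 0%N nu i <= nth 0%N nu i0)%N.
    have := @sorted_leq_nth _ geq (fun _ _ _ h1 h2 => leq_trans h2 h1) leqnn 0%N nu so.
    by apply; rewrite ?inE ?ltn_ord // (leq_trans _ si) // ltnW.
  by lia.
apply: (@leq_trans (\sum_(j < M) \sum_(i < size nu | (i < s)%N) (j < nth 0%N nu i))%N).
  by apply: leq_sum => j _; exact: step.
rewrite exchange_big /=; apply: leq_sum => i _.
rewrite (leq_trans (_ : _ <= \sum_(j < M | (j < nth 0 nu i)%N) 1)%N) //.
  by rewrite [X in (_ <= X)%N]big_mkcond; apply: leq_sum => j _; case: ltnP.
by rewrite sum_ord_lt geq_minr.
Qed.

Lemma big_ord_lt_narrow (V : nmodType) m s (F : nat -> V) : (s <= m)%N ->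
  \sum_(i < m | (i < s)%N) F i = \sum_(i < s) F i.
Proof. by move=> sm; rewrite (big_ord_widen m) . Qed.

Lemma sum_ord_lt_le m s (F : nat -> nat) :
  (\sum_(i < m | (i < s)%N) F i <= \sum_(i < s) F i)%N.
Proof.
have [ms|/ltnW sm] := leqP m s; last by rewrite (big_ord_widen _ _ sm).
rewrite (big_ord_widen_cond _ (fun i => (i < s)%N) F ms) big_mkcond.
by apply: leq_sum => i _; case: ifP.
Qed.

(** At the first difference i the partial sum of [al] up to i exceeds that of [nu], so [skews_e_eq0]
    applies with s = i + 1 by [conjp_min]. *)
Lemma skews_e_lexgt nu m (al : nat -> int) : is_part nu ->
  (forall i, (m <= i)%N -> al i = 0) -> lexgt al (szval nu) ->
  skews (-1) (conjp nu) (\prod_(i < m) hZ (al i)) = 0.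
Proof.
move=> /is_part_sorted so al0 [i [lt eqs]].
have im : (i < m)%N.
  by rewrite ltnNge; apply/negP => /al0 E; move: lt; rewrite E /szval; lia.
apply: (@skews_e_eq0 _ _ _ i.+1).
apply: (@le_lt_trans _ _ (\sum_(j < i.+1) szval nu j)).
  rewrite /szval -(big_morph Posz PoszD (erefl _)) lez_nat.
  apply: leq_trans (conjp_min i.+1 so) _.
  exact: sum_ord_lt_le.
rewrite (big_ord_lt_narrow al im) big_ord_recr [X in _ < X]big_ord_recr /=.
rewrite ler_ltD // le_eqVlt; apply/orP; left; apply/eqP.
by apply: eq_bigr => j _; rewrite eqs.
Qed.

Lemma szval_shift0 la w i : (size la <= i)%N ->
  szval la i + @perm_shift (size la) w i = 0.
Proof.
move=> li; rewrite /szval nth_default // /perm_shift insubF ?addr0 //.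
by apply/negbTE; rewrite -leqNgt.
Qed.

Lemma skews_e_sch_lexgt nu ka : is_part nu -> lexgt (szval ka) (szval nu) ->
  skews (-1) (conjp nu) (sch ka) = 0.
Proof.
move=> pnu gt; rewrite sch_sum skews_sum big1 // => w _.
rewrite sign_mul skewsZ.
rewrite (@skews_e_lexgt nu _ (fun i => szval ka i + perm_shift w i)) ?mulr0 //.
  exact: szval_shift0.
have [->|w1] := eqVneq w 1%g; last exact: lexgt_trans (perm_shift_lexgt _ w1) gt.
have E i : szval ka i + perm_shift (1%g : 'S_(size ka)) i = szval ka i.
  by rewrite /perm_shift; case: insubP => [j _ <-|_]; rewrite ?perm1 ?subrr addr0.
by case: gt => i [lt eqs]; exists i; rewrite E; split=> // j ji; rewrite E eqs.
Qed.

Lemma skews_e_sch_self nu : is_part nu -> 0 < skews (-1) (conjp nu) (sch nu).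
Proof.
move=> pnu; rewrite sch_sum skews_sum (bigD1 1%g) //= [X in _ + X]big1 ?addr0; last first.
  move=> w w1; rewrite sign_mul skewsZ.
  rewrite (@skews_e_lexgt nu _ (fun i => szval nu i + perm_shift w i)) ?mulr0 //.
    exact: szval_shift0.
  exact: perm_shift_lexgt.
rewrite odd_perm1 mul1r.
rewrite (eq_bigr (fun i : 'I_(size nu) => hZ (nth 0%N nu i)%:Z)); last first.
  by move=> i _; rewrite perm_shiftE perm1 subrr addr0.
have := @skews_e_gt0 (sumn nu) (size nu) (fun i => nth 0%N nu i); rewrite /conjp.
by apply=> i; apply: sumn_ge_mem; apply: mem_nth.
Qed.

Lemma count_ltn (T : eqType) (a b : pred T) (s : seq T) y :
  subpred a b -> y \in s -> b y -> ~~ a y -> (count a s < count b s)%N.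
Proof.
move=> ab ys yb ya; have [i [js sE]] : exists i, (i < size s)%N /\ nth y s i = y.
  by exists (index y s); rewrite index_mem nth_index.
rewrite -(cat_take_drop i s) (drop_nth y js) sE !count_cat /= (negPf ya) yb.
by rewrite add0n add1n addnS ltnS leq_add // sub_count.
Qed.

(** The measure is the number of elements of [s] related to x, made countable by turning the
    Prop-valued [R] into a boolean classically. *)
Lemma finite_rel_ind (T : eqType) (s : seq T) (R : T -> T -> Prop) (P : T -> Prop) :
  (forall x y z, R x y -> R y z -> R x z) -> (forall x, ~ R x x) ->
  (forall x, x \in s -> (forall y, y \in s -> R y x -> P y) -> P x) ->
  forall x, x \in s -> P x.
Proof.
move=> tr irr step x; pose c z := count (fun y => boolp.asbool (R y z)) s.
have [n] := ubnP (c x); elim: n x => // n IH x; rewrite ltnS => cn xs.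
apply: step => // y ys yx; apply: IH => //; apply: leq_trans cn.
apply: (@count_ltn _ _ _ _ y) => //.
- by move=> z /boolp.asboolP zy; apply/boolp.asboolP; apply: tr zy yx.
- exact/boolp.asboolP.
by apply/boolp.asboolP; exact: irr.
Qed.

Lemma lexgt_irr a : ~ lexgt a a.
Proof. by case=> i []; rewrite ltxx. Qed.

Lemma skews1_sch_eq0 nu ka : is_part ka -> is_part nu -> nu != ka ->
  ~ lexgt (szval ka) (szval nu) -> skews 1 nu (sch ka) = 0.
Proof.
move=> pka pnu nk le; apply: skews1_lexgt; first exact: is_part_sorted.
by case: (part_total pnu pka nk).
Qed.

Lemma skews_e_sch_eq0 nu ka : is_part ka -> is_part nu -> nu != ka ->
  ~ lexgt (szval nu) (szval ka) -> skews (-1) (conjp nu) (sch ka) = 0.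
Proof.
move=> pka pnu nk le; apply: skews_e_sch_lexgt => //.
by case: (part_total pnu pka nk).
Qed.

(* The first two conditions leave s_la and terms s_nu with nu < la in the
   expansion of [f]; the third one kills the latter, as <s_nu, e_{nu'}> > 0. *)
Lemma sch_unique m la f : homog m f -> la \in parts m ->
  (forall nu, nu \in parts m -> lexgt (szval nu) (szval la) -> skews 1 nu f = 0) ->
  skews 1 la f = 1 ->
  (forall nu, nu \in parts m -> lexgt (szval la) (szval nu) ->
     skews (-1) (conjp nu) f = 0) ->
  f = sch la.
Proof.
move=> hf laP H1 H2 H3; pose c nu := hform f (sch nu).
have cE := sch_expansion hf.
have isP nu : nu \in parts m -> is_part nu by rewrite mem_parts => /andP[].
have up nu : nu \in parts m -> lexgt (szval nu) (szval la) -> c nu = 0.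
  move: nu; apply: (@finite_rel_ind _ _ (fun ka nu => lexgt (szval ka) (szval nu))
    (fun nu => lexgt (szval nu) (szval la) -> c nu = 0)).
  - by move=> x y z; exact: lexgt_trans.
  - by move=> x; exact: lexgt_irr.
  move=> nu nuP IH gt; have := H1 nu nuP gt; rewrite cE skews_sum.
  rewrite (bigD1_seq nu) ?parts_uniq //= skewsZ skews1_self ?is_part_sorted ?isP //.
  rewrite mulr1 big1_seq ?addr0 // => ka /andP[kn kaP]; rewrite skewsZ.
  have [kgt|kle] := boolp.pselect (lexgt (szval ka) (szval nu)).
    by rewrite -/(c ka) (IH _ kaP kgt) ?mul0r //; exact: lexgt_trans gt.
  by rewrite skews1_sch_eq0 ?isP ?mulr0 // eq_sym.
have down nu : nu \in parts m -> lexgt (szval la) (szval nu) -> c nu = 0.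
  move: nu; apply: (@finite_rel_ind _ _ (fun ka nu => lexgt (szval nu) (szval ka))
    (fun nu => lexgt (szval la) (szval nu) -> c nu = 0)).
  - by move=> x y z /[swap]; exact: lexgt_trans.
  - by move=> x; exact: lexgt_irr.
  move=> nu nuP IH gt; have := H3 nu nuP gt; rewrite cE skews_sum.
  rewrite (bigD1_seq nu) ?parts_uniq //= skewsZ big1_seq ?addr0.
    move=> /eqP; rewrite mulf_eq0 => /orP[/eqP //|].
    by rewrite (gt_eqF (skews_e_sch_self (isP _ nuP))).
  move=> ka /andP[kn kaP]; rewrite skewsZ.
  have [kgt|kle] := boolp.pselect (lexgt (szval nu) (szval ka)).
    by rewrite -/(c ka) (IH _ kaP kgt) ?mul0r //; exact: lexgt_trans gt _.
  by rewrite skews_e_sch_eq0 ?isP ?mulr0 // eq_sym.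
have fE : f = c la *: sch la.
  rewrite {1}cE (bigD1_seq la) ?parts_uniq //= big1_seq ?addr0 // => nu /andP[nl nuP].
  have [gt|gt] := part_total (isP _ nuP) (isP _ laP) nl.
    by rewrite -/(c nu) up ?scale0r.
  by rewrite -/(c nu) down ?scale0r.
have := H2; rewrite fE skewsZ skews1_self ?is_part_sorted ?isP // mulr1 => ->.
by rewrite scale1r.
Qed.

(** * Counting words *)

(** Renames x_i into x_{i+1}, which sets x_0 free. *)
Definition shm (t : {cmonom nat}) : {cmonom nat} :=
  [cmonom t j.-1 | j in [fset i.+1 | i in finsupp t]%fset]%M.

Lemma shm0 t : shm t 0%N = 0%N.
Proof.
rewrite /shm cmE fsfun_fun; case: ifP => // /imfsetP[i _ /eqP].
by [].
Qed.

Lemma shmS (t : {cmonom nat}) i : shm t i.+1 = t i.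
Proof.
rewrite /shm cmE fsfun_fun; case: imfsetP => //= h; apply/esym/eqP.
by rewrite cmE_eq0; apply/negP => it; apply: h; exists i.
Qed.

Lemma shmM s t : shm (mmul s t) = mmul (shm s) (shm t).
Proof. by apply/eqP/cmP => -[|i]; rewrite !(shm0, shmS, cmM). Qed.

Lemma shmU i : shm (ucm i) = ucm i.+1.
Proof. by apply/eqP/cmP => -[|j]; rewrite ?shm0 ?shmS !cmU. Qed.

Lemma shm1 : shm mone = mone.
Proof. by apply/eqP/cmP => -[|j]; rewrite ?shm0 ?shmS !cm1. Qed.

(* Polynomials in variables x_0, x_1, ... are encoded in [Lam] itself, x_i being
   the generator p_{i+1}. *)
Definition xv (i : nat) : Lam := mon (ucm i).

Definition shift_lam : Lam -> Lam := ev (fun i => xv i.+1).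

HB.instance Definition _ := GRing.RMorphism.copy shift_lam (ev (fun i => xv i.+1)).
HB.instance Definition _ := GRing.Linear.copy shift_lam (ev (fun i => xv i.+1)).

Lemma shift_mon t : shift_lam (mon t) = mon (shm t).
Proof.
rewrite /shift_lam ev_mon; elim/cmonom_ind: t => [|i t IH].
  by rewrite mon_eval1 shm1 mon1.
by rewrite mon_evalM mon_evalU IH shmM shmU /xv monM.
Qed.

Definition ucmX i k : {cmonom nat} := iter k (mmul (ucm i)) mone.

Lemma ucmXE i k j : ucmX i k j = (k * (i == j))%N.
Proof.
elim: k => [|k IH]; first by rewrite cm1.
by rewrite /= cmM cmU IH mulSn.
Qed.

Lemma xvX i k : xv i ^+ k = mon (ucmX i k).
Proof.
by elim: k => [|k IH]; rewrite ?expr0 ?mon1 // exprS IH /xv monM.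
Qed.

Fixpoint mseq (nu : seq nat) : {cmonom nat} :=
  if nu is n :: nu' then mmul (ucmX 0 n) (shm (mseq nu')) else mone.

Lemma mseqE nu i : mseq nu i = nth 0%N nu i.
Proof.
elim: nu i => [|n nu IH] [|i] /=; rewrite ?cm1 // cmM ucmXE ?shm0 ?shmS ?IH //.
  by rewrite muln1 addn0.
by rewrite muln0.
Qed.

(** A shifted polynomial does not involve x_0, so the exponent of x_0 and the remaining exponents
    are read off separately. *)
Lemma mcf_shift t n g k :
  mcf (mmul (ucmX 0 n) (shm t)) (shift_lam g * xv 0 ^+ k) = (k == n)%:R * mcf t g.
Proof.
rewrite xvX; move: g.
apply: (@linear_eq_mon rat^o) => [a f g|a f g|s].
- by rewrite /shift_lam linearP mulrDl -scalerAl mcfD mcfZ.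
- by rewrite mcfD mcfZ mulrDr mulrCA.
rewrite shift_mon monM !mcf_mon -natrM mulnb; congr (_%:R); congr nat_of_bool.
apply/eqP/andP => [E|[/eqP -> /eqP ->]]; last by rewrite mulmC.
have E' i : mmul (shm s) (ucmX 0 k) i = mmul (ucmX 0 n) (shm t) i by rewrite E.
split; first by have := E' 0%N; rewrite !cmM !ucmXE !shm0 !muln1 add0n addn0 => ->.
apply/eqP/eqP/cmP => i; have := E' i.+1.
by rewrite !cmM !ucmXE !shmS !muln0 add0n addn0.
Qed.

Lemma mcf_sum t I r (P : pred I) (F : I -> Lam) :
  mcf t (\sum_(i <- r | P i) F i) = \sum_(i <- r | P i) mcf t (F i).
Proof. exact: (big_morph (mcf t) (mcfD t) (mcf0 t)). Qed.

Lemma card_porbits_sum (T : finType) (s : {perm T}) :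
  #|T| = (\sum_(c in porbits s) #|c|)%N.
Proof.
rewrite -sum1_card (partition_big (porbit s) (mem (porbits s))) /=; last first.
  by move=> x _; apply: imset_f.
apply: eq_bigr => c cs; rewrite -sum1_card; apply: eq_bigl => x.
apply/eqP/idP => [<-|]; first exact: porbit_id.
by move=> xc; rewrite (porbit_in cs xc).
Qed.

Section Words.

Variable u : rat.

(** For [u = 1] the power sum p_{r+1} of N variables, for [u = -1] its image under omega. *)
Definition pwx N (r : nat) : Lam := \sum_(i < N) u ^+ r *: xv i ^+ r.+1.
Definition evx N : Lam -> Lam := ev (pwx N).

HB.instance Definition _ N := GRing.RMorphism.copy (evx N) (ev (pwx N)).
HB.instance Definition _ N := GRing.Linear.copy (evx N) (ev (pwx N)).

(** Splitting x_0 off the alphabet is the translation performed by [skewp], the other variables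
    being renamed. *)
Lemma evxS N f :
  evx N.+1 f = (map_poly (shift_lam \o evx N) (skewp u f)).[xv 0].
Proof.
pose phi : {rmorphism Lam -> Lam} := shift_lam \o evx N.
have phiZ c g : phi (c *: g) = c *: phi g by rewrite /phi /= !linearZ.
rewrite -[_ \o _]/(phi : Lam -> Lam).
pose H (p : {poly Lam}) := (map_poly phi p).[xv 0].
have HD p q : H (p + q) = H p + H q by rewrite /H rmorphD hornerD.
have HM p q : H (p * q) = H p * H q by rewrite /H rmorphM hornerM.
have HC c : H c%:P = phi c by rewrite /H map_polyC hornerC.
have HX k : H 'X^k = xv 0 ^+ k by rewrite /H map_polyXn hornerXn.
have HA c : H (c%:A)%:P = c%:A by rewrite HC phiZ rmorph1.
rewrite -/(H _); move: f; apply: lam_ind => [c f g IHf IHg||i f IH].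
- by rewrite skewD skewZ HD HM HA -IHf -IHg mulr_algl /evx linearP.
- by rewrite skew1 /evx !rmorph1 -[1 in RHS]/(1%:P) HC rmorph1.
rewrite skewM HM -IH /evx rmorphM; congr (_ * _).
rewrite /= ev_pw skew_pw /skew_var HD HM HA HC HX /pwx big_ord_recl addrC.
congr (_ + _); last by rewrite mulr_algl.
rewrite /phi /= /evx ev_pw /= /pwx raddf_sum; apply: eq_bigr => j _.
by rewrite /= /shift_lam linearZ rmorphXn /= /xv ev_mon mon_evalU.
Qed.

(** The classical fact that <f, h_nu> is the coefficient of x^nu in f, proved by splitting off one
    variable for each part of [nu]. *)
Lemma mcf_evx nu f : mcf (mseq nu) (evx (size nu) f) = skews u nu f.
Proof.
elim: nu f => [|n nu IH] f /=.
  rewrite /eps; move: f; apply: lam_ind => [c f g IHf IHg||i f IH].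
  - by rewrite /evx linearP !mcfD !mcfZ IHf IHg.
  - by rewrite /evx rmorph1.
  rewrite /= -!/(eps _) /evx rmorphM !epsM /= ev_pw /pwx big_ord0 eps_pw.
  by rewrite /eps mcf0 !mul0r.
rewrite evxS horner_coef mcf_sum /=.
pose p := skewp u f.
have szp : (size (map_poly (shift_lam \o evx (size nu)) p) <= size p)%N.
  exact: size_poly.
transitivity (\sum_(k < size p) (k == n :> nat)%:R * skews u nu p`_k).
  rewrite (big_ord_widen _ (fun k => mcf (mmul (ucmX 0 n) (shm (mseq nu)))
     ((map_poly (shift_lam \o evx (size nu)) p)`_k * xv 0 ^+ k)) szp).
  rewrite big_mkcond; apply: eq_bigr => k _; rewrite -IH -mcf_shift.
  case: ifP => [_|/negbT]; first by rewrite coef_map.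
  rewrite -leqNgt => ge.
  have : (map_poly (shift_lam \o evx (size nu)) p)`_k = 0 by rewrite nth_default.
  by rewrite coef_map /= => ->; rewrite mul0r mcf0.
have [np|np] := ltnP n (size p).
  rewrite (bigD1 (Ordinal np)) //= eqxx mul1r big1 ?addr0 // => k.
  by rewrite -val_eqE /= => /negPf ->; rewrite mul0r.
rewrite -/p nth_default // raddf0 big1 // => k _.
by rewrite (_ : (_ == _) = false) ?mul0r //; have := ltn_ord k; lia.
Qed.

(** A word fixed by [s] is one choice of letter per cycle, so distributing the product of power sums
    enumerates these words. The powers u^(|c|-1) multiply to the one in front. *)
Lemma evx_wt N (T : finType) (s : {perm T}) :
  evx N.+1 (wt s) = u ^+ (#|T| - #|porbits s|) *:
    \sum_(w : {ffun T -> 'I_N.+1} | [forall z, w (s z) == w z]) \prod_z xv (w z).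
Proof.
have -> : evx N.+1 (wt s)
    = \prod_(c in porbits s) \sum_(i < N.+1) u ^+ #|c|.-1 *: xv i ^+ #|c|.
  rewrite /evx rmorph_prod; apply: eq_bigr => c /imsetP[z _ ->] /=.
  by rewrite ev_pw /pwx prednK // lt0n card_porbit_neq0.
rewrite (big_distr_big_dep (@ord0 N)) /=.
pose rep (c : {set T}) := [pick z in c].
(* The distributed product runs over functions on all sets, equal to the default [ord0] off the
   orbits. *)
pose h (w : {ffun T -> 'I_N.+1}) : {ffun {set T} -> 'I_N.+1} :=
  [ffun c => if c \in porbits s then oapp w ord0 (rep c) else ord0].
pose h' (g : {ffun {set T} -> 'I_N.+1}) : {ffun T -> 'I_N.+1} :=
  [ffun z => g (porbit s z)].
have repP z : exists2 y, rep (porbit s z) = Some y & y \in porbit s z.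
  rewrite /rep; case: pickP => [y yz|/(_ z)]; first by exists y.
  by rewrite porbit_id.
rewrite (reindex_onto h h') /= => [|g /pfamilyP[gs _]]; last first.
  apply/ffunP => c; rewrite ffunE; case: ifP => [/imsetP[z _ ->]|cs]; last first.
    by apply/esym/eqP; apply: contraFT cs => gc; exact: (subsetP gs).
  have [y -> yz] := repP z; rewrite /= ffunE; congr (g _).
  by apply/eqP; rewrite eq_porbit_mem.
have const (w : {ffun T -> 'I_N.+1}) z y : [forall z, w (s z) == w z] ->
    y \in porbit s z -> w y = w z.
  move=> /forallP ws /porbitP[k ->]; elim: k => [|k IH]; first by rewrite expg0 perm1.
  by rewrite expgSr permM (eqP (ws _)).
rewrite scaler_sumr; apply: eq_big => [w|w].
  apply/andP/idP => [[_ /eqP wE]|ws].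
    have hw z : w z = h w (porbit s z) by rewrite -{1}wE ffunE.
    apply/forallP => z; rewrite !hw; apply/eqP; congr (fun_of_fin _ _).
    by apply/eqP; rewrite eq_porbit_mem -{1}[s]expg1 mem_porbit.
  split.
    apply/pfamilyP; split=> [|c _]; last by [].
    by apply/subsetP => c; rewrite inE ffunE; case: ifP => // _; rewrite eqxx.
  apply/eqP/ffunP => z; rewrite !ffunE imset_f //.
  by have [y -> yz] := repP z; rewrite /= (const w z).
move=> /andP[_ /eqP wE].
have hw z : h w (porbit s z) = w z by rewrite -[in RHS]wE [RHS]ffunE.
rewrite scaler_prod prodrXr; congr (_ ^+ _ *: _).
  rewrite (card_porbits_sum s) -[#|porbits s|]sum1_card -sumnB.
    by apply: eq_bigr => c _; rewrite subn1.
  move=> c /imsetP[z _ ->]; by rewrite lt0n card_porbit_neq0.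
rewrite [RHS](partition_big (porbit s) (mem (porbits s))) => [|z _]; last exact: imset_f.
apply: eq_bigr => c /imsetP[y _ ->]; rewrite -prodr_const.
apply: eq_big => [z|z zy]; first by rewrite eq_porbit_mem.
by congr xv; rewrite -hw; congr (h w _); apply/esym/eqP; rewrite eq_porbit_mem.
Qed.

End Words.

Definition has_content (T : finType) nu (w : {ffun T -> 'I_(size nu)}) : bool :=
  [forall i, #|[pred z | w z == i]| == nth 0%N nu i].

Lemma mcf_word (T : finType) nu (w : {ffun T -> 'I_(size nu)}) :
  mcf (mseq nu) (\prod_z xv (w z)) = (has_content w)%:R.
Proof.
have [t tE tv] : exists2 t, \prod_z xv (w z) = mon t
    & forall i, t i = #|[pred z | w z == i :> nat]|.
  have gen (r : seq T) : exists2 t, \prod_(z <- r) xv (w z) = mon t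
      & forall i, t i = count (fun z => w z == i :> nat) r.
    elim: r => [|z r [t tE tv]]; first by exists mone => [|i]; rewrite ?big_nil ?mon1 ?cm1.
    exists (mmul (ucm (nat_of_ord (w z))) t) => [|i]; first by rewrite big_cons tE /xv monM.
    by rewrite cmM cmU tv.
  have [t tE tv] := gen (index_enum T); exists t => // i.
  by rewrite tv -sum1_card -sum1_count.
rewrite tE mcf_mon; congr (_%:R); congr nat_of_bool.
apply/eqP/forallP => [E i|con].
  apply/eqP; rewrite -mseqE -E tv; apply: eq_card => z.
  by rewrite !inE.
apply/eqP/cmP => i; rewrite tv mseqE; have [im|im] := ltnP i (size nu).
  rewrite -(eqP (con (Ordinal im))); apply: eq_card => z.
  by rewrite !inE.
rewrite nth_default //; apply: eq_card0 => z; rewrite inE.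
by apply/negbTE; rewrite neq_ltn (leq_trans (ltn_ord _) im).
Qed.

(** The permutation character on words of content [nu], twisted by the sign character if [u = -1]
    (see [sign_porbits]). With [nu] non-empty there is a default letter for [evx_wt]. *)
Lemma skews_wt u nu (T : finType) (s : {perm T}) : nu != [::] ->
  skews u nu (wt s) = u ^+ (#|T| - #|porbits s|) *
    (#|[set w : {ffun T -> 'I_(size nu)} |
         [forall z, w (s z) == w z] && has_content w]|)%:R.
Proof.
case: nu => // n nu _; rewrite -mcf_evx evx_wt mcfZ mcf_sum; congr (_ * _).
rewrite -sum1_card natr_sum big_mkcond [RHS]big_mkcond; apply: eq_bigr => w _.
rewrite (mcf_word (nu := n :: nu)) inE; by case: [forall z, _]; case: has_content.
Qed.

Lemma sign_porbits (T : finType) (s : {perm T}) :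
  (-1) ^+ (#|T| - #|porbits s|) = (-1) ^+ odd_perm s :> rat.
Proof.
rewrite -signr_odd oddB ?/odd_perm // (card_porbits_sum s) -sum1_card.
by apply: leq_sum => c /imsetP[z _ ->]; rewrite lt0n card_porbit_neq0.
Qed.

(** * The characteristic map *)

Lemma hform_hs_pwp mu : 0%N \notin mu -> hform (hs (sumn mu)) (pwp mu) = 1.
Proof.
rewrite /pwp; elim: mu => [|r mu IH] /=; first by rewrite big_nil hs0 hform1 eps1.
rewrite inE negb_or eq_sym -lt0n => /andP[r0 mu0]; rewrite big_cons.
case: r r0 => // i _; rewrite -hform_dp -[hs _]/(hZ (i.+1 + sumn mu)%N%:Z) dp_hZ.
by rewrite (_ : _ - _ = (sumn mu)%:Z) ?[hZ _]/(hs (sumn mu)) ?IH //; lia.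
Qed.

Lemma wt_pwp (T : finType) (s : {perm T}) : exists2 t, wt s = mon t & mon_deg t = #|T|.
Proof.
have gen (r : seq {set T}) : exists t, \prod_(c <- r) pw #|c| = mon t.
  elim: r => [|c r [t tE]]; first by exists mone; rewrite big_nil mon1.
  by exists (mmul (ucm #|c|.-1) t); rewrite big_cons tE pwE monM.
have [t tE] := gen (enum (porbits s)).
have wE : wt s = mon t by rewrite -tE /cycle_prod big_enum.
exists t => //; apply: (@homog_inj _ _ (mon t)); first exact: homog_mon.
  by rewrite -wE; exact: homog_wt.
by apply/eqP => /(congr1 (mcf t)); rewrite mcf_mon mcf0 eqxx => /eqP; rewrite oner_eq0.
Qed.

(** For g = p_mu only the [s] with [wt s] = p_mu contribute, and their total weight is <p_mu, m!
    h_m> = m! by [sum_wt]. The general case is linear. *)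
Lemma frobenius_expansion m g : homog m g ->
  (m`!%:R : rat)^-1 *: \sum_(s : 'S_m) hform g (wt s) *: wt s = g.
Proof.
move=> hg; have step t : mon_deg t = m ->
    (m`!%:R : rat)^-1 *: \sum_(s : 'S_m) hform (mon t) (wt s) *: wt s = mon t.
  move=> tm; rewrite (eq_bigr (fun s => hform (mon t) (wt s) *: mon t)) => [|s _].
    have [mu muP tE] := mon_parts t.
    move: muP; rewrite mem_parts tm => /andP[/andP[_ mu0] /eqP mum].
    rewrite -scaler_suml -hform_sumr sum_wt hformZr tE hformC -mum hform_hs_pwp //.
    by rewrite mulr1 scalerA mulVf ?scale1r ?fact_neq0.
  have [r -> _] := wt_pwp s; rewrite hform_monl mcf_mon.
  by have [->|] := eqVneq r t; rewrite // mul0r !scale0r.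
have gE : g = \sum_(t <- lsupp g | mon_deg t == m) mcf t g *: mon t.
  rewrite {1}[g]lam_monE [RHS]big_mkcond; apply: eq_bigr => t _.
  have [->|/hg ->] := eqVneq (mcf t g) 0; last by rewrite eqxx.
  by rewrite scale0r if_same.
rewrite [RHS]gE [RHS](eq_bigr (fun t => mcf t g *: ((m`!%:R : rat)^-1 *:
  \sum_(s : 'S_m) hform (mon t) (wt s) *: wt s))) => [|t /eqP /step -> //].
transitivity ((m`!%:R : rat)^-1 *: \sum_(t <- lsupp g | mon_deg t == m)
  \sum_(s : 'S_m) (mcf t g * hform (mon t) (wt s)) *: wt s).
  congr (_ *: _); rewrite exchange_big; apply: eq_bigr => s _ /=.
  rewrite {1}gE hform_suml scaler_suml; apply: eq_bigr => t _.
  by rewrite hformZl.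
rewrite scaler_sumr; apply: eq_bigr => t _.
rewrite scalerA mulrC -scalerA; congr (_ *: _); rewrite scaler_sumr.
by apply: eq_bigr => s _; rewrite scalerA.
Qed.

(** * Young symmetrizers *)

Section Young.

Variable la : seq nat.
Hypothesis la_part : is_part la.
Local Notation m := (sumn la).
Local Notation row := (reshape_index la).
Local Notation col := (reshape_offset la).
Local Notation R := (row_stab la).
Local Notation K := (col_stab la).

Lemma cell_inj (i j : 'I_m) : row i = row j -> col i = col j -> i = j.
Proof.
move=> rE cE; have [_ _ iE] := row_of_lt (ltn_ord i).
by have [_ _ jE] := row_of_lt (ltn_ord j); apply: val_inj; rewrite /= -iE -jE rE cE.
Qed.

Lemma cell_ex r c : (r < size la)%N -> (c < nth 0%N la r)%N ->
  exists i : 'I_m, row i = r /\ col i = c.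
Proof.
move=> rs cl; exists (Ordinal (flatten_indexP cl)) => /=.
by rewrite flatten_indexKl // flatten_indexKr.
Qed.

Lemma la_noninc r r' : (r <= r')%N -> (nth 0%N la r' <= nth 0%N la r)%N.
Proof.
move=> rr; have [r's|r's] := ltnP r' (size la); last by rewrite [nth _ _ r']nth_default.
have := @sorted_leq_nth _ geq (fun _ _ _ h1 h2 => leq_trans h2 h1) leqnn 0%N la
  (is_part_sorted la_part).
by apply; rewrite ?inE // (leq_ltn_trans rr).
Qed.

Lemma mem_R (p : 'S_m) : (p \in R) = [forall i, row (p i) == row i].
Proof. by rewrite inE. Qed.
Lemma mem_K (p : 'S_m) : (p \in K) = [forall i, col (p i) == col i].
Proof. by rewrite inE. Qed.

Lemma R_row (p : 'S_m) i : p \in R -> row (p i) = row i.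
Proof. by rewrite mem_R => /forallP/(_ i)/eqP. Qed.
Lemma K_col (p : 'S_m) i : p \in K -> col (p i) = col i.
Proof. by rewrite mem_K => /forallP/(_ i)/eqP. Qed.

Lemma R_group : group_set R.
Proof.
apply/group_setP; split=> [|p q pR qR]; rewrite mem_R; apply/forallP => i.
  by rewrite perm1.
by rewrite permM !R_row.
Qed.
Lemma K_group : group_set K.
Proof.
apply/group_setP; split=> [|p q pK qK]; rewrite mem_K; apply/forallP => i.
  by rewrite perm1.
by rewrite permM !K_col.
Qed.
Canonical Rg := Group R_group.
Canonical Kg := Group K_group.

Lemma RK_trivial x : x \in R -> x \in K -> x = 1%g.
Proof.
move=> xR xK; apply/permP => i; rewrite perm1.
by apply: cell_inj; rewrite ?R_row ?K_col.
Qed.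

Lemma tperm_R (i j : 'I_m) : row i = row j -> tperm i j \in R.
Proof.
by move=> E; rewrite mem_R; apply/forallP => k; case: tpermP => [->|->|//]; rewrite ?E.
Qed.
Lemma tperm_K (i j : 'I_m) : col i = col j -> tperm i j \in K.
Proof.
by move=> E; rewrite mem_K; apply/forallP => k; case: tpermP => [->|->|//]; rewrite ?E.
Qed.

Section ColumnWords.

Variables (N : nat) (w : 'I_m -> 'I_N).
Hypothesis w_inj : forall i j : 'I_m, col i = col j -> w i = w j -> i = j.

(** If column c has a cell in a row >= s, the right side is at least s, while distinct letters below
    s number at most s. Otherwise all cells of the column count on the right. *)
Lemma col_word_le s (c : nat) :
  (#|[pred z : 'I_m | (col z == c) && (w z < s)]|
     <= #|[pred z : 'I_m | (col z == c) && (row z < s)]|)%N.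
Proof.
have [/existsP[z0 /andP[/eqP cz0 sz0]]|/existsPn none] :=
    boolP [exists z : 'I_m, (col z == c) && (s <= row z)%N].
  have le_s : (#|[pred z : 'I_m | (col z == c) && (w z < s)%N]| <= s)%N.
    pose f (z : 'I_m) : 'I_s.+1 := inord (w z).
    rewrite -(@card_in_image _ _ f) => [|z z' /= /andP[/eqP cz wz] /andP[/eqP cz' wz']].
      apply: (@leq_trans #|[pred k : 'I_s.+1 | (k < s)%N]|).
        apply: subset_leq_card; apply/subsetP => k /imageP[z /andP[_ wz] ->].
        by rewrite inE /f inordK // ltnS ltnW.
      apply: eq_leq; rewrite -[RHS](minn_idPr (leqnSn s)) -sum_ord_lt -sum1_card.
      exact: eq_bigl.
    move=> /(congr1 val); rewrite /f /= !inordK ?ltnS 1?ltnW // => E.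
    by apply: w_inj; [rewrite cz|apply: val_inj].
  apply: leq_trans le_s _.
  have ex (r : 'I_s) : exists z : 'I_m, (row z == r) && (col z == c).
    have [rz0 cz0' _] := row_of_lt (ltn_ord z0).
    have [||i [ri ci]] := @cell_ex r c; last by exists i; rewrite ri ci !eqxx.
      by rewrite (leq_trans (ltn_ord r)) // (leq_trans sz0) // ltnW.
    rewrite -cz0; apply: leq_trans cz0' _; apply: la_noninc.
    by rewrite (leq_trans (ltnW (ltn_ord r))).
  have [g gP] := fin_all_exists ex.
  rewrite -[s in (s <= _)%N]card_ord -(@card_image _ _ g) => [|r r' /= E].
    apply: subset_leq_card; apply/subsetP => z /imageP[r _ ->].
    by have /andP[/eqP rE cE] := gP r; rewrite inE cE rE ltn_ord.
  have /andP[/eqP rE _] := gP r; have /andP[/eqP rE' _] := gP r'.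
  by apply: val_inj; rewrite /= -rE -rE' E.
apply: subset_leq_card; apply/subsetP => z; rewrite !inE => /andP[cz _].
by have := none z; rewrite cz /= -ltnNge.
Qed.

Lemma card_by_col (P : pred 'I_m) :
  #|[pred z | P z]| = (\sum_(c < m.+1) #|[pred z : 'I_m | (col z == c) && P z]|)%N.
Proof.
have cm (z : 'I_m) : (col z < m.+1)%N.
  have [rz cz _] := row_of_lt (ltn_ord z); rewrite ltnS ltnW // (leq_trans cz) //.
  by apply: sumn_ge_mem; apply: mem_nth.
rewrite -sum1_card (partition_big (fun z => Ordinal (cm z)) xpredT) //=.
apply: eq_bigr => c _; rewrite -sum1_card; apply: eq_bigl => z.
by rewrite !inE andbC -val_eqE.
Qed.

Lemma word_dominance s :
  (#|[pred z : 'I_m | (w z < s)%N]| <= #|[pred z : 'I_m | (row z < s)%N]|)%N.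
Proof.
rewrite (card_by_col (fun z => w z < s)%N) (card_by_col (fun z => row z < s)%N).
by apply: leq_sum => c _; exact: col_word_le.
Qed.

(** Equality of the totals forces equality in every column and for every s. Each column then holds
    exactly its row numbers as letters, and sorting the columns gives [q]. *)
Lemma word_straighten :
  (forall s, #|[pred z : 'I_m | (w z < s)%N]| = #|[pred z : 'I_m | (row z < s)%N]|) ->
  exists2 q, q \in K & forall z, w (q z) = row z :> nat.
Proof.
move=> E.
have eqc s (c : 'I_m.+1) : #|[pred z : 'I_m | (col z == c) && (w z < s)%N]|
    = #|[pred z : 'I_m | (col z == c) && (row z < s)%N]|.
  have := leqif_sum (fun c (_ : true) => leqif_eq (col_word_le s (c : 'I_m.+1))).
  case=> _;
    rewrite -(card_by_col (fun z => w z < s)%N) -(card_by_col (fun z => row z < s)%N).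
  by rewrite E eqxx => /esym/forallP/(_ c)/eqP.
have ex (z : 'I_m) : exists z' : 'I_m, (col z' == col z) && (w z' == row z :> nat).
  have cm : (col z < m.+1)%N.
    have [rz cz _] := row_of_lt (ltn_ord z); rewrite ltnS ltnW // (leq_trans cz) //.
    by apply: sumn_ge_mem; apply: mem_nth.
  have E1 := eqc (row z).+1 (Ordinal cm); have E0 := eqc (row z) (Ordinal cm).
  apply/existsP; apply: contraT => /existsPn none.
  have lt : (#|[pred y : 'I_m | (col y == col z) && (row y < row z)%N]|
      < #|[pred y : 'I_m | (col y == col z) && (row y < (row z).+1)%N]|)%N.
    apply: proper_card; apply/properP; split.
      by apply/subsetP => y; rewrite !inE => /andP[-> /ltnW]; rewrite ltnS.
    by exists z; rewrite !inE ?eqxx ?ltnn ?ltnSn.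
  move: lt; rewrite -E1 -E0 /= ltnNge => /negP[]; apply: subset_leq_card.
  apply/subsetP => y; rewrite !inE ltnS leq_eqVlt => /andP[cy /orP[wy|->]].
    by have := none y; rewrite cy wy.
  by rewrite cy.
have [f fP] := fin_all_exists ex.
have finj : injective f.
  move=> z z' ff; have /andP[/eqP c1 /eqP r1] := fP z; have /andP[/eqP c2 /eqP r2] := fP z'.
  by apply: cell_inj; [rewrite -r1 -r2 ff|rewrite -c1 -c2 ff].
exists (perm finj) => [|z]; last by rewrite permE; have /andP[_ /eqP] := fP z.
by rewrite mem_K; apply/forallP => z; rewrite permE; have /andP[] := fP z.
Qed.

End ColumnWords.

Lemma card_row i : #|[pred z : 'I_m | row z == i]| = nth 0%N la i.
Proof.
have lt (c : 'I_(nth 0%N la i)) := flatten_indexP (ltn_ord c).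
rewrite -[RHS]card_ord -(@card_image _ _ (fun c => Ordinal (lt c))) => [|c c' [] E].
  apply: eq_card => z; rewrite inE; apply/eqP/imageP => [zi|[c _ ->]].
    have [_ cz zE] := row_of_lt (ltn_ord z); rewrite zi in cz zE.
    by exists (Ordinal cz) => //; apply: val_inj; rewrite /= zE.
  by rewrite /= flatten_indexKl.
apply: val_inj => /=; rewrite -(flatten_indexKr (ltn_ord c)) E.
by rewrite flatten_indexKr.
Qed.

Lemma card_val_lt (f : 'I_m -> nat) (nu : seq nat) s :
  (forall i, #|[pred z : 'I_m | f z == i]| = nth 0%N nu i) ->
  #|[pred z : 'I_m | (f z < s)%N]| = (\sum_(i < s) nth 0%N nu i)%N.
Proof.
move=> fE; elim: s => [|s IH]; first by rewrite big_ord0; apply: eq_card0.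
rewrite big_ord_recr -IH -fE /= -cardUI [X in (_ + X)%N]eq_card0 ?addn0.
  by apply: eq_card => z; rewrite !inE ltnS leq_eqVlt orbC.
by move=> z; rewrite !inE; case: eqP => [->|]; rewrite ?ltnn ?andbF.
Qed.

Lemma content_card nu (w : {ffun 'I_m -> 'I_(size nu)}) : has_content w ->
  forall i, #|[pred z : 'I_m | w z == i :> nat]| = nth 0%N nu i.
Proof.
move=> /forallP con i; have [im|im] := ltnP i (size nu).
  by rewrite -(eqP (con (Ordinal im))); apply: eq_card => z; rewrite !inE.
rewrite nth_default //; apply: eq_card0 => z; rewrite inE.
by apply/negbTE; rewrite neq_ltn (leq_trans (ltn_ord _) im).
Qed.

Notation sgn q := ((-1) ^+ odd_perm q : rat).

(* The coefficient of [g] in a x b, where a is the sum of the row stabilizer and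
   b the signed sum of the column stabilizer. *)
Definition ysand (x g : 'S_m) : rat :=
  \sum_(p in R) \sum_(q in K) sgn q * (p * x * q == g)%g%:R.

Lemma sgnM (q q' : 'S_m) : sgn (q * q')%g = sgn q * sgn q'.
Proof. by rewrite odd_permM signr_addb. Qed.

Lemma sum_Rl (V : nmodType) (F : 'S_m -> V) r : r \in R ->
  \sum_(p in R) F p = \sum_(p in R) F (p * r)%g.
Proof.
move=> rR; rewrite (reindex_inj (mulIg r)) /=; apply: eq_bigl => p.
by rewrite (groupMr _ (rR : r \in Rg)).
Qed.

Lemma sum_Kl (V : nmodType) (F : 'S_m -> V) r : r \in K ->
  \sum_(p in K) F p = \sum_(p in K) F (r * p)%g.
Proof.
move=> rR; rewrite (reindex_inj (mulgI r)) /=; apply: eq_bigl => p.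
by rewrite (groupMl _ (rR : r \in Kg)).
Qed.

Lemma ysand_prod p0 q0 g : p0 \in R -> q0 \in K ->
  ysand (p0 * q0)%g g = sgn q0 * ysand 1%g g.
Proof.
move=> pR qK; rewrite /ysand (sum_Rl _ (groupVr (pR : p0 \in Rg))) mulr_sumr.
apply: eq_bigr => p _; rewrite (sum_Kl _ (groupVr (qK : q0 \in Kg))) mulr_sumr.
apply: eq_bigr => q _; rewrite sgnM odd_permV mulrA; congr (_ * _%:R).
by rewrite mulg1 !mulgA mulgKV mulgK.
Qed.

Lemma eqN_eq0 (x : rat) : x = - x -> x = 0.
Proof. by move=> /eqP; rewrite -addr_eq0 -mulr2n mulrn_eq0 => /eqP. Qed.

(** The transposition (i j) lies in the column group and its conjugate by x in the row group.
    Absorbing it on both sides of [x] only changes the sign: a x b = - a x b. *)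
Lemma ysand_swap (x : 'S_m) (i j : 'I_m) g : i != j -> col i = col j ->
  row ((x^-1)%g i) = row ((x^-1)%g j) -> ysand x g = 0.
Proof.
move=> ij cij rij; apply: eqN_eq0.
rewrite {1}/ysand (sum_Rl _ (tperm_R rij)) /ysand -sumrN; apply: eq_bigr => p _.
rewrite (sum_Kl _ (tperm_K cij)) -sumrN; apply: eq_bigr => q _.
rewrite sgnM odd_tperm ij expr1 mulN1r mulNr; congr (- (_ * (_ == _)%:R)).
rewrite -tpermJ conjgE invgK -!mulgA; congr (_ * _)%g.
by rewrite mulKg [in LHS](mulgA (tperm i j)) tperm2 mul1g.
Qed.

(** Von Neumann's lemma. Label z by the row of x^-1 z. If a column repeats a label, [ysand_swap]
    gives 0; otherwise straightening the columns writes [x] as a row permutation times a column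
    permutation. *)
Lemma ysand_scalar (x : 'S_m) : exists k, forall g, ysand x g = k * ysand 1%g g.
Proof.
pose w (z : 'I_m) : 'I_m.+1 := inord (row ((x^-1)%g z)).
have wE z : w z = row ((x^-1)%g z) :> nat.
  rewrite /w inordK // ltnS; have [rz _ _] := row_of_lt (ltn_ord ((x^-1)%g z)).
  by rewrite (leq_trans (ltnW rz)) // sumn_ge_size //; have /andP[] := la_part.
have [/existsP[i /existsP[j /and3P[ij /eqP cij /eqP rij]]]|/existsPn none] :=
  boolP [exists i : 'I_m, exists j : 'I_m, [&& i != j, col i == col j & w i == w j]].
  exists 0 => g; rewrite mul0r; apply: (ysand_swap _ ij cij).
  by rewrite -!wE rij.
have winj (i j : 'I_m) : col i = col j -> w i = w j -> i = j.
  move=> cij wij; apply/eqP; have /existsPn/(_ j) := none i.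
  by rewrite cij wij !eqxx !andbT negbK.
have cnt s : #|[pred z : 'I_m | (w z < s)%N]| = #|[pred z : 'I_m | (row z < s)%N]|.
  rewrite -[RHS](card_image (@perm_inj _ x)); apply: eq_card => z; rewrite inE wE.
  apply/idP/imageP => [zs|[y ys ->]]; last by rewrite permK.
  by exists ((x^-1)%g z); rewrite ?inE // permKV.
have [q qK qE] := word_straighten winj cnt.
have pR : (x * q^-1)%g \in R.
  rewrite -[_ \in R]/(_ \in Rg) -groupV invMg invgK mem_R; apply/forallP => z.
  by rewrite permM -wE qE.
exists (sgn q) => g; rewrite -(ysand_prod g pR qK).
by rewrite mulgKV.
Qed.

Lemma ysand11 : ysand 1%g 1%g = 1.
Proof.
rewrite /ysand (bigD1 (1%g : 'S_m)) ?(group1 Rg) //= (bigD1 (1%g : 'S_m)) ?(group1 Kg) //=.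
rewrite !mulg1 eqxx odd_perm1 mulr1 !big1 ?addr0 // => [p /andP[pR p1]|q /andP[qK q1]].
  rewrite big1 // => q qK; rewrite (_ : _ == _ = false) ?mulr0 //.
  apply: contraNF p1; rewrite mulg1 -eq_invg_mul => /eqP pq.
  have pK : p \in K by rewrite -[_ \in K]/(_ \in Kg) -groupV pq.
  by rewrite (RK_trivial pR pK).
by rewrite mul1g (negPf q1) mulr0.
Qed.

(** In (a b)(a b) each middle product q p' of the two inner factors can be replaced by a scalar, by
    [ysand_scalar]. *)
Lemma young_square : exists c, forall g,
  \sum_(p in R) \sum_(q in K) \sum_(p' in R) \sum_(q' in K)
     sgn q * sgn q' * (p * q * p' * q' == g)%g%:R = c * ysand 1%g g.
Proof.
have [k kE] := fin_all_exists ysand_scalar.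
exists (\sum_(q in K) \sum_(p' in R) sgn q * k (q * p')%g) => g.
rewrite exchange_big mulr_suml; apply: eq_bigr => q _ /=.
rewrite exchange_big mulr_suml; apply: eq_bigr => p' _ /=.
rewrite -mulrA -kE /ysand mulr_sumr; apply: eq_bigr => p _.
rewrite mulr_sumr; apply: eq_bigr => q' _; rewrite mulrA; congr (_ * (_ == _)%:R).
by rewrite !mulgA.
Qed.

(** * Pairings with the image of the Young symmetrizer *)

(** The image of the Young symmetrizer under g -> p_(cycle type of g), which is proportional to the
    characteristic of the Specht module because [wt] is a class function. *)
Definition young_ch : Lam := \sum_(p in R) \sum_(q in K) sgn q *: wt (p * q)%g.

Lemma homog_young_ch : homog m young_ch.
Proof.
apply: homog_sum => p _; apply: homog_sum => q _; apply: homogZ.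
by rewrite -[X in homog X _](card_ord m); exact: homog_wt.
Qed.

Lemma word_fixE N (w : {ffun 'I_m -> 'I_N}) (p q : 'S_m) :
  [forall z, w ((p * q)%g z) == w z] = [forall z, w (q z) == w ((p^-1)%g z)].
Proof.
apply/forallP/forallP => h z.
  by have := h ((p^-1)%g z); rewrite permM permKV.
by rewrite permM (eqP (h _)) permK.
Qed.

Lemma skews_young_ch u nu : nu != [::] -> skews u nu young_ch =
  \sum_(w : {ffun 'I_m -> 'I_(size nu)} | has_content w)
    \sum_(p in R) \sum_(q in K) sgn q * u ^+ (m - #|porbits (p * q)%g|)
      * [forall z, w (q z) == w ((p^-1)%g z)]%:R.
Proof.
move=> nu0; rewrite /young_ch skews_sum [RHS]exchange_big; apply: eq_bigr => p _ /=.
rewrite skews_sum [RHS]exchange_big; apply: eq_bigr => q _ /=.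
rewrite skewsZ skews_wt // card_ord mulrA -mulr_sumr; congr (_ * _).
rewrite -sum1_card natr_sum big_mkcond [RHS]big_mkcond; apply: eq_bigr => w _ /=.
by rewrite inE word_fixE; case: [forall z, _]; case: has_content.
Qed.

(** A sign-reversing involution: [w] does not distinguish i and j, so composing q with (i j)
    preserves the condition. *)
Lemma not_col_inj_sum N (w : {ffun 'I_m -> 'I_N}) (i j : 'I_m) (p : 'S_m) :
  i != j -> col i = col j -> w i = w j ->
  \sum_(q in K) sgn q * [forall z, w (q z) == w ((p^-1)%g z)]%:R = 0.
Proof.
move=> ij cij wij; apply: eqN_eq0.
have tK := tperm_K cij; rewrite {1}(reindex_inj (mulIg (tperm i j))) /= -sumrN.
apply: eq_big => [q|q _]; first by rewrite (groupMr _ (tK : _ \in Kg)).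
rewrite sgnM odd_tperm ij expr1 mulrN1 mulNr; congr (- (_ * (nat_of_bool _)%:R)).
apply: eq_forallb => z; rewrite permM; congr (_ == _).
by case: tpermP => [->|->|].
Qed.

(** Words repeating a letter in a column cancel. The others obey [word_dominance], which contradicts
    [nu] exceeding [la] at the first difference. *)
Lemma skews1_young_ch_eq0 nu : nu != [::] -> lexgt (szval nu) (szval la) ->
  skews 1 nu young_ch = 0.
Proof.
move=> nu0 [i0 [lt eqs]]; rewrite skews_young_ch // big1 // => w con.
rewrite big1 // => p _; under eq_bigr do rewrite expr1n mulr1.
have [/existsP[i /existsP[j /and3P[ij /eqP cij /eqP wij]]]|/existsPn none] :=
  boolP [exists i : 'I_m, exists j : 'I_m, [&& i != j, col i == col j & w i == w j]].
  exact: not_col_inj_sum ij cij wij.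
have winj (i j : 'I_m) : col i = col j -> w i = w j -> i = j.
  move=> cij wij; apply/eqP; have /existsPn/(_ j) := none i.
  by rewrite cij wij !eqxx !andbT negbK.
have := word_dominance winj i0.+1.
rewrite (card_val_lt _ (content_card con)) (card_val_lt _ card_row).
rewrite !big_ord_recr /= leqNgt => /negP[].
have -> : (\sum_(i < i0) nth 0 la i = \sum_(i < i0) nth 0 nu i)%N.
  by apply: eq_bigr => i _; have := eqs i (ltn_ord i); rewrite /szval => -[].
by rewrite ltn_add2l; move: lt; rewrite /szval; lia.
Qed.

Lemma not_row_inj_sum N (w : {ffun 'I_m -> 'I_N}) (i j : 'I_m) (q : 'S_m) :
  i != j -> row i = row j -> w i = w j ->
  \sum_(p in R) sgn p * [forall z, w (q z) == w ((p^-1)%g z)]%:R = 0.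
Proof.
move=> ij rij wij; apply: eqN_eq0.
have tR := tperm_R rij; rewrite {1}(reindex_inj (mulgI (tperm i j))) /= -sumrN.
apply: eq_big => [p|p _]; first by rewrite (groupMl _ (tR : _ \in Rg)).
rewrite sgnM odd_tperm ij expr1 mulN1r mulNr; congr (- (_ * (nat_of_bool _)%:R)).
apply: eq_forallb => z; rewrite invMg tpermV permM; congr (_ == _).
by case: tpermP => [->|->|].
Qed.

(** For words of content nu' with distinct letters in each row, the first s rows of [la] hold each
    letter j at most min(nu'_j, s) times. So they have at most as many cells as those of [nu], a
    contradiction with s just past the first difference. *)
Lemma skews_e_young_ch_eq0 nu : is_part nu -> lexgt (szval la) (szval nu) ->
  skews (-1) (conjp nu) young_ch = 0.
Proof.
move=> pnu [i0 [lt eqs]].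
(* [conjp nu] has |nu| entries, so it is empty only for empty [nu]; the pairing is then the constant
   term of an element of positive degree. *)
have [conj0|conj0] := eqVneq (conjp nu) [::].
  have nu0 : nu = [::].
    apply/eqP; apply: contraT => /(sumn_gt0 pnu); rewrite -(size_mkseq
      (fun j => #|[pred i : 'I_(size nu) | (j < nth 0 nu i)%N]|) (sumn nu)).
    by rewrite -/(conjp nu) conj0.
  rewrite conj0 /=; apply: (homog_eps homog_young_ch); apply: sumn_gt0 => //.
  by apply: contraTneq lt => ->; rewrite /szval !nth_nil; lia.
rewrite skews_young_ch // big1 // => w con.
rewrite exchange_big big1 //= => q _.
(* The sign of p q coming from [u = -1] absorbs that of q and leaves that of p: rows now play the
   antisymmetric role. *)
rewrite (eq_bigr (fun p => sgn p * [forall z, w (q z) == w ((p^-1)%g z)]%:R)); last first.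
  move=> p _; congr (_ * _); have := sign_porbits (p * q)%g; rewrite card_ord => ->.
  by rewrite sgnM mulrCA mulrA -mulrA -signr_addb addbb mulr1.
have [/existsP[i /existsP[j /and3P[ij /eqP rij /eqP wij]]]|/existsPn none] :=
  boolP [exists i : 'I_m, exists j : 'I_m, [&& i != j, row i == row j & w i == w j]].
  exact: not_row_inj_sum ij rij wij.
have winj (i j : 'I_m) : row i = row j -> w i = w j -> i = j.
  move=> rij wij; apply/eqP; have /existsPn/(_ j) := none i.
  by rewrite rij wij !eqxx !andbT negbK.
have := conjp_min i0.+1 (is_part_sorted pnu).
suff : (\sum_(i < size nu | (i < i0.+1)%N) nth 0%N nu i
    < \sum_(j <- conjp nu) minn j i0.+1)%N by lia.
apply: leq_ltn_trans (sum_ord_lt_le _ _ _) _.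
apply: (@leq_trans (\sum_(i < i0.+1) nth 0%N la i)%N).
  rewrite !big_ord_recr /=.
  have -> : (\sum_(i < i0) nth 0 la i = \sum_(i < i0) nth 0 nu i)%N.
    by apply: eq_bigr => i _; have := eqs i (ltn_ord i); rewrite /szval => -[].
  by rewrite ltn_add2l; move: lt; rewrite /szval; lia.
rewrite -(card_val_lt _ card_row) (big_nth 0%N) big_mkord -sum1_card.
rewrite (partition_big w xpredT) //=; apply: leq_sum => k _.
rewrite sum1_card leq_min; apply/andP; split.
  rewrite -(content_card con k); apply: subset_leq_card; apply/subsetP => z.
  by rewrite !inE => /andP[_ /eqP ->].
pose f (z : 'I_m) : 'I_i0.+1 := inord (row z).
rewrite -[X in (_ <= X)%N](card_ord i0.+1) -(@card_in_image _ _ f) ?max_card //.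
move=> z z' /andP[zs /eqP wz] /andP[zs' /eqP wz']; rewrite !inE in zs zs'.
move=> /(congr1 val); rewrite /f /= !inordK // => E.
by apply: winj; rewrite ?wz.
Qed.

(* The scalar kappa such that y y = kappa y for the Young symmetrizer y. *)
Definition young_const : rat := skews 1 la young_ch.

(** The scalar is found at g = 1. In <young_ch, h_la> only the row word moved by some q' in K
    survives cancellation; p q fixes that word exactly when some p' in R satisfies p (q q') p' q'^-1
    = 1, which is a term of the square. *)
Lemma young_square_const g : la != [::] ->
  \sum_(p in R) \sum_(q in K) \sum_(p' in R) \sum_(q' in K)
     sgn q * sgn q' * (p * q * p' * q' == g)%g%:R = young_const * ysand 1%g g.
Proof.
move=> la0; have [c cE] := young_square; suff -> : young_const = c by [].
rewrite -[c]mulr1 -ysand11 -cE /young_const skews_young_ch //.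
pose w0 : {ffun 'I_m -> 'I_(size la)} :=
  [ffun z : 'I_m => Ordinal (reshape_indexP (ltn_ord z))].
have w0E z : w0 z = row z :> nat by rewrite ffunE.
pose h (q' : 'S_m) : {ffun 'I_m -> 'I_(size la)} := [ffun z => w0 (q' z)].
have hE q' z : h q' z = row (q' z) :> nat by rewrite ffunE w0E.
transitivity (\sum_(q' in K) \sum_(p in R) \sum_(q in K)
    sgn q * [forall z, h q' (q z) == h q' ((p^-1)%g z)]%:R).
  rewrite (bigID (mem [set h q' | q' in K])) /= [X in _ + X]big1 ?addr0; last first.
    move=> w /andP[con wh]; apply: big1 => p _; under eq_bigr do rewrite expr1n mulr1.
    have [/existsP[i /existsP[j /and3P[ij /eqP cij /eqP wij]]]|/existsPn none] :=
      boolP [exists i : 'I_m, exists j : 'I_m, [&& i != j, col i == col j & w i == w j]].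
      exact: not_col_inj_sum ij cij wij.
    have winj (i j : 'I_m) : col i = col j -> w i = w j -> i = j.
      move=> cij wij; apply/eqP; have /existsPn/(_ j) := none i.
      by rewrite cij wij !eqxx !andbT negbK.
    have [|q qK qE] := word_straighten winj.
      by move=> s; rewrite (card_val_lt _ (content_card con)) (card_val_lt _ card_row).
    case/imsetP: wh; exists (q^-1)%g; first by rewrite (groupV Kg).
    by apply/ffunP => z; apply: val_inj; rewrite /= hE -qE permKV.
  rewrite (eq_bigl (mem [set h q' | q' in K])) => [|w]; last first.
    apply/andP/idP => [[]//|wh]; split=> //; case/imsetP: wh => q' _ ->.
    apply/forallP => i; rewrite -card_row -(card_image (@perm_inj _ q')); apply/eqP.
    apply: eq_card => y; rewrite inE; apply/imageP/eqP => [[z zi ->]|yi].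
      by move: zi; rewrite inE => /eqP <-; rewrite hE.
    by exists ((q'^-1)%g y); rewrite ?permKV // inE -val_eqE /= hE permKV yi.
  rewrite big_imset /=; last first.
    move=> q1 q2 q1K q2K hh; apply/permP => z; apply: cell_inj; last by rewrite !K_col.
    by rewrite -!hE hh.
  by apply: eq_bigr => q' _; apply: eq_bigr => p _; apply: eq_bigr => q _;
    rewrite expr1n mulr1.
transitivity (\sum_(q' in K) \sum_(p in R) \sum_(q in K) \sum_(p' in R)
     sgn q * sgn q' * (p * q * p' * q' == 1)%g%:R); last first.
  rewrite exchange_big; apply: eq_bigr => p _ /=; rewrite exchange_big.
  by apply: eq_bigr => q _ /=; rewrite exchange_big.
(* With q' replaced by its inverse and then q by q q', the sign reduces to that of q. *)
rewrite [RHS](reindex_inj invg_inj) /=.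
apply: eq_big => [q'|q' q'K]; first by rewrite (groupV Kg).
apply: eq_bigr => p pR; rewrite [RHS](reindex_inj (mulIg q')) /=.
apply: eq_big => [q|q qK]; first by rewrite (groupMr _ (q'K : _ \in Kg)).
have ss : sgn q' * sgn q' = 1 by rewrite -signr_addb addbb.
rewrite -mulr_sumr sgnM odd_permV -[sgn q * _ * _]mulrA ss mulr1; congr (_ * _).
pose x := (q'^-1 * p * (q * q'))%g.
have -> : [forall z, h q' (q z) == h q' ((p^-1)%g z)] = (x \in R).
  rewrite mem_R; apply/forallP/forallP => H z.
    have /eqP/(congr1 val) := H ((q'^-1 * p)%g z); rewrite /= !hE.
    by rewrite /x !permM permK permKV => /eqP.
  have := H ((p^-1 * q')%g z); rewrite /x !permM permK permKV => /eqP E.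
  by rewrite -val_eqE /= !hE E.
rewrite (reindex_inj invg_inj) /=.
rewrite (eq_bigl (mem R)) => [|y]; last by rewrite (groupV Rg).
have E y : (p * (q * q') * y^-1 * q'^-1 == 1)%g = (y == x).
  rewrite /x -(mulgA (q'^-1)%g); set a := (p * _)%g; apply/eqP/eqP => [H|->].
    have -> : a = (q' * y)%g by rewrite -[a](mulgKV y) -[(a * y^-1)%g](mulgKV q') H mul1g.
    by rewrite mulKg.
  by rewrite invMg invgK mulgA mulgV mul1g mulgV.
have [xR|xR] := boolP (x \in R).
  rewrite (bigD1 x) //= E eqxx big1 ?addr0 // => y /andP[_ yx].
  by rewrite E (negPf yx).
rewrite big1 // => y yR; rewrite E (_ : _ == _ = false) //.
by apply: contraNF xR => /eqP <-.
Qed.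

End Young.

(** * Traces on submodules and quotients *)

Section Traces.

Variables (C : fieldType) (n : nat) (U A E : 'M[C]_n).

(** [E] is a projection onto U; it factors through coordinates on U as (E b) v, and the trace is
    cyclic. *)
Lemma trace_submod : (E <= U)%MS -> U *m E = U -> (U *m A <= U)%MS ->
  \tr (in_submod U (val_submod 1%:M *m A)) = \tr (E *m A).
Proof.
move=> EU UE UA; set v := val_submod 1%:M; pose b : 'M_(n, \rank U) := in_submod U 1%:M.
have fixU k (W : 'M_(k, n)) : (W <= U)%MS -> W *m E = W.
  by case/submxP => w ->; rewrite -mulmxA UE.
have EE : E = E *m b *m v by rewrite -val_submodE -in_submodE in_submodK.
have vA : (v *m A <= U)%MS.
  by apply: submx_trans UA; apply: submxMr; exact: val_submodP.
transitivity (\tr (v *m A *m (E *m b))).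
  by rewrite mulmxA fixU // in_submodE.
by rewrite mxtrace_mulC mulmxA -EE.
Qed.

(* [E] is a projection with kernel [U]. *)
Lemma trace_factmod : (1%:M - E <= U)%MS -> U *m E = 0 -> (U *m A <= U)%MS ->
  \tr (in_factmod U (val_factmod 1%:M *m A)) = \tr (A *m E).
Proof.
move=> EU UE UA; set v := val_factmod 1%:M; pose c := in_factmod U 1%:M.
have kerU k (W : 'M_(k, n)) : (W <= U)%MS -> W *m E = 0.
  by case/submxP => w ->; rewrite -mulmxA UE mulmx0.
have cv : (1%:M - c *m v <= U)%MS.
  have /eqP := add_sub_fact_mod U 1%:M; rewrite [val_factmod _]val_factmodE.
  by rewrite eq_sym -subr_eq => /eqP ->; exact: val_submodP.
have Ec : E *m c = c.
  have : (1%:M - E) *m c = 0 by apply/eqP; rewrite -in_factmodE in_factmod_eq0.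
  by rewrite mulmxBl mul1mx => /eqP; rewrite subr_eq0 => /eqP.
transitivity (\tr (v *m (A *m E) *m c)).
  by rewrite in_factmodE -/c -mulmxA -[in RHS]mulmxA -[A *m E *m c]mulmxA Ec mulmxA.
rewrite mxtrace_mulC mulmxA; congr (\tr _).
have : (1%:M - c *m v) *m A *m E = 0.
  by rewrite kerU //; apply: submx_trans UA; exact: submxMr.
by rewrite !mulmxBl mul1mx => /eqP; rewrite subr_eq0 -!mulmxA => /eqP.
Qed.

(** In the rank factorization A = c r, the equation c r c r = 0 forces r c = 0, and c r has the same
    trace as r c. *)
Lemma trace_nilpotent : A *m A = 0 -> \tr A = 0.
Proof.
move=> A2; rewrite -(mulmx_base A) mxtrace_mulC.
suff -> : row_base A *m col_base A = 0 by rewrite linear0.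
apply: (row_free_inj (row_base_free A)); apply: (row_full_inj (col_base_full A)).
rewrite mul0mx mulmx0 (mulmxA (col_base A) _ (row_base A)).
by rewrite (mulmxA (col_base A) (row_base A)) mulmx_base -mulmxA mulmx_base.
Qed.

End Traces.

(** * Characters of Specht modules *)

Section SpechtTrace.

Variables (C : numFieldType) (la : seq nat).
Hypotheses (la_part : is_part la) (la0 : la != [::]).
Local Notation m := (sumn la).
Local Notation G := [set: 'S_m]%G.
Local Notation aG := (regular_repr C G).
Local Notation ys := (@ysand la 1%g).

(** Left multiplication by the Young symmetrizer y on the group algebra: row i is y g_i. It commutes
    with the regular representation, which multiplies on the right. *)
Definition young_mx : 'M[C]_#|G| :=
  \matrix_(i, j) ratr (ys (enum_val j * (enum_val i)^-1)%g).

Lemma young_symmetrizerE j :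
  young_symmetrizer C la 0 j = ratr (ys (enum_val j)).
Proof.
rewrite /young_symmetrizer /ysand summxE rmorph_sum; apply: eq_bigr => p _ /=.
rewrite summxE rmorph_sum; apply: eq_bigr => q _ /=.
rewrite !mxE /= rmorphM rmorph_sign rmorph_nat mulg1; congr (_ * (nat_of_bool _)%:R).
by apply/eqP/eqP => [->|->]; rewrite ?gring_indexK ?gring_valK // inE.
Qed.

Lemma mul_regular (v : 'rV[C]_#|G|) g j :
  (v *m aG g) 0 j = v 0 (gring_index G (enum_val j * g^-1)%g).
Proof.
rewrite mxE (bigD1 (gring_index G (enum_val j * g^-1)%g)) //= big1 ?addr0.
  by rewrite !mxE gring_indexK ?inE // mulgKV gring_valK !eqxx mulr1.
move=> i ij; rewrite !mxE /= (_ : _ == _ = false) ?mulr0 //.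
apply: contraNF ij => /eqP ->; rewrite gring_indexK ?inE // mulgK.
by rewrite gring_valK.
Qed.

Lemma row_young_mx i : row i young_mx = young_symmetrizer C la *m aG (enum_val i).
Proof.
apply/rowP => j; rewrite mul_regular young_symmetrizerE !mxE.
by rewrite gring_indexK ?inE.
Qed.

Lemma young_mx_regular g i j :
  (young_mx *m aG g) i j = ratr (ys (enum_val j * g^-1 * (enum_val i)^-1)%g).
Proof.
have -> : (young_mx *m aG g) i j = (row i young_mx *m aG g) 0 j.
  by rewrite -row_mul [RHS]mxE.
by rewrite mul_regular !mxE gring_indexK ?inE.
Qed.

Lemma young_mx_comm g : young_mx *m aG g = aG g *m young_mx.
Proof.
apply/row_matrixP => i; rewrite !row_mul row_young_mx [row i (aG g)]rowK -rowE.
rewrite row_young_mx gring_indexK ?inE // repr_mxM ?inE //.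
by rewrite mulmxA.
Qed.

Lemma ysand_conv g :
  \sum_h ys (g * h^-1)%g * ys h = young_const la * ys g.
Proof.
rewrite -young_square_const // /ysand.
rewrite (eq_bigr (fun h => \sum_(p in row_stab la) \sum_(q in col_stab la)
    \sum_(p' in row_stab la) \sum_(q' in col_stab la)
    (-1) ^+ odd_perm q * (-1) ^+ odd_perm q' *
      ((p * q == g * h^-1)%g && (p' * q' == h)%g)%:R)); last first.
  move=> h _; rewrite mulr_suml; apply: eq_bigr => p _.
  rewrite mulr_suml; apply: eq_bigr => q _; rewrite mulr_sumr; apply: eq_bigr => p' _.
  rewrite mulr_sumr; apply: eq_bigr => q' _; rewrite !mulg1 mulrACA; congr (_ * _).
  by rewrite -natrM mulnb.
rewrite exchange_big; apply: eq_bigr => p _ /=.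
rewrite exchange_big; apply: eq_bigr => q _ /=.
rewrite exchange_big; apply: eq_bigr => p' _ /=.
rewrite exchange_big; apply: eq_bigr => q' _ /=.
rewrite -mulr_sumr (bigD1 (p' * q')%g) //= eqxx andbT big1 ?addr0 => [|h]; last first.
  by rewrite eq_sym => /negPf ->; rewrite andbF.
by rewrite -mulgA (canF_eq (mulgK (p' * q')%g)) eq_sym.
Qed.

Lemma young_mx_square : young_mx *m young_mx = ratr (young_const la) *: young_mx.
Proof.
apply/matrixP => i j; rewrite !mxE -rmorphM -ysand_conv rmorph_sum.
pose f (k : 'I_#|G|) := (enum_val k * (enum_val i)^-1)%g.
have fbij : bijective f.
  exists (fun h => gring_index G (h * enum_val i)%g) => [k|h].
    by rewrite /f mulgKV gring_valK.
  by rewrite /f gring_indexK ?inE // mulgK.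
rewrite [RHS](reindex f) /=; last exact: onW_bij.
apply: eq_bigr => k _; rewrite !mxE rmorphM mulrC; congr (ratr (ys _) * _).
by rewrite /f invMg invgK mulgA mulgKV.
Qed.

Lemma trace_young_mx g :
  \tr (young_mx *m aG g) = ratr (\sum_x ys (x * g^-1 * x^-1)%g).
Proof.
rewrite rmorph_sum /mxtrace [RHS](reindex (fun i : 'I_#|G| => enum_val i)) /=.
  by apply: eq_bigr => i _; rewrite young_mx_regular.
by apply: onW_bij; exists (gring_index G) => [k|h]; rewrite ?gring_valK ?gring_indexK ?inE.
Qed.

(* A nilpotent Young symmetrizer would have trace 0 in the regular representation,
   but its trace there is m!. *)
Lemma young_const_neq0 : young_const la != 0.
Proof.
apply/eqP => c0; have := trace_young_mx 1%g.
rewrite repr_mx1 mulmx1 trace_nilpotent; last first.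
  by rewrite young_mx_square c0 rmorph0 scale0r.
rewrite (eq_bigr (fun=> 1)) => [|x _]; last by rewrite invg1 mulg1 mulgV ysand11.
rewrite sumr_const ratr_nat => /esym/eqP; rewrite pnatr_eq0.
by rewrite card_Sn; apply/negP; rewrite -lt0n fact_gt0.
Qed.

(** The trace, on the whole group algebra, of right multiplication by g composed with the projection
    y / kappa onto the Specht module. *)
Definition specht_char (g : 'S_m) : rat :=
  (young_const la)^-1 * \sum_x ys (x * g^-1 * x^-1)%g.

Lemma specht_trace g : \tr (specht_repr C la g) = ratr (specht_char g).
Proof.
have c0 : ratr (young_const la) != 0 :> C by rewrite fmorph_eq0 young_const_neq0.
set U := specht_module C la; pose E := (ratr (young_const la))^-1 *: young_mx.
have Umod : mxmodule aG U := cyclic_mx_module _ _.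
have EU : (E <= U)%MS.
  apply/row_subP => i; rewrite linearZ scalemx_sub //= row_young_mx.
  by apply: submx_trans (submxMr _ (cyclic_mx_id aG _)) _; apply: (mxmoduleP Umod);
    rewrite inE.
have UE : U *m E = U.
  (* The vectors fixed by [E] form a submodule, as [E] commutes with the action; it contains the
     generator y because y y = kappa y. *)
  pose W := kermx (E - 1%:M).
  suff : (U <= W)%MS by move=> /sub_kermxP; rewrite mulmxBr mulmx1 => /eqP;
    rewrite subr_eq0 => /eqP.
  apply: cyclic_mx_sub.
    apply/mxmoduleP => g' _; apply/sub_kermxP.
    rewrite -mulmxA (_ : aG g' *m _ = (E - 1%:M) *m aG g').
      by rewrite mulmxA mulmx_ker mul0mx.
    by rewrite mulmxBl mulmxBr mul1mx mulmx1 -scalemxAl -scalemxAr young_mx_comm.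
  apply/sub_kermxP; rewrite mulmxBr mulmx1 -scalemxAr.
  pose i1 := gring_index G 1%g.
  have vE : young_symmetrizer C la = row i1 young_mx.
    by rewrite row_young_mx gring_indexK ?inE // repr_mx1 mulmx1.
  by rewrite vE -row_mul young_mx_square linearZ scalerA mulVf // scale1r subrr.
rewrite /specht_repr /submod_repr /= /submod_mx (trace_submod EU UE); last first.
  by apply: (mxmoduleP Umod); rewrite inE.
by rewrite -scalemxAl linearZ /= trace_young_mx /specht_char rmorphM fmorphV.
Qed.

End SpechtTrace.

(** * Schur functions as characteristics of Specht modules *)

Section SpechtCh.

Variable la : seq nat.
Hypotheses (la_part : is_part la) (la0 : la != [::]).
Local Notation m := (sumn la).

(** After division by [young_const], the conditions of [sch_unique] are the two vanishing lemmas
    and, for the normalization, the definition of [young_const]. *)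
Lemma young_ch_sch : young_ch la = young_const la *: sch la.
Proof.
have c0 : young_const la != 0 by exact: (young_const_neq0 rat).
have laP : la \in parts m by rewrite mem_parts la_part eqxx.
suff <- : (young_const la)^-1 *: young_ch la = sch la by rewrite scalerA mulfV // scale1r.
apply: (@sch_unique m) => // [|nu nuP gt||nu nuP gt].
- by apply: homogZ; exact: homog_young_ch.
- rewrite skewsZ skews1_young_ch_eq0 ?mulr0 //; apply: contraTneq nuP => ->.
  by rewrite mem_parts /= eq_sym -lt0n sumn_gt0.
- by rewrite skewsZ mulVf.
rewrite skewsZ skews_e_young_ch_eq0 ?mulr0 //.
by move: nuP; rewrite mem_parts => /andP[].
Qed.

(** [wt] is invariant under conjugation and inversion, so each of the m! conjugating elements x
    contributes one copy of [young_ch]. *)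
Lemma specht_ch_sch :
  (m`!%:R : rat)^-1 *: \sum_(g : 'S_m) specht_char g *: wt g = sch la.
Proof.
have c0 : young_const la != 0 by exact: (young_const_neq0 rat).
suff -> : \sum_(g : 'S_m) specht_char g *: wt g
    = (m`!%:R * (young_const la)^-1) *: young_ch la.
  by rewrite young_ch_sch !scalerA mulrA mulVf ?fact_neq0 // mul1r mulVf // scale1r.
rewrite mulrC -scalerA scalerA; rewrite -scalerA /specht_char.
under eq_bigr do rewrite -scalerA scaler_suml.
rewrite -scaler_sumr; congr (_ *: _); rewrite exchange_big /=.
rewrite -(card_Sn m) -sumr_const scaler_suml; apply: eq_bigr => x _; rewrite scale1r.
rewrite (reindex_inj invg_inj) (reindex_inj (conjg_inj x)) /=.
transitivity (\sum_(g : 'S_m) ysand 1%g g *: wt g).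
  apply: eq_bigr => g _; rewrite cycle_prodV cycle_prod_conj conjgE invgK.
  by congr (ysand _ _ *: _); rewrite !mulgA mulgV mul1g mulgK.
rewrite /ysand /young_ch.
under eq_bigr do rewrite scaler_suml.
rewrite exchange_big; apply: eq_bigr => p _ /=.
under eq_bigr do rewrite scaler_suml.
rewrite exchange_big; apply: eq_bigr => q _ /=.
rewrite (bigD1 (p * q)%g) //= mulg1 eqxx mulr1 big1 ?addr0 // => g gn.
by rewrite eq_sym (negPf gn) mulr0 scale0r.
Qed.

End SpechtCh.

(** * Characters of the rook monoid *)

Lemma mxtrace_tens (R : comNzRingType) m n (A : 'M[R]_m) (B : 'M[R]_n) :
  \tr (A *t B) = \tr A * \tr B.
Proof.
rewrite /mxtrace mulr_sum; apply: eq_bigr => k _.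
by rewrite mxE.
Qed.

Section RookTrace.

Variables (C : numFieldType) (n : nat) (la : seq nat).
Local Notation l := (sumn la).
Local Notation Inj := (Defs.inj_map l n).
Local Notation rho := (specht_repr C la).
Local Notation L := (@inj_left C n la).
Local Notation R := (@inj_right C n la).

Lemma inj_comp_subproof (f : Inj) (t : 'S_l) : injectiveb [ffun i => val f (t i)].
Proof.
apply/injectiveP => i j; rewrite !ffunE => /(injectiveP _ (valP f)).
exact: perm_inj.
Qed.
Definition inj_comp (f : Inj) t : Inj :=
  exist (fun f : {ffun 'I_l -> 'I_n} => is_true (injectiveb f)) _ (inj_comp_subproof f t).

Lemma inj_compE f t i : val (inj_comp f t) i = val f (t i).
Proof. by rewrite ffunE. Qed.

Lemma inj_compK f t : inj_comp (inj_comp f t) t^-1 = f.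
Proof. by apply/val_inj/ffunP => i; rewrite !inj_compE permKV. Qed.

Lemma inj_compKV f t : inj_comp (inj_comp f t^-1) t = f.
Proof. by apply/val_inj/ffunP => i; rewrite !inj_compE permK. Qed.

Lemma inj_rightE t a b :
  R t a b = (enum_val b == inj_comp (enum_val a) t)%:R.
Proof.
rewrite mxE; congr (nat_of_bool _)%:R; apply/forallP/eqP => [H|-> i].
  by apply/val_inj/ffunP => i; rewrite inj_compE; apply/eqP.
by rewrite inj_compE.
Qed.

Lemma mul_inj_right k t (M : 'M_(_, k)) a j :
  (R t *m M) a j = M (enum_rank (inj_comp (enum_val a) t)) j.
Proof.
rewrite mxE (bigD1 (enum_rank (inj_comp (enum_val a) t))) //= big1 ?addr0.
  by rewrite inj_rightE enum_rankK eqxx mul1r.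
move=> b ba; rewrite inj_rightE (_ : _ == _ = false) ?mul0r //.
by apply: contraNF ba => /eqP <-; rewrite enum_valK.
Qed.

Lemma mulmx_inj_right k t (M : 'M_(k, _)) i b :
  (M *m R t) i b = M i (enum_rank (inj_comp (enum_val b) t^-1)).
Proof.
rewrite mxE (bigD1 (enum_rank (inj_comp (enum_val b) t^-1))) //= big1 ?addr0.
  by rewrite inj_rightE enum_rankK inj_compKV eqxx mulr1.
move=> a ba; rewrite inj_rightE (_ : _ == _ = false) ?mulr0 //.
by apply: contraNF ba => /eqP ->; rewrite inj_compK enum_valK.
Qed.

Lemma inj_rightM t t' : R t *m R t' = R (t' * t)%g.
Proof.
apply/matrixP => a b; rewrite mul_inj_right !inj_rightE enum_rankK.
congr (_ == _)%:R; apply/val_inj/ffunP => i.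
by rewrite !inj_compE permM.
Qed.

Lemma inj_left_right s t : L s *m R t = R t *m L s.
Proof.
apply/matrixP => a b; rewrite mul_inj_right mulmx_inj_right !mxE !enum_rankK.
congr (nat_of_bool _)%:R; apply/forallP/forallP => H i.
  by have := H (t i); rewrite !inj_compE permK.
by have := H ((t^-1)%g i); rewrite !inj_compE permKV.
Qed.

Local Notation X t := (R t *t (1%:M : 'M_(specht_dim C la))).
Local Notation Y t := ((1%:M : 'M_(#|{: Inj}|)) *t rho t).

(* The idempotent projecting along [balanced_rel]. *)
Let e := (l`!%:R)^-1 *: \sum_(t : 'S_l) R t *t rho t^-1%g.

Lemma balanced_rel_e : balanced_rel C n la *m e = 0.
Proof.
apply/sub_kermxP; apply/sumsmx_subP => s _; apply/sub_kermxP.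
rewrite mulmxBl; apply/eqP; rewrite subr_eq0; apply/eqP.
rewrite /e -!scalemxAr; congr (_ *: _); rewrite !mulmx_sumr.
rewrite [RHS](reindex_inj (mulIg s)) /=; apply: eq_bigr => t _.
rewrite !tensmx_mul !mul1mx inj_rightM -repr_mxM ?inE //.
by rewrite invMg mulKVg.
Qed.

(** Each term of [e] differs from the identity by a relation, since 1 - R t (x) rho t^-1 = - Y t^-1
    (X t - Y t). *)
Lemma balanced_rel_compl : (1%:M - e <= balanced_rel C n la)%MS.
Proof.
have f0 : (l`!%:R : C) != 0 by rewrite pnatr_eq0 -lt0n fact_gt0.
have -> : 1%:M - e = (l`!%:R)^-1 *: \sum_(t : 'S_l) (1%:M - R t *t rho t^-1%g).
  by rewrite sumrB sumr_const card_Sn -scaler_nat scalerBr scalerA mulVf // scale1r.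
apply: scalemx_sub; apply: summx_sub => t _.
have sub : (X t - Y t <= balanced_rel C n la)%MS.
  by rewrite /balanced_rel (sumsmx_sup t).
have -> : 1%:M - R t *t rho t^-1%g = - (Y t^-1%g *m (X t - Y t)).
  rewrite mulmxBr !tensmx_mul !mul1mx mulmx1 opprB -repr_mxM ?inE // mulVg repr_mx1.
  congr (_ - _); apply/matrixP => x y; case: (mxtens_indexP x) => a b;
    case: (mxtens_indexP y) => a' b'.
  rewrite tensmxE !mxE -natrM mulnb; congr (nat_of_bool _)%:R.
  by rewrite (can_eq (@mxtens_indexK _ _)) xpair_eqE.
by rewrite -mulNmx mulmx_sub.
Qed.

(** [e] projects along the relations, so the trace on the quotient is that of (L s (x) 1) e; the
    relations are stable because [L s] commutes with every [R t]. *)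
Lemma rook_trace s : \tr (rook_mx C la s)
  = (l`!%:R)^-1 * \sum_(t : 'S_l) \tr (L s *m R t) * \tr (rho t^-1%g).
Proof.
rewrite /rook_mx (trace_factmod balanced_rel_compl balanced_rel_e).
  rewrite /e -scalemxAr linearZ /= mulmx_sumr raddf_sum; congr (_ * _).
  apply: eq_bigr => t _ /=.
  by rewrite tensmx_mul mul1mx mxtrace_tens.
rewrite /balanced_rel sumsmxMr; apply/sumsmx_subP => t _.
rewrite mulmxBl !tensmx_mul !mulmx1 !mul1mx -inj_left_right.
have -> : (L s *m R t) *t 1%:M - L s *t rho t
    = (L s *t 1%:M) *m (X t - Y t).
  by rewrite mulmxBr !tensmx_mul !mulmx1 !mul1mx.
by rewrite mulmx_sub // (sumsmx_sup t).
Qed.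

End RookTrace.

(** A permutation acting as [u] on the first part preserves the second, where it may be any [t];
    [gl] glues the two, and their cycles are put together. *)
Lemma sum_wt_extend (T T1 T2 : finType) (f1 : T1 -> T) (f2 : T2 -> T) (u : {perm T1}) :
  injective f1 -> injective f2 -> (forall y z, f1 y != f2 z) ->
  (forall x, (exists y, x = f1 y) \/ (exists z, x = f2 z)) ->
  \sum_(s : {perm T} | [forall i, s (f1 i) == f1 (u i)]) wt s
    = wt u * \sum_(t : {perm T2}) wt t.
Proof.
move=> f1I f2I f12 f12T.
pose h w := match w with inl y => f1 y | inr z => f2 z end.
have hI : injective h.
  move=> [y|z] [y'|z'] //= e; first by rewrite (f1I _ _ e).
  - by have := f12 y z'; rewrite e eqxx.
  - by have := f12 y' z; rewrite e eqxx.
  by rewrite (f2I _ _ e).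
have hT x : exists w, h w == x.
  by case: (f12T x) => -[y ->]; [exists (inl y)|exists (inr y)] => /=.
have [g gP] := fin_all_exists hT.
have gK w : g (h w) = w by apply: hI; apply/eqP/gP.
pose sw (t : {perm T2}) w := match w with inl y => inl (u y) | inr z => inr (t z) end.
have glI t : injective (fun x => h (sw t (g x))).
  move=> x x' /hI e; rewrite -(eqP (gP x)) -(eqP (gP x')); congr h; move: e.
  by case: (g x) (g x') => [y|z] [y'|z'] //= [] /perm_inj ->.
pose gl t := perm (glI t).
have gl1 t y : gl t (f1 y) = f1 (u y) by rewrite permE (gK (inl y)).
have gl2 t z : gl t (f2 z) = f2 (t z) by rewrite permE (gK (inr z)).
have glJ : injective gl.
  by move=> t t' e; apply/permP => z; apply: f2I; rewrite -!gl2 e.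
transitivity (\sum_(s in gl @: [set: {perm T2}]) wt s).
  apply: eq_bigl => s; apply/forallP/imsetP => [sP|[t _ ->] y]; last by rewrite gl1.
  have sf2 z : exists z', s (f2 z) == f2 z'.
    case: (f12T (s (f2 z))) => -[y sy]; last by exists y; apply/eqP.
    have := sP ((u^-1)%g y); rewrite permKV -sy => /eqP/perm_inj e.
    by have := f12 ((u^-1)%g y) z; rewrite e eqxx.
  have [v vP] := fin_all_exists sf2.
  have vI : injective v.
    move=> z z' e; apply: f2I; apply: (@perm_inj _ s).
    by rewrite (eqP (vP z)) (eqP (vP z')) e.
  exists (perm vI) => //; apply/permP => x; case: (f12T x) => -[y ->].
    by rewrite gl1; apply/eqP.
  by rewrite gl2 permE; apply/eqP.
rewrite big_imset /=; last by move=> t t' _ _; exact: glJ.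
rewrite mulr_sumr; apply: eq_big => [t|t _]; first by rewrite inE.
by apply: (cycle_prod_sum pw f1I f2I).
Qed.

(** Counts the fixed points of f -> s o f o t on injective maps, hence a trace on their span. *)
Definition equivariant_injs k l (s : 'S_k) (t : 'S_l) : nat :=
  #|[set f : {ffun 'I_l -> 'I_k} | injectiveb f && [forall i, s (f (t i)) == f i]]|.

(** For a fixed injection f, [s] acts on the image of f as t^-1 and is arbitrary on the k - l other
    points, giving [wt t] (k-l)! h_{k-l}. There are k! / (k-l)! injections. *)
Lemma sum_equivariant_injs k l (t : 'S_l) : (l <= k)%N ->
  \sum_(s : 'S_k) (equivariant_injs s t)%:R *: wt s = (k`!%:R : rat) *: (wt t * hs (k - l)).
Proof.
move=> lk.
transitivity (\sum_(f : {ffun 'I_l -> 'I_k} | injectiveb f)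
    \sum_(s : 'S_k | [forall i, s (f i) == f ((t^-1)%g i)]) wt s).
  rewrite (exchange_big_dep xpredT) //=; apply: eq_bigr => s _.
  rewrite sumr_const -scaler_nat; congr (_%:R *: _); rewrite /equivariant_injs cardsE.
  apply: eq_card => f; rewrite !unfold_in; congr (_ && _).
  apply/forallP/forallP => H i.
    by have := H ((t^-1)%g i); rewrite permKV.
  by have := H (t i); rewrite permK.
transitivity (\sum_(f : {ffun 'I_l -> 'I_k} | injectiveb f)
   wt t * ((k - l)`!%:R *: hs (k - l))).
  apply: eq_bigr => f /injectiveP fI; pose B := ~: (f @: [set: 'I_l]).
  have cB : #|B| = (k - l)%N.
    by rewrite /B cardsCs setCK card_imset // cardsT !card_ord.
  pose f2 (z : 'I_#|B|) : 'I_k := enum_val z.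
  rewrite (sum_wt_extend (f2 := f2) (t^-1)%g fI).
  - by rewrite cycle_prodV sum_wt cB.
  - exact: enum_val_inj.
  - move=> y z; apply: contraTneq (enum_valP z) => e.
    by rewrite inE negbK -/(f2 z) -e imset_f.
  - move=> x; case: (boolP (x \in B)) => xB.
      by right; exists (enum_rank_in xB x); rewrite /f2 enum_rankK_in.
    by left; move: xB; rewrite inE negbK => /imsetP[y _ ->]; exists y.
rewrite sumr_const -scaler_nat -scalerAr scalerA; congr (_ *: _).
rewrite -natrM; congr _%:R.
rewrite (eq_card (B := [set f : {ffun 'I_l -> 'I_k} | injectiveb f])).
  by rewrite card_inj_ffuns !card_ord ffact_fact.
by move=> f; rewrite inE.
Qed.

Lemma equivariant_injs_gt k l (s : 'S_k) (t : 'S_l) : (k < l)%N -> equivariant_injs s t = 0%N.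
Proof.
move=> kl; apply/eqP; rewrite /equivariant_injs cards_eq0; apply/eqP/setP => f;
  rewrite !inE.
apply/negP => /andP[/injectiveP /leq_card]; rewrite !card_ord.
by rewrite leqNgt kl.
Qed.

Section PartialPermutation.

Variables (k n : nat) (kn : (k <= n)%N).

(* The partial permutation of [n] which is [s] on the first [k] points. *)
Definition perm_rook_fun (s : 'S_k) : {ffun 'I_n -> option 'I_n} :=
  [ffun i : 'I_n => omap (fun j : 'I_k => widen_ord kn (s j)) (insub (val i))].

Lemma perm_rook_funE (s : 'S_k) (i j : 'I_n) :
  reflect (exists2 x : 'I_k, i = widen_ord kn x & j = widen_ord kn (s x))
    (perm_rook_fun s i == Some j).
Proof.
rewrite ffunE; case: insubP => [x xk xi|ik] /=.
  apply: (iffP eqP) => [[<-]|[y iy ->]].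
    by exists x => //; apply: val_inj; rewrite /= -xi.
  by congr (Some (widen_ord kn (s _))); apply: val_inj; rewrite /= xi iy.
by apply: (iffP eqP) => // -[x ix _]; move: ik; rewrite ix /= ltn_ord.
Qed.

Lemma perm_rook_proof (s : 'S_k) : is_rook (perm_rook_fun s).
Proof.
apply/'forall_forallP => i j; apply/implyP => /andP[].
case e : (perm_rook_fun s i) => [y|] // _ /eqP e'.
have /perm_rook_funE[x -> yx] := introT eqP e.
have /perm_rook_funE[x' -> yx'] := introT eqP (esym e').
move: yx'; rewrite yx => /(congr1 val) /= /val_inj /perm_inj ->.
exact: eqxx.
Qed.

Definition perm_rook (s : 'S_k) : rook n :=
  exist (fun f : {ffun 'I_n -> option 'I_n} => is_true (is_rook f)) _ (perm_rook_proof s).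

(** A fixed injection takes its values in the domain of the partial permutation, that is among the
    first k points, and so comes from an injection into ['I_k]. *)
Lemma trace_inj_left_right (C : numFieldType) la (s : 'S_k) (t : 'S_(sumn la)) :
  \tr (inj_left C la (perm_rook s) *m inj_right C n t) = (equivariant_injs s t)%:R.
Proof.
pose P (f : Defs.inj_map (sumn la) n) :=
  [forall i, perm_rook_fun s (val f (t i)) == Some (val f i)].
transitivity (\sum_(a < #|{: Defs.inj_map (sumn la) n}|) ((P (enum_val a))%:R : C)).
  rewrite /mxtrace; apply: eq_bigr => a _.
  rewrite mulmx_inj_right mxE enum_rankK; congr (nat_of_bool _)%:R.
  apply/forallP/forallP => H i.
    by have := H (t i); rewrite inj_compE permK.
  by have := H ((t^-1)%g i); rewrite inj_compE permKV.
rewrite -natr_sum; congr _%:R.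
rewrite -(big_enum_val (fun f => nat_of_bool (P f))) /=.
transitivity #|[set f | P f]|.
  by rewrite -sum1dep_card [RHS]big_mkcond; apply: eq_bigr => f _; case: (P f).
rewrite -(card_imset _ val_inj) /equivariant_injs.
pose w (f : {ffun 'I_(sumn la) -> 'I_k}) := [ffun i => widen_ord kn (f i)].
have wI : injective w.
  move=> f f' /ffunP e; apply/ffunP => i; apply: val_inj.
  by have := e i; rewrite !ffunE => /(congr1 val).
rewrite -(card_imset _ wI); apply: eq_card => g; apply/imsetP/imsetP.
  case=> f; rewrite inE => /forallP Pf ->.
  have /fin_all_exists[f' f'P] i : exists x, val f i = widen_ord kn x.
    by have := Pf ((t^-1)%g i); rewrite permKV => /perm_rook_funE[x -> _]; exists x.
  have fE : val f = w (finfun f') by apply/ffunP => i; rewrite !ffunE.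
  exists (finfun f') => //; rewrite inE; apply/andP; split.
    apply/injectiveP => i j; rewrite !ffunE => e.
    by apply: (injectiveP _ (valP f)); rewrite !f'P e.
  apply/forallP => i; rewrite !ffunE; have /perm_rook_funE[x] := Pf i.
  rewrite !f'P => /(congr1 val) /= /val_inj -> /(congr1 val) /= /val_inj ->.
  exact: eqxx.
case=> f; rewrite inE => /andP[/injectiveP fI /forallP fP] ->.
have wfI : injectiveb (w f).
  by apply/injectiveP => i j; rewrite !ffunE => /(congr1 val) /= /val_inj /fI.
exists (exist (fun f : {ffun 'I_(sumn la) -> 'I_n} => is_true (injectiveb f)) _ wfI) => //.
rewrite inE; apply/forallP => i /=; apply/perm_rook_funE.
by exists (f (t i)); rewrite !ffunE // (eqP (fP i)).
Qed.

End PartialPermutation.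

Definition rook_char k la (s : 'S_k) : rat :=
  ((sumn la)`!%:R)^-1 * \sum_(t : 'S_(sumn la)) (equivariant_injs s t)%:R * specht_char t^-1%g.

Lemma rook_char_trace (C : numFieldType) k n (kn : (k <= n)%N) la (s : 'S_k) :
  is_part la -> la != [::] ->
  \tr (rook_mx C la (perm_rook kn s)) = ratr (rook_char la s).
Proof.
move=> la_part la0; rewrite rook_trace /rook_char rmorphM fmorphV /= ratr_nat.
congr (_ * _); rewrite rmorph_sum; apply: eq_bigr => t _ /=.
by rewrite trace_inj_left_right specht_trace // [RHS]rmorphM /= ratr_nat.
Qed.

Lemma rook_char_gt k la (s : 'S_k) : (k < sumn la)%N -> rook_char la s = 0.
Proof.
move=> kl; rewrite /rook_char big1 ?mulr0 // => t _.
by rewrite equivariant_injs_gt // mul0r.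
Qed.

(** Summing over [s] first turns each t into [wt t] h_{k-l}; the remaining average over t is the
    characteristic of the Specht module. *)
Lemma rook_char_ch k la : is_part la -> la != [::] -> (sumn la <= k)%N ->
  (k`!%:R : rat)^-1 *: \sum_(s : 'S_k) rook_char la s *: wt s
    = sch la * hs (k - sumn la).
Proof.
move=> la_part la0 lk.
rewrite -specht_ch_sch // -scalerAl mulr_suml.
rewrite (eq_bigr (fun s : 'S_k => ((sumn la)`!%:R : rat)^-1 *: \sum_(t : 'S_(sumn la))
    specht_char t^-1%g *: ((equivariant_injs s t)%:R *: wt s))); last first.
  move=> s _; rewrite /rook_char -scalerA; congr (_ *: _).
  by rewrite scaler_suml; apply: eq_bigr => t _; rewrite mulrC -scalerA.
rewrite -scaler_sumr scalerA mulrC -scalerA; congr (_ *: _).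
rewrite exchange_big /= scaler_sumr (reindex_inj invg_inj) /=.
apply: eq_bigr => t _; rewrite -scaler_sumr sum_equivariant_injs // invgK cycle_prodV.
rewrite -scalerAl scalerA mulrC -scalerA; congr (_ *: _).
by rewrite scalerA mulVf ?fact_neq0 // scale1r.
Qed.

(** * Traces on the tensor space *)

Lemma permX_mod (T : finType) (s : {perm T}) q m x :
  (s ^+ q)%g x = x -> (s ^+ (m %% q))%g x = (s ^+ m)%g x.
Proof.
move=> sq; have sqm j : (s ^+ (j * q))%g x = x.
  elim: j => [|j IHj]; first by rewrite expg0 perm1.
  by rewrite mulSn expgD permM sq.
by rewrite [in RHS](divn_eq m q) expgD permM sqm.
Qed.

Lemma permX_fix (T : finType) (s : {perm T}) r x :
  ((s ^+ r)%g x == x) = (#|porbit s x| %| r)%N.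
Proof.
set q := #|porbit s x|.
have q0 : (0 < q)%N by rewrite lt0n card_porbit_neq0.
have sq : (s ^+ q)%g x = x by rewrite permX iter_porbit.
rewrite -(permX_mod r sq) permX.
apply/eqP/idP => [e|/eqP ->]; last by [].
have := uniq_traject_porbit s x; rewrite -/q => u; apply/eqP.
have lt : (r %% q < q)%N by rewrite ltn_mod.
apply/eqP; rewrite -(nth_uniq x _ _ u) ?size_traject //.
by rewrite !nth_traject // e /=.
Qed.

Lemma card_permX_fix (T : finType) (s : {perm T}) r :
  #|[set x | (s ^+ r)%g x == x]| = (\sum_(c in porbits s | #|c| %| r) #|c|)%N.
Proof.
rewrite -sum1_card (partition_big (porbit s) (fun c => (c \in porbits s) && (#|c| %| r)%N)) /=.
  apply: eq_bigr => c /andP[/imsetP[x _ ->] cr]; rewrite -sum1_card; apply: eq_bigl => y.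
  rewrite inE permX_fix; apply/andP/idP => [[_ /eqP <-]|yx]; first exact: porbit_id.
  have e : porbit s y = porbit s x by apply/eqP; rewrite eq_porbit_mem.
  by rewrite e.
by move=> x; rewrite inE permX_fix => ->; rewrite imset_f.
Qed.

(** An equivariant map is determined by its values at the first points of the rows of [mu]; on a row
    of length r that value is an arbitrary fixed point of s^r. *)
Lemma card_cycle_equivariant (T : finType) (s : {perm T}) (mu : seq nat) :
  0%N \notin mu ->
  #|[set v : {ffun 'I_(sumn mu) -> T} | [forall y, s (v y) == v (cycle_perm mu y)]]|
    = (\prod_(r <- mu) #|[set x | (s ^+ r)%g x == x]|)%N.
Proof.
move=> mu0; pose m_ (r : 'I_(size mu)) := nth 0%N mu r.
have m_gt0 r : (0 < m_ r)%N.
  by rewrite lt0n; apply: contraNneq mu0 => <-; exact: mem_nth.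
pose F (r : 'I_(size mu)) : {pred T} := mem [set x | (s ^+ m_ r)%g x == x].
have -> : (\prod_(r <- mu) #|[set x | (s ^+ r)%g x == x]| = #|family F|)%N.
  by rewrite card_family foldrE big_map big_enum /= (big_nth 0%N) big_mkord.
pose ix (i : 'I_(sumn mu)) : 'I_(size mu) := Ordinal (reshape_indexP (ltn_ord i)).
pose fl r := Ordinal (@flatten_indexP mu (val r) 0 (m_gt0 r)).
pose v (x : {ffun 'I_(size mu) -> T}) : {ffun 'I_(sumn mu) -> T} :=
  [ffun i => (s ^+ reshape_offset mu (val i))%g (x (ix i))].
have ix_fl r : ix (fl r) = r by apply: val_inj; exact: (flatten_indexKl (m_gt0 r)).
have of_fl r : reshape_offset mu (val (fl r)) = 0%N by exact: (flatten_indexKr (m_gt0 r)).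
have ix_c i : ix (cycle_perm mu i) = ix i.
  by apply: val_inj; rewrite /= permE val_cycle_fun; case: (cycle_step_row (ltn_ord i)).
have of_c i : reshape_offset mu (val (cycle_perm mu i))
     = ((reshape_offset mu (val i)).+1 %% m_ (ix i))%N.
  by rewrite permE val_cycle_fun; case: (cycle_step_row (ltn_ord i)).
have vI : injective v.
  move=> x x' /ffunP e; apply/ffunP => r; have := e (fl r).
  by rewrite !ffunE ix_fl of_fl expg0 !perm1.
rewrite -(card_imset _ vI); apply: eq_card => w; rewrite inE.
apply/forallP/imsetP => [wP|[x /familyP xF ->] y]; last first.
  have := xF (ix y); rewrite inE => /eqP fx.
  by rewrite !ffunE ix_c of_c permX_mod // expgSr permM.
have wE r o (lt : (o < m_ r)%N) : w (Ordinal (@flatten_indexP mu (val r) o lt)) = (s ^+ o)%g (w (fl r)).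
  elim: o lt => [|o IHo] lt.
    by rewrite expg0 perm1; congr (w _); apply: val_inj.
  have lt' := ltnW lt; rewrite expgSr permM -IHo (eqP (wP _)); congr (w _).
  apply: val_inj => /=; rewrite permE val_cycle_fun /cycle_step /=.
  rewrite flatten_indexKl // flatten_indexKr // modn_small //.
exists [ffun r => w (fl r)].
  apply/familyP => r; rewrite inE ffunE.
  have mr : (m_ r).-1.+1 = m_ r by rewrite prednK.
  have lt : ((m_ r).-1 < m_ r)%N by rewrite mr.
  (* The last offset of a row steps back to offset 0, which closes the cycle and shows that s^r
     fixes the first value. *)
  rewrite -[X in (s ^+ X)%g]mr expgSr permM -(wE r _ lt) (eqP (wP _)).
  apply/eqP; congr (w _); apply: val_inj => /=.
  rewrite permE val_cycle_fun /cycle_step /= flatten_indexKl // flatten_indexKr //.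
  by rewrite mr modnn.
apply/ffunP => i; rewrite !ffunE.
rewrite -(wE (ix i) _ (reshape_offsetP (ltn_ord i))); congr (w _); apply: val_inj => /=.
by rewrite reshape_indexK.
Qed.

Section TensorTrace.

Variables (k i : nat) (c : 'S_i) (d : PP k).
Hypotheses (i0 : (0 < i)%N) (ik : (i <= k)%N) (dE : val d = ext_blocks k c).

Lemma clamp_subproof (x : 'I_k) : (minn x i.-1 < i)%N.
Proof. by rewrite -[X in (_ < X)%N]prednK // ltnS geq_minr. Qed.
(** The index of the block containing the barred element x: everything from i - 1 on falls into the
    last block. *)
Definition clamp x := Ordinal (clamp_subproof x).

Lemma clampK y : clamp (widen_ord ik y) = y.
Proof. by apply: val_inj => /=; apply/minn_idPl; rewrite -ltnS prednK. Qed.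

Lemma same_block_rr j l : same_block d (inr j) (inr l) = (clamp j == clamp l).
Proof.
rewrite /same_block dE; apply/existsP/eqP => [[B /andP[/imsetP[y _ ->]]]|e].
  rewrite !inE => /andP[/eqP e1 /eqP e2]; apply: val_inj => /=.
  by rewrite e1 e2.
exists (ext_block k c (clamp j)); rewrite imset_f //= !inE /= eqxx /=.
by rewrite -[minn l _]/(val (clamp l)) -e.
Qed.

Lemma same_block_lr j l : same_block d (inl j) (inr l) = (clamp j == c (clamp l)).
Proof.
rewrite /same_block dE; apply/existsP/eqP => [[B /andP[/imsetP[y _ ->]]]|e].
  rewrite !inE => /andP[/eqP e1 /eqP e2].
  have -> : clamp l = y by apply: val_inj.
  by apply: val_inj.
exists (ext_block k c (clamp l)); rewrite imset_f //= !inE /= eqxx andbT.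
by rewrite -[minn j _]/(val (clamp j)) e.
Qed.

(** The trace counts pairs (a, b) with s a = b and d b = a. The diagram forces b = v o clamp and a =
    v o c^-1 o clamp, so that s a = b becomes the equivariance of v. *)
Lemma tensor_trace (C : fieldType) m n (mn : (m <= n)%N) (s : 'S_m) :
  \tr (rook_tensor C k (perm_rook mn s) *m PP_tensor C n d)
    = #|[set v : {ffun 'I_i -> 'I_m} | [forall y, s (v y) == v (c y)]]|%:R.
Proof.
pose P (u : multi k n * multi k n) :=
  [forall j, perm_rook_fun mn s (u.1 j) == Some (u.2 j)] && PP_sends d u.2 u.1.
transitivity (#|[set u | P u]|%:R : C).
  rewrite -sum1dep_card big_mkcond /= natr_sum.
  rewrite -(pair_big xpredT xpredT (fun a b => ((if P (a, b) then 1 else 0)%N%:R : C))) /=.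
  rewrite /mxtrace [RHS]big_enum_val /=; apply: eq_bigr => a _.
  rewrite mxE [RHS]big_enum_val /=; apply: eq_bigr => b _.
  rewrite !mxE /P /=.
  by case: [forall j, _]; case: PP_sends; rewrite ?mul1r ?mul0r.
pose ab (v : {ffun 'I_i -> 'I_m}) : multi k n * multi k n :=
  ([ffun j => widen_ord mn (v (c^-1 (clamp j))%g)], [ffun j => widen_ord mn (v (clamp j))]).
have abI : injective ab.
  move=> v v' [_ /ffunP e]; apply/ffunP => y; have := e (widen_ord ik y).
  by rewrite !ffunE clampK => /(congr1 val) /= /val_inj.
congr _%:R; rewrite -(card_imset _ abI); apply: eq_card => -[a b]; rewrite inE.
apply/idP/imsetP => [|[v vP [-> ->]]]; last first.
  move: vP; rewrite inE => /forallP vP.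
  apply/andP; split => /=.
    apply/forallP => j; apply/perm_rook_funE; exists (v (c^-1 (clamp j))%g);
      rewrite ffunE //.
    by rewrite (eqP (vP _)) permKV.
  apply/andP; split; apply/'forall_forallP => j l; apply/implyP.
    by rewrite same_block_rr !ffunE => /eqP ->.
  by rewrite same_block_lr !ffunE => /eqP ->; rewrite permK.
move=> /andP[/= /forallP sab /andP[/'forall_forallP b1 /'forall_forallP b2]].
have bE j : b j = b (widen_ord ik (clamp j)).
  by apply/eqP; apply: (implyP (b1 _ _)); rewrite same_block_rr clampK.
have aE j : a j = b (widen_ord ik (c^-1 (clamp j)))%g.
  by apply/eqP; apply: (implyP (b2 _ _)); rewrite same_block_lr clampK permKV.
have /fin_all_exists[v vP] y : exists x : 'I_m, b (widen_ord ik y) = widen_ord mn x.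
  by have /perm_rook_funE[x _ ->] := sab (widen_ord ik y); exists (s x).
exists (finfun v).
  rewrite inE; apply/forallP => y; rewrite !ffunE.
  have := sab (widen_ord ik (c y)); rewrite aE clampK permK vP => /perm_rook_funE[x].
  move=> /(congr1 val) /= /val_inj ->; rewrite vP => /(congr1 val) /= /val_inj ->.
  exact: eqxx.
by congr pair; apply/ffunP => j; rewrite !ffunE ?aE ?[b j]bE vP.
Qed.

End TensorTrace.

Lemma trace_decomposition (C : fieldType) k n (W : seq nat -> PP_module C k)
    (s : rook n) (d : PP k) :
  tensor_decomposition n W ->
  \tr (rook_tensor C k s *m PP_tensor C n d)
    = \sum_(la <- nonempty_parts k) \tr (rook_mx C la s) * \tr (W la d).
Proof.
case=> T [Tfree Tfull Ts Td]; rewrite (big_nth [::]) big_mkord.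
have -> : rook_tensor C k s *m PP_tensor C n d
    = pinvmx T *m (T *m rook_tensor C k s *m PP_tensor C n d).
  by rewrite !mulmxA mulVpmx // mul1mx.
rewrite -Ts -[_ *m T *m _]mulmxA -Td mxtrace_mulC -!mulmxA mulmxVp // mulmx1.
rewrite mul_mxdiag_mxblock mxtrace_mxblock; apply: eq_bigr => i _.
by rewrite eqxx conform_mx_id tensmx_mul mulmx1 mul1mx mxtrace_tens.
Qed.

Lemma sum_character (C : numFieldType) k n (W : seq nat -> PP_module C k) (mu : seq nat)
    (d : PP k) m (s : 'S_m) :
  tensor_decomposition n W -> (k <= n)%N -> (m <= k)%N ->
  is_part mu -> mu != [::] -> (sumn mu <= k)%N -> val d = ext_blocks k (cycle_perm mu) ->
  \sum_(la <- nonempty_parts k) ratr (rook_char la s) * \tr (W la d)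
    = (\prod_(r <- mu) \sum_(c in porbits s | #|c| %| r) #|c|)%N%:R.
Proof.
move=> dec kn mk mu_part mu0 muk dE; have mn := leq_trans mk kn.
have mu_gt0 : (0 < sumn mu)%N by exact: sumn_gt0.
have mu_0 : 0%N \notin mu by case/andP: mu_part.
under eq_bigr => r _ do rewrite -card_permX_fix.
rewrite -card_cycle_equivariant // -(tensor_trace mu_gt0 muk dE C mn).
rewrite (trace_decomposition _ _ dec) [LHS]big_seq [RHS]big_seq.
apply: eq_bigr => la; rewrite mem_nonempty_parts => /and3P[la_part la0 _].
by rewrite rook_char_trace //; apply: contraTneq la0 => ->.
Qed.

(** * Plethysm with [Omega - 1] *)

(** Both forms are bilinear and agree on Schur functions, into which every monomial expands by
    [sch_expansion]. *)
Lemma hall_hform (B : Lambda -> Lambda -> rat) (f g : Lam) :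
  is_hall B -> B (lam_val f) (lam_val g) = hform f g.
Proof.
case=> Bl Br Bs; have B0l h : B 0 h = 0.
  by have := Bl 1 0 0 h; rewrite scale1r addr0 mul1r => /eqP;
    rewrite -subr_eq0 opprD addNKr oppr_eq0 => /eqP.
have B0r h : B h 0 = 0.
  by have := Br 1 0 0 h; rewrite scale1r addr0 mul1r => /eqP;
    rewrite -subr_eq0 opprD addNKr oppr_eq0 => /eqP.
have Bsum_l h r (c : seq nat -> rat) (F : seq nat -> Lam) :
    B (lam_val (\sum_(la <- r) c la *: F la)) h = \sum_(la <- r) c la * B (lam_val (F la)) h.
  elim: r => [|la r IH]; first by rewrite !big_nil raddf0 B0l.
  by rewrite !big_cons raddfD /= lam_valZ Bl IH.
have Bsum_r h r (c : seq nat -> rat) (F : seq nat -> Lam) :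
    B h (lam_val (\sum_(la <- r) c la *: F la)) = \sum_(la <- r) c la * B h (lam_val (F la)).
  elim: r => [|la r IH]; first by rewrite !big_nil raddf0 B0r.
  by rewrite !big_cons raddfD /= lam_valZ Br IH.
move: f g; apply: (@bilinear_eq_mon rat^o).
- by move=> g a f1 f2; rewrite raddfD /= lam_valZ Bl.
- exact: hform_linearl.
- by move=> f a g1 g2; rewrite raddfD /= lam_valZ Br.
- exact: hform_linearr.
move=> s t; rewrite (sch_expansion (@homog_mon s)) (sch_expansion (@homog_mon t)).
rewrite Bsum_l hform_suml big_seq [RHS]big_seq; apply: eq_bigr => la.
rewrite mem_parts => /andP[la_part _]; rewrite hformZl; congr (_ * _).
rewrite Bsum_r hform_sumr big_seq [RHS]big_seq; apply: eq_bigr => ka.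
rewrite mem_parts => /andP[ka_part _]; rewrite hformZr; congr (_ * _).
by rewrite !lam_val_sch Bs // sch_orth.
Qed.

Definition pleth_pw (r : nat) : Lam -> Lam := ev (fun i => pw (r * i.+1)).

Lemma pleth_pw_lin r : linear (pleth_pw r). Proof. exact: linearP. Qed.
Lemma pleth_pw1 r : pleth_pw r 1 = 1. Proof. exact: rmorph1. Qed.
Lemma pleth_pwM r f g : pleth_pw r (f * g) = pleth_pw r f * pleth_pw r g. Proof. exact: rmorphM. Qed.
Lemma pleth_pw0 r : pleth_pw r 0 = 0. Proof. exact: raddf0. Qed.
Lemma pleth_pw_pw r i : pleth_pw r (pw i.+1) = pw (r * i.+1). Proof. exact: ev_pw. Qed.

Lemma evE (A : comAlgType rat) (x : nat -> A) f :
  ev x f = \sum_(t <- lsupp f) mcf t f *: mon_eval x t.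
Proof. by rewrite /ev unlock. Qed.

Lemma lam_val_pleth_pw r f : lam_val (pleth_pw r f) = pleth_psum r (lam_val f).
Proof.
rewrite /pleth_pw evE raddf_sum /pleth_psum; apply: eq_bigr => t _ /=.
rewrite lam_valZ rmorph_prod; congr (_ *: _); apply: eq_bigr => i _.
by rewrite rmorphXn /= lam_val_pw.
Qed.

(** A chain rule: p_{a+1} enters p_r[f] only as the image of p_b with r b = a + 1, and the
    normalizing factors a + 1 and b differ by r. *)
Lemma dp_pleth_pw a r f : (0 < r)%N -> dp a (pleth_pw r f)
  = if (r %| a.+1)%N then r%:R *: pleth_pw r (dp (a.+1 %/ r).-1 f) else 0.
Proof.
move=> r0; move: f; apply: lam_ind => [c f g fE gE||i f fE].
- rewrite pleth_pw_lin !dp_lin fE gE; case: ifP => _; last by rewrite scaler0 addr0.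
  by rewrite pleth_pw_lin scalerDr !scalerA mulrC.
- by rewrite pleth_pw1 !dp1 pleth_pw0 scaler0 if_same.
rewrite pleth_pwM dpM fE pleth_pw_pw -[X in dp a (pw X)]prednK ?muln_gt0 ?r0 // dp_pw.
have -> : ((r * i.+1).-1 == a) = (r * i.+1 == a.+1)%N by rewrite -eqSS prednK ?muln_gt0 ?r0.
case: ifP => [ra|ra]; last first.
  case: eqP => [e|_]; last by rewrite muln0 mul0r mulr0 addr0.
  by rewrite -e dvdn_mulr in ra.
have e : a.+1 = (r * (a.+1 %/ r).-1.+1)%N.
  by rewrite prednK ?divn_gt0 ?(dvdn_leq _ ra) // mulnC divnK.
move: e; set b := (_).-1 => e.
have psiD f1 f2 : pleth_pw r (f1 + f2) = pleth_pw r f1 + pleth_pw r f2.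
  by have := pleth_pw_lin r 1 f1 f2; rewrite !scale1r.
rewrite dpM psiD !pleth_pwM pleth_pw_pw dp_pw scalerDr -scalerAr; congr (_ + _).
rewrite [pleth_pw r _%:R]rmorph_nat [in LHS]e eqn_pmul2l // eqSS scalerAl; congr (_ * _).
by rewrite -mulnA natrM scaler_nat mulr_natl.
Qed.

Section Plethysm.

Variable N : nat.

(* The truncation at degree [N] of p_r[Omega]. *)
Definition omega_pw (r : nat) : {poly Lam} :=
  \poly_(d < N.+1) (if (r %| d)%N then pleth_pw r (hs (d %/ r)) else 0).

(* The truncation at degree [N] of f |-> f[Omega - 1]. *)
Definition pleth_Omega1 : Lam -> {poly Lam} := ev (fun i => omega_pw i.+1 - 1 : lam_poly).
HB.instance Definition _ := GRing.RMorphism.copy pleth_Omega1 (pleth_Omega1 : Lam -> lam_poly).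

Lemma pleth_Omega1Z c f : pleth_Omega1 (c *: f) = (c%:A)%:P * pleth_Omega1 f.
Proof. by rewrite /pleth_Omega1 linearZ /= [RHS]mul_polyC. Qed.

Lemma coef_pleth_Omega1Z c f n : (pleth_Omega1 (c *: f))`_n = c *: (pleth_Omega1 f)`_n.
Proof. by rewrite pleth_Omega1Z coefCM mulr_algl. Qed.

Lemma coef_omega_pw r d : (d <= N)%N ->
  (omega_pw r)`_d = if (r %| d)%N then pleth_pw r (hs (d %/ r)) else 0.
Proof. by move=> dN; rewrite coef_poly ltnS dN. Qed.

Let approx (F : Lambda_hat) (q : {poly Lam}) :=
  forall d, (d <= N)%N -> F d = lam_val q`_d.

Lemma approx1 : approx hat_one 1.
Proof. by move=> d _; rewrite /hat_one coef1; case: eqP; rewrite ?rmorph1 ?rmorph0. Qed.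

Lemma approxM F G p q : approx F p -> approx G q -> approx (hat_mul F G) (p * q).
Proof.
move=> Fp Gq d dN; rewrite /hat_mul coefM raddf_sum; apply: eq_bigr => i _ /=.
rewrite lam_val_mul Fp ?Gq // ?(leq_trans (leq_subr _ _)) //.
by apply: leq_trans dN; rewrite -ltnS.
Qed.

(** p_m[-] fixes constants, so the -1 passes through unchanged in degree 0. *)
Lemma approx_omega_pw i : approx (pleth_psum_hat i.+1 Omega_minus1) (omega_pw i.+1 - 1).
Proof.
move=> d dN;
  rewrite coefB coef_omega_pw // coef1 /pleth_psum_hat /Omega_minus1 /Omega /hat_one.
have -> : hsym (d %/ i.+1) - (d %/ i.+1 == 0)%N%:R
    = lam_val (hs (d %/ i.+1) - (d %/ i.+1 == 0)%N%:R).
  by rewrite raddfB /= lam_val_hs rmorph_nat.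
rewrite -lam_val_pleth_pw; case: ifP => [id|id].
  rewrite /pleth_pw; congr (lam_val _); rewrite raddfB /= rmorph_nat; congr (_ - _%:R).
  by rewrite -[in RHS](divnK id) muln_eq0 orbF.
by case: eqP id => [->|_]; rewrite ?dvdn0 // subr0 raddf0.
Qed.

Lemma coef_pleth_Omega1 f d : (d <= N)%N ->
  pleth (lam_val f) Omega_minus1 d = lam_val (pleth_Omega1 f)`_d.
Proof.
move=> dN; rewrite /pleth_Omega1 evE coef_sum raddf_sum; apply: eq_bigr => t _ /=.
rewrite coefZ mulr_algl lam_valZ; congr (_ *: _); apply: (_ : approx _ _) dN.
rewrite /mon_eval; elim/big_rec2: _ => [|i q F _ Fq]; first exact: approx1.
apply: approxM Fq; rewrite -[X in _ ^+ X]card_ord -prodr_const.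
elim/big_rec2: _ => [|j q' F' _ Fq']; first exact: approx1.
by apply: approxM Fq'; exact: approx_omega_pw.
Qed.

End Plethysm.

(** * Pairing plethysms with power sums *)

Section PowerSumPairing.

Variable N : nat.
Local Notation omega_pw := (omega_pw N).
Local Notation pleth_Omega1 := (pleth_Omega1 N).

(* As p_r[Omega] is the exponential of the sum of the p_{ri} / i, the derivations
   multiply products of such series by monomials in the degree variable. *)
Definition dp_eigen (F : {poly Lam}) (K : nat -> rat) :=
  forall a d, (d <= N)%N -> dp a F`_d = K a *: ('X^(a.+1) * F)`_d.

Lemma dp_eigen1 : dp_eigen 1 (fun=> 0).
Proof.
move=> a d _; rewrite scale0r coef1; case: eqP => _; first exact: dp1.
exact: raddf0.
Qed.

Lemma dp_eigenM F G K L :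
  dp_eigen F K -> dp_eigen G L -> dp_eigen (F * G) (fun a => K a + L a).
Proof.
move=> FK GL a d dN; rewrite scalerDl {1}mulrA [in X in _ + X]mulrCA !coefM.
rewrite raddf_sum !scaler_sumr -big_split; apply: eq_bigr => i _ /=.
rewrite dpM FK ?GL ?(leq_trans (leq_subr _ _)) ?(leq_trans _ dN) //; last first.
  by rewrite -ltnS.
by rewrite scalerAl scalerAr.
Qed.

(** The chain rule brings out the factor r, and [dp_hZ] lowers the index d / r of h by (a + 1) / r,
    which is a shift by a + 1 in the degree variable. *)
Lemma dp_eigen_omega_pw r : (0 < r)%N ->
  dp_eigen (omega_pw r) (fun a => if (r %| a.+1)%N then r%:R else 0).
Proof.
move=> r0 a d dN; rewrite coefXnM coef_omega_pw //.
have [rd|rd] := boolP (r %| d)%N; last first.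
  rewrite [LHS]raddf0; case: ifP => [ra|_]; last by rewrite scale0r.
  case: ltnP => [_|ad]; first by rewrite scaler0.
  rewrite coef_omega_pw; last by rewrite (leq_trans (leq_subr _ _)).
  by rewrite dvdn_subl // (negPf rd) scaler0.
rewrite dp_pleth_pw //; case: ifP => [ra|_]; last by rewrite scale0r.
congr (_ *: _); rewrite -[hs _]/(hZ (Posz _)) dp_hZ.
have -> : (a.+1 %/ r).-1.+1 = (a.+1 %/ r)%N.
  by rewrite prednK // divn_gt0 // dvdn_leq.
case: ltnP => [da|ad].
  rewrite (_ : Posz _ - Posz _ = Negz (a.+1 %/ r - d %/ r).-1) ?pleth_pw0 //.
  have : (d %/ r < a.+1 %/ r)%N by rewrite ltn_divLR // divnK.
  by lia.
rewrite coef_omega_pw; last by rewrite (leq_trans (leq_subr _ _)).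
rewrite dvdn_sub // divnBr // (_ : Posz _ - Posz _ = Posz (d %/ r - a.+1 %/ r)) //.
have : (a.+1 %/ r <= d %/ r)%N by rewrite leq_div2r.
by lia.
Qed.

Lemma dp_eigen_prod (I : Type) (s : seq I) (P : pred I) (r : I -> nat) :
  (forall c, P c -> 0 < r c)%N ->
  dp_eigen (\prod_(c <- s | P c) omega_pw (r c))
    (fun a => \sum_(c <- s | P c) if (r c %| a.+1)%N then (r c)%:R else 0).
Proof.
move=> r0; elim: s => [|c s IH].
  by rewrite big_nil => a d dN; rewrite big_nil; apply: dp_eigen1.
have [Pc|Pc] := boolP (P c); last first.
  rewrite big_cons (negPf Pc) => a d dN; rewrite big_cons (negPf Pc); exact: IH.
rewrite big_cons Pc => a d dN; rewrite big_cons Pc.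
exact: (dp_eigenM (dp_eigen_omega_pw (r0 _ Pc)) IH).
Qed.

(** Each factor p_{a+1} of p_mu moves to the other side as [dp a], where it yields K a and a shift
    by a + 1 in degree; at the end only the constant term is left. *)
Lemma dp_eigen_pairing F K mu : dp_eigen F K -> 0%N \notin mu -> (sumn mu <= N)%N ->
  \sum_(d < (sumn mu).+1) hform F`_d (pwp mu) = (\prod_(r <- mu) K r.-1) * eps F`_0.
Proof.
move=> FK; elim: mu => [|[//|a] mu IH] /=.
  by move=> _ _; rewrite big_ord1 /pwp !big_nil hform1 mul1r.
rewrite inE negb_or => /andP[_ mu0] le.
(* The degrees d <= a are split off: the series multiplied by X^(a+1) has no coefficient there. *)
rewrite -addnS big_split_ord /= big1 ?add0r.
  rewrite big_cons -mulrA -IH //; last exact: leq_trans (leq_addl _ _) le.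
  rewrite mulr_sumr; apply: eq_bigr => i _.
  rewrite /pwp big_cons -hform_dp FK.
    by rewrite hformZl coefXnM ltnNge leq_addr /= addKn.
  by rewrite (leq_trans _ le) // leq_add2l -ltnS.
move=> i _; rewrite /pwp big_cons -hform_dp FK.
  by rewrite coefXnM ltn_ord scaler0 hform0l.
by rewrite (leq_trans _ le) // (leq_trans (ltnW (ltn_ord i))) // leq_addr.
Qed.

Definition pleth_pairing (mu : seq nat) (f : Lam) : rat :=
  \sum_(d < (sumn mu).+1) hform (pleth_Omega1 f)`_d (pwp mu).

Lemma pleth_pairing_sum mu I (s : seq I) (P : pred I) (F : I -> Lam) :
  pleth_pairing mu (\sum_(i <- s | P i) F i) = \sum_(i <- s | P i) pleth_pairing mu (F i).
Proof.
rewrite /pleth_pairing exchange_big; apply: eq_bigr => d _ /=.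
by rewrite rmorph_sum coef_sum hform_suml.
Qed.

Lemma pleth_pairingZ mu c f : pleth_pairing mu (c *: f) = c * pleth_pairing mu f.
Proof.
rewrite /pleth_pairing mulr_sumr; apply: eq_bigr => d _.
by rewrite coef_pleth_Omega1Z hformZl.
Qed.

Lemma pleth_Omega1_pw r : pleth_Omega1 (pw r.+1) = omega_pw r.+1 - 1.
Proof. by rewrite /pleth_Omega1 ev_pw. Qed.

Lemma pleth_Omega1_pwD1 r : (0 < r)%N -> pleth_Omega1 (pw r + 1) = omega_pw r.
Proof. by case: r => // r _; rewrite rmorphD rmorph1 /= pleth_Omega1_pw subrK. Qed.

(** The 1 added to each p_|c| compensates the -1 of Omega - 1, leaving a product of the
    p_|c|[Omega]. Its eigenvalue at r sums |c| over the cycles with |c| dividing r. *)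
Lemma pleth_pairing_cycles (T : finType) (s : {perm T}) mu :
  0%N \notin mu -> (sumn mu <= N)%N ->
  pleth_pairing mu (\prod_(c in porbits s) (pw #|c| + 1))
    = (\prod_(r <- mu) \sum_(c in porbits s | #|c| %| r) #|c|)%N%:R.
Proof.
move=> mu0 muN; have c0 c : c \in porbits s -> (0 < #|c|)%N.
  by case/imsetP => x _ ->; rewrite lt0n card_porbit_neq0.
rewrite /pleth_pairing rmorph_prod /=.
rewrite (eq_bigr (fun c : {set T} => omega_pw #|c|)) => [|c /c0];
  last exact: pleth_Omega1_pwD1.
rewrite (dp_eigen_pairing (dp_eigen_prod _ c0) mu0 muN).
have -> : (\prod_(c in porbits s) omega_pw #|c|)`_0 = 1.
  rewrite coef0_prod big1 // => c _; rewrite coef_omega_pw // dvdn0 div0n hs0.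
  exact: pleth_pw1.
rewrite eps1 mulr1 natr_prod big_seq [RHS]big_seq; apply: eq_bigr => r rmu.
have r0 : (0 < r)%N by rewrite lt0n; apply: contraNneq mu0 => <-.
by rewrite prednK // natr_sum big_mkcondr.
Qed.

(** Without its constant term p_r[Omega - 1] begins in degree r, so a monomial of degree l begins in
    degree l. The vanishing for |mu| < |la| comes from here. *)
Lemma coef_pleth_Omega1_lt l f d : homog l f -> (d < l)%N -> (pleth_Omega1 f)`_d = 0.
Proof.
move=> hf dl; rewrite [f]lam_monE rmorph_sum coef_sum big_seq big1 // => t.
rewrite -mcf_neq0 => /hf tl; rewrite coef_pleth_Omega1Z.
suff -> : (pleth_Omega1 (mon t))`_d = 0 by rewrite scaler0.
move: d dl; rewrite -tl {tl}; elim/cmonom_ind: t => [|i t IH] d; first by rewrite mon_deg1.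
rewrite mon_degM mon_degU -monM -[mon (ucm i)]/(mon (ucm i.+1.-1)) -pwE.
rewrite rmorphM /= pleth_Omega1_pw coefM => dlt; rewrite big1 // => j _.
have [ji|ij] := ltnP j i.+1; last first.
  by rewrite IH ?mulr0 //; have := ltn_ord j; lia.
have [jN|Nj] := leqP j N; last first.
  rewrite coefB coef1 coef_poly ltnNge Nj /= (_ : _ == _ = false) ?subr0 ?mul0r //.
  by lia.
rewrite coefB coef_omega_pw // coef1; case: ifP => [/dvdnP[q qE]|ji'].
  have j0 : (j = 0 :> nat)%N by case: q qE ji => [|q] -> //; lia.
  by rewrite j0 div0n hs0 pleth_pw1 subrr mul0r.
by case: eqP ji' => [->|]; rewrite ?dvdn0 // subr0 mul0r.
Qed.

End PowerSumPairing.

Lemma hform_skew_mon n m f t : homog m f -> hform (skewp 1 f)`_n (mon t) != 0 ->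
  m = (n + mon_deg t)%N.
Proof.
move=> hf; rewrite -hform_hs => h; apply/eqP; apply: contraNT h => neq.
apply/eqP; apply: (hform_homog hf) (neq).
by apply: homogM; [exact: homog_hs|exact: homog_mon].
Qed.

(** Read off by pairing with monomials, as no z_mu is 0. For n > m the coefficient vanishes, so the
    truncated difference does no harm. *)
Lemma homog_coef_skew n m f : homog m f -> homog (m - n) (skewp 1 f)`_n.
Proof.
move=> hf t h; have := @hform_skew_mon n m f t hf.
rewrite hformC hform_monl mulf_eq0 (negPf h) pnatr_eq0 => ->; first by rewrite addKn.
by rewrite /zee -lt0n prodn_gt0 // => i; rewrite muln_gt0 expn_gt0 fact_gt0.
Qed.

Lemma size_skew m f : homog m f -> (size (skewp 1 f) <= m.+1)%N.
Proof.
move=> hf; apply/leq_sizeP => n mn; rewrite [LHS]lam_monE big_seq big1 // => t.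
rewrite -mcf_neq0 => h; have := @hform_skew_mon n m f t hf.
rewrite hformC hform_monl mulf_eq0 (negPf h) pnatr_eq0 => E; move: mn;
  rewrite E ?leq_addr //.
  by rewrite ltnNge leq_addr.
by rewrite /zee -lt0n prodn_gt0 // => i; rewrite muln_gt0 expn_gt0 fact_gt0.
Qed.

(** At X = 1 the translation [skewp 1] sends p_r to p_r + 1. *)
Lemma prod_cycles_add1 (T : finType) (s : {perm T}) :
  \prod_(c in porbits s) (pw #|c| + 1) = \sum_(n < #|T|.+1) (skewp 1 (wt s))`_n.
Proof.
transitivity (skewp 1 (wt s)).[1]; last first.
  rewrite (horner_coef_wide _ (@size_skew #|T| _ (@homog_wt T s))).
  by apply: eq_bigr => n _; rewrite expr1n mulr1.
rewrite rmorph_prod horner_prod; apply: eq_bigr => c /imsetP[x _ ->].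
have : (0 < #|porbit s x|)%N by rewrite lt0n card_porbit_neq0.
case: #|_| => // r _; rewrite /= skew_pw /skew_var !hornerE.
by rewrite !expr1n scale1r mulr1.
Qed.

Lemma cycles_sch m (s : 'S_m) :
  \prod_(c in porbits s) (pw #|c| + 1)
    = \sum_(l < m.+1) \sum_(la <- parts l) hform (sch la * hs (m - l)) (wt s) *: sch la.
Proof.
rewrite prod_cycles_add1 card_ord (reindex_inj rev_ord_inj) /=.
apply: eq_bigr => l _; rewrite subSS.
have lm : (l <= m)%N by rewrite -ltnS.
have h : homog l (skewp 1 (wt s))`_(m - l).
  have := @homog_coef_skew (m - l) m (wt s); rewrite subKn //; apply.
  by rewrite -[X in homog X](card_ord m); exact: homog_wt.
rewrite [LHS](sch_expansion h).
by apply: eq_bigr => la _; rewrite -hform_hs hformC mulrC.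
Qed.

(** Once [cycles_sch] is substituted, the sum over [s] of <s_la h_{m-l}, wt s> [wt s] gives back m!
    s_la h_{m-l} by [frobenius_expansion]. *)
Lemma pleth_pairing_ch N mu m :
  0%N \notin mu -> (sumn mu <= N)%N ->
  (m`!%:R : rat)^-1 *: \sum_(s : 'S_m)
      (\prod_(r <- mu) \sum_(c in porbits s | #|c| %| r) #|c|)%N%:R *: wt s
    = \sum_(l < m.+1) \sum_(la <- parts l)
        pleth_pairing N mu (sch la) *: (sch la * hs (m - l)).
Proof.
move=> mu0 muN.
under eq_bigr => s _.
  rewrite -(pleth_pairing_cycles s mu0 muN) cycles_sch pleth_pairing_sum scaler_suml.
  under eq_bigr => l _.
    rewrite pleth_pairing_sum scaler_suml.
    under eq_bigr => la _ do rewrite pleth_pairingZ mulrC -scalerA.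
    over.
  over.
rewrite exchange_big /= scaler_sumr; apply: eq_bigr => l _.
rewrite exchange_big /= scaler_sumr big_seq [RHS]big_seq; apply: eq_bigr => la.
rewrite mem_parts => /andP[_ /eqP lal].
rewrite -scaler_sumr scalerA mulrC -scalerA; congr (_ *: _).
apply: frobenius_expansion.
have mE : (sumn la + (m - l))%N = m by rewrite lal subnKC // -ltnS.
rewrite -[X in homog X]mE.
by apply: homogM; [exact: homog_sch|exact: homog_hs].
Qed.

(** * Comparison of the two expansions *)

Section Main.

Variables (C : numFieldType) (k n : nat) (W : seq nat -> PP_module C k) (mu : seq nat).
Hypotheses (kn : (k <= n)%N) (dec : tensor_decomposition n W).
Hypotheses (mu_part : is_part mu) (mu_n0 : mu != [::]) (muk : (sumn mu <= k)%N).
Variable d : PP k.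
Hypothesis dE : val d = ext_blocks k (cycle_perm mu).

Let X la := pleth_pairing (sumn mu) mu (sch la).

Lemma mu_notin0 : 0%N \notin mu. Proof. by case/andP: mu_part. Qed.

(** The empty partition occurs in [parts 0] but not in the tensor decomposition; its term drops out
    because p_mu has positive degree. *)
Lemma pleth_pairing_nil : X [::] = 0.
Proof.
rewrite /X sch_nil /pleth_pairing big1 // => -[i im] _ /=.
rewrite rmorph1 coef1; case: eqP => _; last by rewrite hform0l.
rewrite hformC hform1 /pwp; case: (mu) mu_n0 => // r nu _.
by rewrite big_cons epsM eps_pw mul0r.
Qed.

Lemma sum_parts (V : nmodType) m (F : seq nat -> V) : (m <= k)%N -> F [::] = 0 ->
  \sum_(l < m.+1) \sum_(la <- parts l) F la
    = \sum_(la <- nonempty_parts k | (sumn la <= m)%N) F la.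
Proof.
move=> mk F0;
  transitivity (\sum_(l < m.+1) \sum_(la <- nonempty_parts k | sumn la == l) F la).
  apply: eq_bigr => -[l lm] _ /=; rewrite ltnS in lm; rewrite -[RHS]big_filter.
  have [->|l0] := posnP l.
    rewrite big_seq [RHS]big_seq big1 => [|la].
      rewrite big1 // => la; rewrite mem_filter mem_nonempty_parts.
      by move=> /andP[/eqP ->]; rewrite andbF.
    rewrite mem_parts => /andP[la_part /eqP la0].
    by have [->|/(sumn_gt0 la_part)] := eqVneq la [::]; rewrite ?la0.
  apply: perm_big; apply: uniq_perm;
    rewrite ?parts_uniq ?(filter_uniq _ (nonempty_parts_uniq k)) //.
  move=> la; rewrite mem_parts mem_filter mem_nonempty_parts andbC.
  by case: eqP => //= ->; rewrite l0 (leq_trans lm mk) /= andbT.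
under [LHS]eq_bigr => l _ do rewrite big_mkcond.
rewrite exchange_big /= [RHS]big_mkcond; apply: eq_bigr => la _.
rewrite -big_mkcond /=; case: leqP => [lam|mla]; last first.
  by rewrite big_pred0 // => l; apply/negP => /eqP e; have := ltn_ord l; lia.
by rewrite (big_pred1 (Ordinal (lam : (_ < m.+1)%N))) // => l; rewrite -val_eqE eq_sym.
Qed.

(** [Lam] has rational coefficients while the traces lie in [C], so the two expansions of ch F are
    compared after pairing with a test element [g]. *)
Lemma character_ch m g : (m <= k)%N ->
  \sum_(la <- nonempty_parts k | (sumn la <= m)%N)
    ratr (hform (sch la * hs (m - sumn la)) g) * (\tr (W la d) - ratr (X la)) = 0.
Proof.
move=> mk.
pose c (s : 'S_m) := (m`!%:R : rat)^-1 * hform (wt s) g.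
pose P (s : 'S_m) := (\prod_(r <- mu) \sum_(c in porbits s | #|c| %| r) #|c|)%N.
have left : ratr (\sum_s c s * (P s)%:R) = \sum_(la <- nonempty_parts k | (sumn la <= m)%N)
    ratr (hform (sch la * hs (m - sumn la)) g) * \tr (W la d).
  rewrite rmorph_sum /=.
  under eq_bigr => s _ do rewrite rmorphM /= ratr_nat
    -(sum_character s dec kn mk mu_part mu_n0 muk dE) mulr_sumr.
  rewrite exchange_big /= [RHS]big_mkcond /= big_seq [RHS]big_seq; apply: eq_bigr => la.
  rewrite mem_nonempty_parts => /and3P[la_part la0 _].
  have la_n0 : la != [::] by apply: contraTneq la0 => ->.
  under eq_bigr => s _ do rewrite mulrA -rmorphM /=.
  rewrite -mulr_suml -rmorph_sum /=; case: leqP => [lm|ml]; last first.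
    by rewrite big1 ?rmorph0 ?mul0r // => s _; rewrite rook_char_gt // mulr0.
  congr (ratr _ * _); rewrite -rook_char_ch // hformZl hform_suml mulr_sumr.
  by apply: eq_bigr => s _; rewrite hformZl /c -mulrA; congr (_ * _); rewrite mulrC.
have right : \sum_s c s * (P s)%:R = \sum_(la <- nonempty_parts k | (sumn la <= m)%N)
    hform (sch la * hs (m - sumn la)) g * X la.
  rewrite -sum_parts ?pleth_pairing_nil ?mulr0 //.
  have /(congr1 (hform^~ g)) := @pleth_pairing_ch _ mu m mu_notin0 (leqnn _).
  rewrite hformZl !hform_suml mulr_sumr => E.
  transitivity (\sum_(s : 'S_m) (m`!%:R : rat)^-1 * hform ((P s)%:R *: wt s) g).
    by apply: eq_bigr => s _; rewrite hformZl /c -mulrA; congr (_ * _); rewrite mulrC.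
  rewrite E; apply: eq_bigr => l _; rewrite hform_suml big_seq [RHS]big_seq.
  apply: eq_bigr => la; rewrite mem_parts => /andP[_ /eqP ->].
  by rewrite hformZl mulrC.
under eq_bigr => la _ do rewrite mulrBr -rmorphM /=.
by rewrite sumrB -left right rmorph_sum subrr.
Qed.

(** Take m = |la| and test against s_la. Smaller partitions drop out by induction, those of the same
    size by orthonormality, and [la] itself has coefficient 1. *)
Lemma character_pairing la : is_part la -> (0 < sumn la <= k)%N ->
  \tr (W la d) = ratr (X la).
Proof.
move=> la_part la_k; apply/eqP; rewrite -subr_eq0; apply/eqP.
have [m] := ubnP (sumn la);
  elim: m la la_part la_k => // m IH la la_part /andP[la0 lak] lam.
have := character_ch (sch la) lak.
rewrite big_mkcond (bigD1_seq la) ?nonempty_parts_uniq ?mem_nonempty_parts ?la_part ?la0 //=.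
rewrite leqnn subnn hs0 mulr1 sch_orth // eqxx ratr_nat mul1r big_seq_cond big1 ?addr0 //.
move=> ka /andP[]; rewrite mem_nonempty_parts => /andP[ka_part kak] ne.
case: leqP => // kala.
have [lt|ge] := ltnP (sumn ka) (sumn la).
  by rewrite (IH ka) ?mulr0 // (leq_trans lt).
have -> : (sumn la - sumn ka)%N = 0%N by apply/eqP; rewrite subn_eq0.
by rewrite hs0 mulr1 sch_orth // (negPf ne) ratr_nat mul0r.
Qed.

End Main.

Lemma sym_deg_psum_part mu : 0%N \notin mu -> sym_deg (psum_part mu) = sumn mu.
Proof.
move=> mu0; have [t tE] : exists t, pwp mu = mon t.
  elim: mu {mu0} => [|r mu [t tE]]; first by exists mone; rewrite /pwp big_nil mon1.
  by exists (mmul (ucm r.-1) t); rewrite /pwp big_cons -/(pwp mu) tE pwE monM.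
rewrite -lam_val_pwp /sym_deg -[msupp _]/(lsupp _) tE lsupp_mon big_seq_fset1.
apply: (@homog_pwp mu mu0); rewrite tE mcf_mon eqxx; exact: oner_neq0.
Qed.

Lemma hat_pairing_pleth hall la mu : is_hall hall -> 0%N \notin mu ->
  hat_pairing hall (pleth (schur la) Omega_minus1) (psum_part mu)
    = pleth_pairing (sumn mu) mu (sch la).
Proof.
move=> hallP mu0; rewrite /hat_pairing sym_deg_psum_part //; apply: eq_bigr => i _.
rewrite -lam_val_sch -lam_val_pwp (@coef_pleth_Omega1 (sumn mu)); last by rewrite -ltnS.
by rewrite hall_hform.
Qed.

Lemma pleth_pairing_lt la mu : (sumn mu < sumn la)%N ->
  pleth_pairing (sumn mu) mu (sch la) = 0.
Proof.
move=> lt; rewrite /pleth_pairing big1 // => i _.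
rewrite (@coef_pleth_Omega1_lt _ (sumn la)) ?hform0l //; first exact: homog_sch.
exact: leq_trans (ltn_ord i) lt.
Qed.

Theorem corollary6p3 (R : realType) (k n : nat)
    (hall : Lambda -> Lambda -> rat)
    (W : seq nat -> PP_module (complex R) k)
    (la mu : seq nat) :
  (0 < k)%N -> (k <= n)%N ->
  is_hall hall ->
  (forall nu, is_part nu -> (0 < sumn nu <= k)%N -> PP_irreducible (W nu)) ->
  tensor_decomposition n W ->
  is_part la -> is_part mu -> (sumn la <= k)%N -> (sumn mu <= k)%N ->
  chi_PP W la mu
    = ratr (hat_pairing hall (pleth (schur la) Omega_minus1) (psum_part mu))
  /\ ((sumn mu < sumn la)%N -> chi_PP W la mu = 0).
Proof.
move=> _ kn hallP _ dec la_part mu_part lak muk.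
have mu0 : 0%N \notin mu by case/andP: mu_part.
rewrite hat_pairing_pleth //.
suff -> : chi_PP W la mu = ratr (pleth_pairing (sumn mu) mu (sch la)).
  by split=> // /pleth_pairing_lt ->; rewrite rmorph0.
(* For empty [mu] only degree 0 counts, where s_la[Omega - 1] is 1 if [la] is empty and 0 otherwise,
   as the convention prescribes. *)
rewrite /chi_PP; have [mu_nil|mu_n0] := eqVneq mu [::].
  rewrite mu_nil /= andbT orbT; have [->|la_n0] := eqVneq la [::].
    rewrite /pleth_pairing big_ord1 sch_nil (rmorph1 (pleth_Omega1 _)) coef1 /= /pwp big_nil hform1.
    by rewrite eps1 (rmorph1 ratr).
  rewrite (@pleth_pairing_lt la [::]) ?rmorph0; last exact: sumn_gt0.
  by case: (la) la_n0.
have -> : nilp mu = false by case: (mu) mu_n0.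
rewrite orbF andbF; case: nilP => [->|la_n0]; first by rewrite pleth_pairing_nil ?rmorph0.
have mu_gt0 : (0 < sumn mu)%N by exact: sumn_gt0.
have mu_PP : is_PP (ext_blocks k (cycle_perm mu)) by apply: ext_blocksP; rewrite mu_gt0.
rewrite /d_part (insubT _ mu_PP).
apply: (character_pairing kn dec) => //.
by rewrite lak andbT sumn_gt0 //; apply/eqP.
Qed.
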